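(* Let $0<\epsilon<1$, let $D\subset\mathbb{R}^3$ be a bounded Lipschitz domain, and let $\mathcal{L}$ be the operator $\mathcal{L}u=-\nabla\cdot(A(x)\nabla u)$, $x\in D$, with $u|_{\partial D}=0$, where $A(x)\in\mathbb{R}^{3\times3}$ is symmetric positive definite for every $x\in D$, has entries $A_{ij}\in L^\infty(D)$, and is uniformly elliptic. Let $G$ be the Green's function associated with $\mathcal{L}$, and let $K:D\times D\to\mathbb{R}$ be a continuous symmetric positive definite kernel, used as the covariance kernel for generating random input functions. Then there is a randomized algorithm that constructs an approximation $\tilde G$ of $G$ using $\mathcal{O}(\epsilon^{-6}\log^4(1/\epsilon))$ input-output pairs of $\mathcal{L}$ such that, as $\epsilon\to0$, $$\|G-\tilde G\|_{L^2(D\times D)}=\mathcal{O}\big(\Gamma_\epsilon^{-1/2}\log^3(1/\epsilon)\,\epsilon\big)\,\|G\|_{L^2(D\times D)}$$ with probability $\ge1-\mathcal{O}(\epsilon^{\log(1/\epsilon)-6})$, where $\Gamma_\epsilon$ is the quality measure of the kernel $K$ defined in the context.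
   Context: Operator and Green's function: uniformly elliptic means $\lambda_{\min}=\inf_{x\in D}\lambda_{\min}(A(x))>0$; put $\lambda_{\max}=\sup_{x\in D}\lambda_{\max}(A(x))<\infty$ and $\kappa_C=\lambda_{\max}/\lambda_{\min}$. The operator $\mathcal{L}$ acts from $\mathcal{H}^2(D)\cap\mathcal{H}^1_0(D)$ to $L^2(D)$. The Green's function is the unique nonnegative function $G:D\times D\to\mathbb{R}^+\cup\{\infty\}$ such that for each $y\in D$ and $r>0$, $G(\cdot,y)\in\mathcal{H}^1(D\setminus B_r(y))\cap\mathcal{W}^{1,1}_0(D)$, where $B_r(y)$ is the open ball of radius $r$ about $y$, and for $f\in\mathcal{C}_c^\infty(D)$ the solution of $\mathcal{L}u=f$, $u|_{\partial D}=0$, is $u(x)=\int_DG(x,y)f(y)\,dy$. It is symmetric, lies in $L^2(D\times D)$, and the solution for $f\in L^2(D)$ is given by the same formula. Algorithm and data: an input-output pair is $(f,u)$ with $\mathcal{L}u=f$, $u|_{\partial D}=0$. The inputs are selected by the algorithm: it may draw them at random (from Gaussian processes built by restricting $K$ to subdomains of $D$ and extending samples by zero) and may choose later inputs using earlier outputs; it accesses $\mathcal{L}$ only through the pairs, its parameters ($\epsilon$, $D$, $K$ and the constants $c$, $c_{\kappa_C}$ below) being given. Probability is over the random inputs. Implied constants do not depend on $\epsilon$. $\log$ is the natural logarithm. Kernel: $K(x,y)=\sum_{j\ge1}\lambda_j\psi_j(x)\psi_j(y)$ (absolutely and uniformly convergent) with $\{\psi_j\}$ an orthonormal basis of $L^2(D)$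 of eigenfunctions of the integral operator with kernel $K$, eigenvalues $\lambda_1\ge\lambda_2\ge\cdots>0$ (positive definite means all are strictly positive), and $\operatorname{Tr}(K)=\sum_j\lambda_j<\infty$. Target rank: fix $\rho=1/\sqrt3$. Set $k_\epsilon=\lceil c\rceil\lceil\log(1/\epsilon)\rceil^4+\lceil\log(1/\epsilon)\rceil$, where $c=c(\rho,\operatorname{diam}D,\kappa_C)$ is a constant depending only on $\rho,\operatorname{diam}D,\kappa_C$ such that for all $X,Y\subset D$ with $\operatorname{dist}(X,Y)\ge\rho\max\{\operatorname{diam}X,\operatorname{diam}Y\}$ and every $0<\epsilon<1$ there are $k\le k_\epsilon$ and $G_k(x,y)=\sum_{j=1}^kg_j(x)h_j(y)$ with $g_j\in L^2(X)$, $h_j\in L^2(Y)$ and $\|G-G_k\|_{L^2(X\times Y)}\le\epsilon\|G\|_{L^2(X\times\hat Y)}$, where $\hat Y=\{y\in D:\operatorname{dist}(y,Y)\le\frac\rho2\operatorname{diam}Y\}$. (Existence of such a constant is a known result of Bebendorf and Hackbusch.) Hierarchical partition: after translating and scaling, $D$ is identified with a domain of diameter $1$ contained in $[0,1]^3$ (for general $D$, the partition below is transported back by the inverse translation and scaling). For $L\ge0$, the level-$L$ cubes are the $8^L$ closed dyadic cubes of side $2^{-L}$ in $[0,1]^3$, each indexed by its integer position $(j_1,j_2,j_3)$, $0\le j_i<2^L$; each cube has 8 children at level $L+1$ obtained by bisecting each side. Let $P_{\text{non-adm}}(L)$ be the set of pairs $\tau\times\sigma$ of level-$L$ cubes with positions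 $j,\tilde j$ satisfying $|j_i-\tilde j_i|\le1$ for $i=1,2,3$. Let $\Lambda(P_{\text{non-adm}}(L-1))$ be the set of all pairs (child of $\tau$)$\times$(child of $\sigma$) with $\tau\times\sigma\in P_{\text{non-adm}}(L-1)$. The number of levels is $$n_\epsilon=\big\lceil\log_2\big(54\pi^2(6+\sqrt3)c_{\kappa_C}^2\big)+2\log_2(1/\epsilon)\big\rceil,$$ where $c_{\kappa_C}$ is a constant (in the paper, depending only on $\kappa_C$) such that, on the normalized domain, $G(x,y)\le\frac{c_{\kappa_C}}{\|x-y\|_2}\|G\|_{L^2(D\times D)}$ for almost every $x\ne y\in D$. The set of admissible domains is $$P_{\text{adm}}=\bigcup_{L=1}^{n_\epsilon}\Lambda(P_{\text{non-adm}}(L-1))\setminus P_{\text{non-adm}}(L),$$ each pair $\tau\times\sigma$ being intersected with $D\times D$ to give $X\times Y=(\tau\cap D)\times(\sigma\cap D)$ (nonempty intersections only). Kernel quality: for $X\times Y\in P_{\text{adm}}$ and $k\ge1$, let $v_{1,X\times Y},\ldots,v_{k,X\times Y}\in L^2(Y)$ be the first $k$ right singular functions of the Hilbert--Schmidt integral operator $L^2(Y)\to L^2(X)$ with kernel $G|_{X\times Y}$ (singular values in nonincreasing order), and let $\mathcal{R}_Y^*v$ denote the extension of $v\in L^2(Y)$ by zero to $D$. Put $$[\mathbf{C}_{X\times Y}]_{ij}=\int_{D\times D}\mathcal{R}_Y^*v_{i,X\times Y}(x)\,K(x,y)\,\mathcal{R}_Y^*v_{j,X\times Y}(y)\,dx\,dy,\quad1\le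 i,j\le k,\qquad\gamma_{k,X\times Y}=\frac{k}{\lambda_1\operatorname{Tr}(\mathbf{C}_{X\times Y}^{-1})},$$ and $$\Gamma_\epsilon=\min\{\gamma_{k_\epsilon,X\times Y}:X\times Y\in P_{\text{adm}}\}.$$ *)

(* Defs.v *)
From HB Require Import structures.
From mathcomp Require Import all_boot all_order all_algebra.
From mathcomp Require Import all_classical all_reals all_analysis.
From mathcomp Require Import measurable_realfun.

Set Implicit Arguments.
Unset Strict Implicit.
Unset Printing Implicit Defensive.

Import Order.TTheory GRing.Theory Num.Theory.
Import numFieldNormedType.Exports.

Local Open Scope classical_set_scope.
Local Open Scope ring_scope.

(* Three-dimensional space.  Topology, normed-module structure and Borel
   sigma-algebra are those of the product R * R * R; the library norm on it is
   the sup norm, so Euclidean distances are introduced separately ([edist]). *)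
Definition R3 (R : realType) : Type := (R * R) * R.

HB.instance Definition _ (R : realType) :=
  NormedModule.copy (R3 R) ((R * R) * R)%type.
HB.instance Definition _ (R : realType) := Measurable.copy (R3 R)
  ((measurableTypeR R * measurableTypeR R) * measurableTypeR R)%type.

Section lebesgue_measure_3.
Variable R : realType.
Local Notation line := (measurableTypeR R).
Local Notation leb := (@lebesgue_measure R).

Lemma product_measure_sigma_finite d1 d2 (T1 : measurableType d1)
    (T2 : measurableType d2) (m1 : {sigma_finite_measure set T1 -> \bar R})
    (m2 : {sigma_finite_measure set T2 -> \bar R}) :
  sigma_finite setT (m1 \x m2)%E.
Proof.
have /sigma_finiteP[F [TF ndF Foo]] := sigma_finiteT m1.
have /sigma_finiteP[G [TG ndG Goo]] := sigma_finiteT m2.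
exists (fun n => F n `*` G n).
  rewrite -setXTT TF TG predeqE => -[x y]; split.
    move=> [/= [n _ Fnx] [k _ Gky]]; exists (maxn n k) => //; split.
    - by move: x Fnx; exact/subsetPset/ndF/leq_maxl.
    - by move: y Gky; exact/subsetPset/ndG/leq_maxr.
  by move=> [n _ []/= ? ?]; split; exists n.
move=> k; have [? ?] := Foo k; have [? ?] := Goo k.
split; first exact: measurableX.
by rewrite product_measure1E// lte_mul_pinfty// ge0_fin_numE.
Qed.

Definition lebesgue2 : set (line * line) -> \bar R := (leb \x leb)%E.
HB.instance Definition _ := Measure.on lebesgue2.
HB.instance Definition _ := Measure_isSigmaFinite.Build _ _ _ lebesgue2
  (product_measure_sigma_finite leb leb).

Definition lebesgue3 : set (line * line * line) -> \bar R :=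
  (lebesgue2 \x leb)%E.
HB.instance Definition _ := Measure.on lebesgue3.
HB.instance Definition _ := Measure_isSigmaFinite.Build _ _ _ lebesgue3
  (product_measure_sigma_finite lebesgue2 leb).

Definition mu3 : {sigma_finite_measure set (R3 R) -> \bar R} :=
  (lebesgue3 : {sigma_finite_measure set (line * line * line)%type -> \bar R}).

Definition mu6 : {measure set (R3 R * R3 R)%type -> \bar R} := (mu3 \x mu3)%E.

End lebesgue_measure_3.
Arguments mu3 {R}.
Arguments mu6 {R}.

Section euclidean_geometry.
Variable R : realType.
Implicit Types (x y : R3 R) (X Y : set (R3 R)).

Definition coord x (i : 'I_3) : R := nth 0 [:: x.1.1; x.1.2; x.2] i.

Definition basis_vec (i : 'I_3) : R3 R :=
  (((i == 0 :> nat)%:R, (i == 1 :> nat)%:R), (i == 2 :> nat)%:R).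

Definition edist x y : R :=
  Num.sqrt (\sum_(i < 3) (coord x i - coord y i) ^+ 2).

Definition eball y (r : R) : set (R3 R) := [set x | edist x y < r].

Definition diam X : R := sup [set edist p.1 p.2 | p in X `*` X].

(* Extended-real valued, so that the distance to the empty set is +oo. *)
Definition set_dist X Y : \bar R :=
  ereal_inf [set (edist p.1 p.2)%:E | p in X `*` Y].

(* A bounded domain whose boundary is, near each of its points p and in
   suitable orthonormal coordinates (the rows of Q) centred at p, the graph of
   a Lipschitz function, with the domain lying above the graph. *)
Definition lipschitz_domain (D : set (R3 R)) : Prop :=
  [/\ open D, connected D, D !=set0, bounded_set D &
   forall p, closure D p -> ~ D p ->
   exists (Q : 'M[R]_3) (phi : R * R -> R) (U : set (R3 R)),
   let loc x (i : 'I_3) := \sum_(k < 3) Q i k * (coord x k - coord p k) in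
   [/\ Q *m Q^T = 1%:M, [lipschitz phi t | t in setT], open U, U p &
    D `&` U =
      [set x | U x /\ phi (loc x ord0, loc x (inord 1)) < loc x ord_max]]].

End euclidean_geometry.

Section function_spaces.
Variable R : realType.
Implicit Types (U : set (R3 R)) (u f g phi : R3 R -> R) (p : \bar R).

Definition inLp p U f : Prop := (f \_ U) \in Lfun mu3 p.

Definition Lp_dist p U f g : \bar R :=
  'N[mu3]_p[EFin \o ((fun x => f x - g x)%R \_ U)]%E.

Definition inner U f g : R := \int[mu3]_(x in U) (f x * g x).

Definition partial (i : 'I_3) f : R3 R -> R :=
  fun x => derive f x (basis_vec R i).

Fixpoint Ck (k : nat) f : Prop :=
  if k is k'.+1 then
    continuous f /\
    forall i, (forall x, derivable f x (basis_vec R i)) /\ Ck k' (partial i f)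
  else continuous f.

Definition test_function U phi : Prop :=
  let supp := closure [set x | phi x != 0] in
  [/\ forall k, Ck k phi, compact supp & supp `<=` U].

Definition weak_gradient U u (w : 'I_3 -> R3 R -> R) : Prop :=
  forall phi, test_function U phi -> forall i,
  inner U u (partial i phi) = - inner U (w i) phi.

(* u belongs to W^{1,p}(U), with weak gradient w. *)
Definition sobolev_with p U u w : Prop :=
  [/\ inLp p U u, forall i, inLp p U (w i) & weak_gradient U u w].

(* u belongs to W^{1,p}_0(U), the closure of C_c^infty(U) in W^{1,p}(U),
   with weak gradient w. *)
Definition sobolev0_with p U u w : Prop :=
  sobolev_with p U u w /\
  exists phi : nat -> R3 R -> R,
  [/\ forall n, test_function U (phi n),
      Lp_dist p U u (phi n) @[n --> \oo] --> 0%E &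
      forall i, Lp_dist p U (w i) (partial i (phi n)) @[n --> \oo] --> 0%E].

Definition sobolev p U u : Prop := exists w, sobolev_with p U u w.
Definition sobolev0 p U u : Prop := exists w, sobolev0_with p U u w.

Definition orthonormal U (e : nat -> R3 R -> R) : Prop :=
  (forall j, inLp 2%:E U (e j)) /\
  forall i j, inner U (e i) (e j) = (i == j)%:R.

Definition orthonormal_basis U (e : nat -> R3 R -> R) : Prop :=
  orthonormal U e /\
  forall f, inLp 2%:E U f ->
  Lp_dist 2%:E U f (fun x => \sum_(j < n) inner U f (e j) * e j x)
    @[n --> \oo] --> 0%E.

(* Norm of L^2(X x Y) for an extended-real valued function. *)
Definition L2norm2 (X Y : set (R3 R)) (H : R3 R * R3 R -> \bar R) : \bar R :=
  'N[mu6]_2%:E[H \_ (X `*` Y)]%E.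

End function_spaces.

Section elliptic_operator.
Variable R : realType.
Variables (D : set (R3 R)) (A : R3 R -> 'M[R]_3).

Definition lambda_min (M : 'M[R]_3) : R := inf [set l | eigenvalue M l].
Definition lambda_max (M : 'M[R]_3) : R := sup [set l | eigenvalue M l].

Record elliptic_coefficient : Prop := EllipticCoefficient {
  coef_sym : forall x, D x -> (A x)^T = A x;
  coef_posdef : forall x, D x ->
    forall v : 'rV[R]_3, v != 0 -> 0 < (v *m A x *m v^T) ord0 ord0;
  coef_Linfty : forall i j, inLp +oo%E D (fun x => A x i j);
  coef_lambda_min : 0 < inf [set lambda_min (A x) | x in D];
  coef_lambda_max : has_ubound [set lambda_max (A x) | x in D] }.

(* The pair (f, u) satisfies - div (A grad u) = f in D, u = 0 on the boundary:
   since A is only bounded and measurable, the equation is understood in the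
   weak sense, with u in H^1_0(D) and f in L^2(D). *)
Definition solves (f u : R3 R -> R) : Prop :=
  inLp 2%:E D f /\
  exists w, sobolev0_with 2%:E D u w /\
  forall phi, test_function D phi ->
  \int[mu3]_(x in D)
     (\sum_(i < 3) \sum_(j < 3) A x i j * w j x * partial i phi x) =
  inner D f phi.

Variable G : R3 R * R3 R -> \bar R.

Definition green_potential (f : R3 R -> R) : R3 R -> R :=
  fun x => fine (\int[mu3]_(y in D) (G (x, y) * (f y)%:E))%E.

(* The Sobolev space on D \ B_r(y) is that of the interior of this set. *)
Record green_function : Prop := GreenFunction {
  green_ge0 : forall x y, D x -> D y -> (0 <= G (x, y))%E;
  green_measurable : measurable_fun (D `*` D) G;
  green_fin : forall y, D y -> {ae mu3, forall x, D x -> (G (x, y) < +oo)%E};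
  green_H1 : forall y r, D y -> 0 < r ->
    sobolev 2%:E (interior (D `\` eball y r)) (fun x => fine (G (x, y)));
  green_W110 : forall y, D y -> sobolev0 1%:E D (fun x => fine (G (x, y)));
  green_solves : forall f, test_function D f -> solves f (green_potential f) }.

(* Known consequences of [green_function] for elliptic coefficients.  Since
   G(., y) is only determined almost everywhere, so is the symmetry. *)
Record green_function_facts : Prop := GreenFunctionFacts {
  green_sym : {ae mu6, forall z : R3 R * R3 R,
    (D `*` D) z -> G z = G (z.2, z.1)};
  green_L2 : (L2norm2 D D G < +oo)%E;
  green_solves_L2 : forall f, inLp 2%:E D f -> solves f (green_potential f) }.

End elliptic_operator.

Section covariance_kernel.
Variables (R : realType) (D : set (R3 R)) (K : R3 R * R3 R -> R).
Variables (lam : nat -> R) (psi : nat -> R3 R -> R).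

(* K is a continuous symmetric positive definite kernel on D x D with Mercer
   expansion given by lam and psi; the eigenvalues are indexed from 0. *)
Record covariance_kernel : Prop := CovarianceKernel {
  kernel_continuous : {within D `*` D, continuous K};
  kernel_sym : forall x y, D x -> D y -> K (x, y) = K (y, x);
  kernel_basis : orthonormal_basis D psi;
  kernel_eigen : forall j x, D x ->
    \int[mu3]_(y in D) (K (x, y) * psi j y) = lam j * psi j x;
  kernel_lam_noninc : forall i j, (i <= j)%N -> lam j <= lam i;
  kernel_lam_gt0 : forall j, 0 < lam j;
  kernel_trace : cvgn (series lam);
  kernel_abs_cvg : forall x y, D x -> D y ->
    cvgn (series (fun j => `|lam j * psi j x * psi j y|));
  kernel_unif_cvg : forall e, 0 < e -> \forall n \near \oo,
    forall x y, D x -> D y ->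
    `|K (x, y) - \sum_(j < n) lam j * psi j x * psi j y| < e }.

End covariance_kernel.

Section target_rank.
Variable R : realType.

Definition rho : R := (Num.sqrt 3)^-1.

Definition logV (eps : R) : R := ln eps^-1.

Definition k_eps (c eps : R) : nat :=
  (`|Num.ceil c| * `|Num.ceil (logV eps)| ^ 4 + `|Num.ceil (logV eps)|)%N.

Definition enlarge (D Y : set (R3 R)) : set (R3 R) :=
  [set y | D y /\ (set_dist [set y] Y <= (rho / 2 * diam Y)%:E)%E].

Definition low_rank_constant (D : set (R3 R)) (G : R3 R * R3 R -> \bar R)
    (c : R) : Prop :=
  forall X Y : set (R3 R), measurable X -> measurable Y ->
  X `<=` D -> Y `<=` D ->
  ((rho * Num.max (diam X) (diam Y))%:E <= set_dist X Y)%E ->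
  forall eps : R, 0 < eps < 1 ->
  exists (k : nat) (g h : nat -> R3 R -> R),
  [/\ (k <= k_eps c eps)%N,
      forall j, (j < k)%N -> inLp 2%:E X (g j) /\ inLp 2%:E Y (h j) &
      (L2norm2 X Y (fun z => G z - (\sum_(j < k) g j z.1 * h j z.2)%:E)
       <= eps%:E * L2norm2 X (enlarge D Y) G)%E].

End target_rank.

Section hierarchical_partition.
Variables (R : realType) (D : set (R3 R)) (a : R3 R).

(* The change of variables to the normalized domain, of diameter 1. *)
Definition normalize (x : R3 R) : R3 R := (diam D)^-1 *: (x - a).
Definition denormalize (x : R3 R) : R3 R := a + diam D *: x.

Definition normalizing_origin : Prop :=
  forall x, D x -> forall i, 0 <= coord (normalize x) i <= 1.

(* The Green's function of the normalized operator is a positive multiple of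
   [Gn] below; the bound is homogeneous in it. *)
Definition pointwise_constant (G : R3 R * R3 R -> \bar R) (ckappa : R) : Prop :=
  let Dn := normalize @` D in
  let Gn z := G (denormalize z.1, denormalize z.2) in
  {ae mu6, forall z : R3 R * R3 R, (Dn `*` Dn) z -> z.1 <> z.2 ->
    (Gn z <= (ckappa / edist z.1 z.2)%:E * L2norm2 Dn Dn Gn)%E}.

(* ceil (log_2 (54 pi^2 (6 + sqrt 3) ckappa^2) + 2 log_2 (1 / eps)) *)
Definition n_eps (ckappa eps : R) : int :=
  Num.ceil (ln (54 * pi ^+ 2 * (6 + Num.sqrt 3) * ckappa ^+ 2) / ln 2
            + 2 * (logV eps / ln 2)).

Definition position := 'I_3 -> nat.

Definition cube (L : nat) (j : position) : set (R3 R) :=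
  [set x | forall i, (j i)%:R / 2 ^+ L <= coord x i <= (j i).+1%:R / 2 ^+ L].

Definition part (L : nat) (j : position) : set (R3 R) :=
  [set x | D x /\ cube L j (normalize x)].

Definition parent (j : position) : position := fun i => (j i)./2.

Definition P_nonadm (L : nat) : set (position * position) :=
  [set q | forall i, [/\ (q.1 i < 2 ^ L)%N, (q.2 i < 2 ^ L)%N,
                         (q.1 i <= (q.2 i).+1)%N & (q.2 i <= (q.1 i).+1)%N]].

Definition children (P : set (position * position)) :
    set (position * position) :=
  [set q | P (parent q.1, parent q.2)].

Definition P_adm (ckappa eps : R) : set (set (R3 R) * set (R3 R)) :=
  [set XY | exists (L : nat) (q : position * position),
    [/\ (1 <= L)%N, (L%:Z <= n_eps ckappa eps)%R,
        (children (P_nonadm L.-1) `\` P_nonadm L) q,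
        XY = (part L q.1, part L q.2) & XY.1 !=set0 /\ XY.2 !=set0]].

End hierarchical_partition.

Section kernel_quality.
Variable R : realType.
Variables (D : set (R3 R)) (K : R3 R * R3 R -> R) (lam : nat -> R).

(* v is the sequence of right singular functions, in nonincreasing order of
   the singular values s, of the operator L^2(Y) -> L^2(X) with kernel G,
   e being the left singular functions.  For finite rank, the functions
   beyond the rank (with singular value 0) only have to be orthonormal. *)
Definition right_singular_functions (G : R3 R * R3 R -> \bar R)
    (X Y : set (R3 R)) (v : nat -> R3 R -> R) : Prop :=
  exists (s : nat -> R) (e : nat -> R3 R -> R),
  [/\ forall i j, (i <= j)%N -> 0 <= s j <= s i,
      orthonormal X e, orthonormal Y v &
      L2norm2 X Y (fun z => G z - (\sum_(j < n) s j * e j z.1 * v j z.2)%:E)%E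
        @[n --> \oo] --> 0%E].

Definition C_matrix (Y : set (R3 R)) (v : nat -> R3 R -> R) (k : nat) :
    'M[R]_k :=
  \matrix_(i < k, j < k)
    \int[mu6]_(z in D `*` D) ((v i \_ Y) z.1 * K z * (v j \_ Y) z.2).

Definition gamma_quality (Y : set (R3 R)) (v : nat -> R3 R -> R) (k : nat) : R :=
  k%:R / (lam 0%N * \tr (invmx (C_matrix Y v k))).

(* P_adm is finite, so the infimum is a minimum (when P_adm is nonempty, which
   holds for all small eps). *)
Definition Gamma_eps (a : R3 R) (c ckappa eps : R)
    (v : set (R3 R) -> set (R3 R) -> nat -> R3 R -> R) : R :=
  inf [set gamma_quality XY.2 (v XY.1 XY.2) (k_eps c eps)
      | XY in P_adm D a ckappa eps].

End kernel_quality.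

Section randomized_algorithm.
Variables (R : realType) (D : set (R3 R)) (K : R3 R * R3 R -> R).

Definition gaussian_law (v : R) : set R -> \bar R :=
  if v == 0 then dirac (0 : R) else normal_prob 0 (Num.sqrt v).

(* xi_0, ..., xi_(m-1) are independent centred Gaussian processes, xi_i having
   for covariance the restriction of K to Y_i x Y_i, with samples extended by
   zero.  Independence and Gaussianity are stated together: the family indexed
   by pairs (i, x) is a centred Gaussian process in which the covariance of
   distinct xi_i, xi_j vanishes. *)
Definition independent_gaussian_draws d (Omega : measurableType d)
    (P : probability Omega R) (m : nat) (Y : 'I_m -> set (R3 R))
    (xi : 'I_m -> Omega -> R3 R -> R) : Prop :=
  let cov (s t : 'I_m * R3 R) : R :=
    if s.1 == t.1 then (K \_ (Y s.1 `*` Y s.1)) (s.2, t.2) else 0 in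
  [/\ forall i, measurable (Y i) /\ Y i `<=` D,
      forall i, measurable_fun setT (fun p : Omega * R3 R => xi i p.1 p.2),
      forall i omega x, ~ Y i x -> xi i omega x = 0 &
      forall n (t : 'I_n -> 'I_m * R3 R) (b : 'I_n -> R) (B : set R),
        measurable B ->
        P [set omega | B (\sum_(l < n) b l * xi (t l).1 omega (t l).2)] =
        gaussian_law (\sum_(l < n) \sum_(l' < n) b l * b l' * cov (t l) (t l'))
          B].

(* A randomized algorithm with access to the operator through [ra_npairs]
   input-output pairs.  The next input is a function of the random draws and of
   the list of the outputs obtained so far; the approximation is a function of
   the draws and of all the outputs. *)
Record randomized_algorithm := RandomizedAlgorithm {
  ra_display : measure_display;
  ra_space : measurableType ra_display;
  ra_prob : probability ra_space R;
  ra_ndraws : nat;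
  ra_subdomain : 'I_ra_ndraws -> set (R3 R);
  ra_draw : 'I_ra_ndraws -> ra_space -> R3 R -> R;
  ra_drawP : independent_gaussian_draws ra_prob ra_subdomain ra_draw;
  ra_npairs : nat;
  ra_input : ('I_ra_ndraws -> R3 R -> R) -> seq (R3 R -> R) -> R3 R -> R;
  ra_inputP : forall xi us, inLp 2%:E D (ra_input xi us);
  ra_output :
    ('I_ra_ndraws -> R3 R -> R) -> seq (R3 R -> R) -> R3 R * R3 R -> R;
  ra_outputP : forall xi us,
    (ra_output xi us \_ (D `*` D)) \in Lfun mu6 2%:E }.

(* us is the list of outputs obtained when the algorithm is run, at the sample
   point omega, on the operator with coefficient A. *)
Definition transcript (alg : randomized_algorithm) (A : R3 R -> 'M[R]_3)
    (omega : ra_space alg) (us : seq (R3 R -> R)) : Prop :=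
  let xi i := ra_draw i omega in
  size us = ra_npairs alg /\
  forall i, (i < ra_npairs alg)%N ->
  solves D A (ra_input xi (take i us)) (nth (cst 0) us i).

Definition green_approximation (alg : randomized_algorithm) (omega : ra_space alg)
    (us : seq (R3 R -> R)) : R3 R * R3 R -> R :=
  ra_output (fun i => ra_draw i omega) us.

End randomized_algorithm.

(* Main.v *)
From HB Require Import structures.
From mathcomp Require Import all_boot all_order all_algebra.
From mathcomp Require Import all_classical all_reals all_analysis.
From mathcomp Require Import measurable_realfun ring lra zify.
Require Import Defs.
Import Order.TTheory GRing.Theory Num.Theory.
Import numFieldNormedType.Exports.
Local Open Scope classical_set_scope.
Local Open Scope ring_scope.
Set Implicit Arguments.
Unset Strict Implicit.
Unset Printing Implicit Defensive.

(* The approximation is deterministic.  Enclose D in a cube cut into 8^L boxes Q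
   of side h ~ 2^-L, take the indicators 1_Q as inputs, with outputs u_Q, and let
   Gt(x, y) = sum_Q u_Q(x) 1_Q(y) / |Q|, the projection of G on the functions
   constant in y on the boxes.  With beta(f, g) the quadratic form of the Green
   operator and F(L, M) the sum of beta(1_P, 1_Q)^2 / (|P| |Q|) over the boxes P of
   level L and Q of level M, Bessel's inequality gives
   ||G - Gt||^2 <= ||G||^2 - F(L, L), and F(L, L) tends to ||G||^2.
   Going from level L to L + 1 in one variable adds the squares of the pairings of
   the u_Q with zero-mean combinations of the children of a box; such a combination
   is a sum of derivatives d_i B_i with |B_i| <= h, so the gain is at most
   C h^2 times the sum of ||grad u_Q||^2 / |Q|.  By ellipticity ||grad u_Q||^2 is at
   most a constant times beta(1_Q, 1_Q), which decays like 32^-L (again by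
   comparing a box with its children).  Summing over the levels,
   ||G - Gt||^2 = O(2^-L), and 2^L ~ eps^-2 gives an error O(eps) from O(eps^-6)
   pairs.  Finally 0 < Gamma_eps <= 1 for small eps: the matrices C are positive
   definite and bounded by lambda_1, so that each diagonal entry of C^-1 is at
   least 1 / lambda_1. *)

(** The obstacle is to gain powers of the box side near the boundary and the diagonal without
    regularity of A. Extension by zero removes the first difficulty: functions in H^1_0 are limits
    of test functions of D, so the fields B_i can be paired with their gradients on any box, whether
    or not it crosses the boundary. For the second, only the energy of an indicator matters; its
    rate is that of the integral of 1/|x - y| over Q x Q, which scales as h^5, whence 32 = 2^5. The
    convergence of F(L, L) to ||G||^2 is qualitative, by density of step functions; the rate comes
    from summing the gains over all finer levels. Symmetry of beta turns a gain in one variable into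
    a gain in the other. The outputs are arbitrary weak solutions and have to be identified with the
    potentials of G. Equal gradients make two solutions agree on all zero-mean combinations of
    boxes; a box outside D then fixes the remaining constant, which is why the cube is twice as wide
    as the region known to contain D. The constants may depend on A and G, so an additive bound on
    ||G - Gt||^2 becomes relative on division by ||G||^2. *)

(** At (y, -z) the form equals y (x y - z^2), which settles y > 0. If y = 0 and z is nonzero, it
    takes the value - x - 2 at (1, - (x + 1) / z). This is the common source of the Cauchy-Schwarz
    inequalities for integrals and for matrices. *)
Lemma psd_discriminant (R : realFieldType) (x y z : R) :
  (forall a b, 0 <= a ^+ 2 * x + 2 * (a * b) * z + b ^+ 2 * y) ->
  z ^+ 2 <= x * y.
Proof.
move=> key; have := key (y + 1) (- z); have := key y (- z).
have x0 : 0 <= x by have := key 1 0; rewrite expr1n expr0n /=; lra.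
have y0 : 0 <= y by have := key 0 1; rewrite expr1n expr0n /=; lra.
have [y1 K1 _|y1] := ltrP 0 y; first by nra.
have yE : y = 0 by apply/eqP; rewrite eq_le y1.
have [->|z0] := eqVneq z 0; first by rewrite expr0n mulr_ge0.
have := key 1 (- (x + 1) / z).
have -> : 2 * (1 * (- (x + 1) / z)) * z = - 2 * (x + 1) by field.
by rewrite yE; move=> *; lra.
Qed.

(** * Square-integrable functions and their inner product *)

Section square_integrable.
Context {d : measure_display} {T : measurableType d} {R : realType}.
Variable mu : {measure set T -> \bar R}.
Implicit Types f g h : T -> R.

(** Functions are total, and those on a domain are extended by zero, so that one real-valued inner
    product serves every domain. *)
Definition L2f f : Prop :=
  measurable_fun setT f /\ mu.-integrable setT (EFin \o (fun x => f x ^+ 2)).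

Definition ip f g : R := \int[mu]_x (f x * g x).

Lemma L2f_mul f g : L2f f -> L2f g ->
  mu.-integrable setT (EFin \o (fun x => f x * g x)).
Proof.
move=> [mf f2] [mg g2].
apply: (le_integrable measurableT _ _ (integrableD measurableT f2 g2)).
  by apply/measurable_EFinP; exact: measurable_funM.
move=> x _ /=; rewrite lee_fin.
rewrite (le_trans _ (ler_norm _))// ler_norml.
have := sqr_ge0 (f x - g x); have := sqr_ge0 (f x + g x).
have := sqr_ge0 (f x); have := sqr_ge0 (g x).
by move=> *; apply/andP; split; nra.
Qed.

Lemma L2fE f : L2f f <-> f \in Lfun mu 2%:E.
Proof.
split=> [[mf f2]|f2]; last first.
  split; last exact: Lfun2_integrable_sqr.
  by move: f2; rewrite inE => /andP[/[!inE]/= mf _].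
rewrite inE; apply/andP; split; rewrite inE//=.
rewrite /finite_norm unlock /Lnorm poweR_lty//.
move/integrableP : f2 => [_]; apply: le_lt_trans.
rewrite le_eqVlt; apply/orP; left; apply/eqP; apply: eq_integral => x _.
by rewrite /= normrX -powR_mulrn// normr_ge0.
Qed.

Lemma L2fD f g : L2f f -> L2f g -> L2f (fun x => f x + g x).
Proof.
move=> Lf Lg; split; first by apply: measurable_funD; [case: Lf|case: Lg].
have /= := integrableD measurableT (integrableD measurableT Lf.2 Lg.2)
  (integrableZl measurableT 2 (L2f_mul Lf Lg)).
apply: eq_integrable => // x _ /=.
by rewrite -!EFinM -!EFinD; congr EFin; ring.
Qed.

Lemma L2fZ a f : L2f f -> L2f (fun x => a * f x).
Proof.
move=> Lf; split; first by apply: measurable_funM => //; case: Lf.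
have /= := integrableZl measurableT (a ^+ 2) Lf.2.
by apply: eq_integrable => // x _ /=; rewrite -EFinM exprMn.
Qed.

Lemma L2fB f g : L2f f -> L2f g -> L2f (fun x => f x - g x).
Proof.
move=> Lf Lg; rewrite (_ : (fun _ => _) = (fun x => f x + (-1) * g x)); last first.
  by apply/funext => x; rewrite mulN1r.
by apply: L2fD => //; exact: L2fZ.
Qed.

Lemma L2f0 : L2f (fun=> 0).
Proof.
split=> //; rewrite (_ : _ \o _ = cst 0); first exact: integrable0.
by apply/funext => x /=; rewrite expr0n.
Qed.

Lemma L2f_sum I (s : seq I) (P : pred I) (F : I -> T -> R) :
  (forall i, P i -> L2f (F i)) -> L2f (fun x => \sum_(i <- s | P i) F i x).
Proof.
move=> LF; elim: s => [|i s IH].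
  by under eq_fun do rewrite big_nil; exact: L2f0.
under eq_fun do rewrite big_cons.
by case: (boolP (P i)) => // Pi; apply: L2fD => //; exact: LF.
Qed.

Lemma L2f_indic (A : set T) : measurable A -> (mu A < +oo)%E -> L2f (\1_A).
Proof.
move=> mA Afin; split; first exact: measurable_indic.
apply/integrableP; split.
  by apply/measurable_EFinP; apply: measurable_funX; exact: measurable_indic.
rewrite (eq_integral (EFin \o \1_A)) ?integral_indic ?setIT// => x _ /=.
by rewrite indicE; case: (_ \in _); rewrite ?expr1n ?expr0n ?normr1 ?normr0.
Qed.

Lemma L2f_bounded (A : set T) f (M : R) : measurable A -> (mu A < +oo)%E ->
  measurable_fun setT f -> (forall x, `|f x| <= M * \1_A x) -> L2f f.
Proof.
move=> mA Afin mf bf; split => //.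
have [_ LA] := L2fZ M (L2f_indic mA Afin).
apply: (le_integrable measurableT _ _ LA).
  by apply/measurable_EFinP; exact: measurable_funX.
move=> x _ /=; rewrite lee_fin !normrX.
rewrite lerXn2r ?nnegrE//; exact: le_trans (bf x) (ler_norm _).
Qed.

Lemma L2f_le f g : measurable_fun setT f -> L2f g ->
  (forall x, `|f x| <= `|g x|) -> L2f f.
Proof.
move=> mf [mg g2] fg; split => //.
apply: (le_integrable measurableT _ _ g2).
  by apply/measurable_EFinP; exact: measurable_funX.
by move=> x _ /=; rewrite lee_fin !normrX lerXn2r ?nnegrE.
Qed.

Lemma L2f_restrict f (A : set T) : measurable A -> L2f f -> L2f (f \_ A).
Proof.
move=> mA Lf; apply: (L2f_le _ Lf) => [|x].
  by apply/(measurable_restrictT _ mA); apply: measurable_funTS; case: Lf.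
by rewrite patchE; case: ifPn => // _; rewrite normr0.
Qed.

Lemma ipC f g : ip f g = ip g f.
Proof. by apply: eq_Rintegral => x _; rewrite mulrC. Qed.

Lemma ipDl f g h : L2f f -> L2f g -> L2f h ->
  ip (fun x => f x + g x) h = ip f h + ip g h.
Proof.
move=> Lf Lg Lh; rewrite /ip -RintegralD//; [|exact: L2f_mul..].
by apply: eq_Rintegral => x _; rewrite mulrDl.
Qed.

Lemma ipZl a f h : L2f f -> L2f h -> ip (fun x => a * f x) h = a * ip f h.
Proof.
move=> Lf Lh; rewrite /ip -RintegralZl//; last exact: L2f_mul.
by apply: eq_Rintegral => x _; rewrite mulrA.
Qed.

Lemma ipBl f g h : L2f f -> L2f g -> L2f h ->
  ip (fun x => f x - g x) h = ip f h - ip g h.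
Proof.
move=> Lf Lg Lh; rewrite /ip -RintegralB//; [|exact: L2f_mul..].
by apply: eq_Rintegral => x _; rewrite mulrBl.
Qed.

Lemma ipDr f g h : L2f f -> L2f g -> L2f h ->
  ip h (fun x => f x + g x) = ip h f + ip h g.
Proof. by move=> *; rewrite ipC ipDl// !(ipC h). Qed.

Lemma ipZr a f h : L2f f -> L2f h -> ip h (fun x => a * f x) = a * ip h f.
Proof. by move=> *; rewrite ipC ipZl// !(ipC h). Qed.

Lemma ipBr f g h : L2f f -> L2f g -> L2f h ->
  ip h (fun x => f x - g x) = ip h f - ip h g.
Proof. by move=> *; rewrite ipC ipBl// !(ipC h). Qed.

Lemma ip0l f : ip (fun=> 0) f = 0.
Proof.
rewrite /ip; under eq_Rintegral do rewrite mul0r.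
by rewrite /Rintegral integral0.
Qed.

Lemma ip_suml I (s : seq I) (P : pred I) (F : I -> T -> R) h :
  (forall i, P i -> L2f (F i)) -> L2f h ->
  ip (fun x => \sum_(i <- s | P i) F i x) h = \sum_(i <- s | P i) ip (F i) h.
Proof.
move=> LF Lh; elim: s => [|i s IH].
  by under [X in ip X _]eq_fun do rewrite big_nil; rewrite big_nil ip0l.
under [X in ip X _]eq_fun do rewrite big_cons.
rewrite big_cons; case: ifPn => // Pi.
by rewrite ipDl ?IH//; [exact: LF|exact: L2f_sum].
Qed.

Lemma ip_sumr I (s : seq I) (P : pred I) (F : I -> T -> R) h :
  (forall i, P i -> L2f (F i)) -> L2f h ->
  ip h (fun x => \sum_(i <- s | P i) F i x) = \sum_(i <- s | P i) ip h (F i).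
Proof.
by move=> LF Lh; rewrite ipC ip_suml//; apply: eq_bigr => i _; rewrite ipC.
Qed.

Lemma ip_ge0 f : 0 <= ip f f.
Proof. by apply: Rintegral_ge0 => x _; rewrite -expr2 sqr_ge0. Qed.

Lemma ip_norm_le f g : L2f f -> L2f g -> (forall x, `|f x| <= `|g x|) ->
  ip f f <= ip g g.
Proof.
move=> Lf Lg fg; apply: le_Rintegral => //; [exact: L2f_mul..|].
move=> x _; rewrite -!expr2 -(real_normK (num_real (f x))).
by rewrite -(real_normK (num_real (g x))) lerXn2r ?nnegrE.
Qed.

Lemma ip_cauchy_schwarz f g : L2f f -> L2f g ->
  ip f g ^+ 2 <= ip f f * ip g g.
Proof.
move=> Lf Lg.
apply: psd_discriminant => a b.
have Laf := L2fZ a Lf; have Lbg := L2fZ b Lg.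
have := ip_ge0 (fun x => a * f x + b * g x).
rewrite ipDl//; last exact: L2fD.
by rewrite !ipDr// !ipZl// !ipZr// (ipC g f) => H; nra.
Qed.

Lemma integral_sqr f : L2f f ->
  (\int[mu]_x (f x ^+ 2)%:E)%E = (ip f f)%:E.
Proof.
move=> Lf; rewrite /ip /Rintegral fineK; last first.
  by apply: integrable_fin_num => //; exact: L2f_mul.
by apply: eq_integral => x _; rewrite expr2.
Qed.

(** The coefficients are left free: the optimal ones give Bessel's inequality, those of a step
    function give the converse estimate, and 1 / |Q| gives the error of the algorithm. *)
Lemma ip_bessel (I : finType) (e : I -> T -> R) (c : I -> R) f :
  L2f f -> (forall i, L2f (e i)) ->
  (forall i j, i != j -> ip (e i) (e j) = 0) ->
  let g x := f x - \sum_i c i * e i x in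
  ip g g = ip f f - 2 * \sum_i c i * ip f (e i) + \sum_i c i ^+ 2 * ip (e i) (e i).
Proof.
move=> Lf Le orth g.
have Lce i : L2f (fun x => c i * e i x) by exact: L2fZ.
have Ls : L2f (fun x => \sum_i c i * e i x) by exact: L2f_sum.
have Lg : L2f g by exact: L2fB.
rewrite ipBl// !ipBr// (ipC _ f).
have -> : ip f (fun x => \sum_i c i * e i x) = \sum_i c i * ip f (e i).
  by rewrite ip_sumr//; apply: eq_bigr => i _; rewrite ipZr.
have -> : ip (fun x => \sum_i c i * e i x) (fun x => \sum_i c i * e i x) =
    \sum_i c i ^+ 2 * ip (e i) (e i).
  rewrite ip_suml//; apply: eq_bigr => i _; rewrite ip_sumr// (bigD1 i)//=.
  rewrite big1 ?addr0; last first.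
    by move=> j ji; rewrite ipZl// ipZr// orth ?mulr0// eq_sym.
  by rewrite ipZl// ipZr//; ring.
by ring.
Qed.

End square_integrable.

(** * Haar functions and their primitives on the line *)

Section haar_tent.
Context {R : realType}.
Local Notation leb := (@lebesgue_measure R).
Implicit Types (a b h t : R) (f g : R -> R).

Definition haar a h t : R := \1_(`[a, a + h[) t - \1_(`[a + h, a + h *+ 2[) t.

(** The continuous primitive of [haar a h] with bounded support; its height [h] is the source of the
    gain of one box side. *)
Definition tent a h t : R :=
  \1_(`[a, a + h[) t * (t - a) + \1_(`[a + h, a + h *+ 2[) t * (a + h *+ 2 - t).

Lemma continuous_integrable_itvco a b f : continuous f ->
  leb.-integrable `[a, b[ (EFin \o f).
Proof.
move=> cf; have : leb.-integrable `[a, b] (EFin \o f).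
  apply: continuous_compact_integrable; first exact: segment_compact.
  exact: continuous_subspaceT.
by apply: integrableS => //; apply: subset_itvl; rewrite bnd_simp.
Qed.

Lemma Rintegral_derive f g (a b : R) : a < b ->
  (forall t : R, is_derive t 1 f (g t)) -> continuous g ->
  \int[leb]_(t in `[a, b[) g t = f b - f a.
Proof.
move=> ab df cg.
have cf : continuous f.
  by move=> t; apply/differentiable_continuous/derivable1_diffP; have [] := df t.
rewrite Rintegral_itv_bndo_bndc; last exact: continuous_integrable_itvco.
rewrite /Rintegral (continuous_FTC2 ab (F := f)) //.
- exact: continuous_subspaceT.
- by split=> [t _||]; [have [] := df t|apply: cvg_at_right_filter; exact: cf|apply: cvg_at_left_filter; exact: cf].
- by move=> t _; rewrite derive1E; exact: derive_val.
Qed.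

Lemma Rintegral_indic_mul (A : set R) f :
  \int[leb]_t (\1_A t * f t) = \int[leb]_(t in A) f t.
Proof.
rewrite [RHS]Rintegral_mkcond; apply: eq_Rintegral => t _.
by rewrite patchE indicE; case: (t \in A); rewrite ?mul1r ?mul0r.
Qed.

Lemma integrable_indic_mul a b f : continuous f ->
  leb.-integrable setT (EFin \o (fun t => \1_(`[a, b[) t * f t)).
Proof.
move=> cf.
move: (continuous_integrable_itvco a b cf).
rewrite integrable_mkcond//; apply: eq_integrable => // t _.
by rewrite /= patchE /= indicE; case: (t \in _); rewrite ?mul1r ?mul0r.
Qed.

(** Integration by parts on each half, with the primitives (t - a) f and (c - t) f: the boundary
    terms at the midpoint, h f(b) and - h f(b), cancel. *)
Lemma integral_haar a h f g : 0 < h ->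
  (forall t : R, is_derive t 1 f (g t)) -> continuous g ->
  \int[leb]_t (haar a h t * f t) = - \int[leb]_t (tent a h t * g t).
Proof.
move=> h0 df cg.
have cf : continuous f.
  by move=> t; apply/differentiable_continuous/derivable1_diffP; have [] := df t.
set b := a + h; set c := a + h *+ 2.
have ab : a < b by rewrite ltrDl.
have bc : b < c by rewrite /b /c mulr2n addrA ltrDl.
have clin (k m : R) : continuous (fun t : R => k * t + m).
  by move=> t; apply: cvgD; [apply: cvgM; [exact: cvg_cst|exact: cvg_id]|exact: cvg_cst].
pose l1 t := 1 * t + - a; pose l2 t := (-1) * t + c.
have cl1 : continuous l1 by exact: clin.
have cl2 : continuous l2 by exact: clin.
have left : \int[leb]_(t in `[a, b[) (f t + l1 t * g t) = h * f b.
  have dl t : is_derive t 1 (fun t => l1 t * f t) (f t + l1 t * g t).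
    by have := df t => dft; apply: is_derive_eq; rewrite /l1 /GRing.scale/=; ring.
  rewrite (Rintegral_derive ab dl) /l1 /b; first by ring.
  by move=> t; apply: cvgD; [exact: cf|apply: cvgM; [exact: cl1|exact: cg]].
have right : \int[leb]_(t in `[b, c[) (- f t + l2 t * g t) = - (h * f b).
  have dl t : is_derive t 1 (fun t => l2 t * f t) (- f t + l2 t * g t).
    by have := df t => dft; apply: is_derive_eq; rewrite /l2 /GRing.scale/=; ring.
  rewrite (Rintegral_derive bc dl) /l2 /b /c; first by rewrite mulr2n; ring.
  move=> t; apply: cvgD; first exact: cvgN (cf t).
  by apply: cvgM; [exact: cl2|exact: cg].
have i1 (p q : R) (k l : R -> R) : continuous k -> continuous l ->
    leb.-integrable setT (EFin \o (fun t => \1_(`[p, q[) t * (k t * l t))).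
  move=> ck cl; apply: (@integrable_indic_mul p q (fun t => k t * l t)) => t.
  by apply: cvgM; [exact: ck|exact: cl].
have H1 : \int[leb]_t (haar a h t * f t) =
    \int[leb]_(t in `[a, b[) f t - \int[leb]_(t in `[b, c[) f t.
  have := RintegralB measurableT (integrable_indic_mul a b cf)
    (integrable_indic_mul b c cf).
  rewrite !Rintegral_indic_mul => <-.
  by apply: eq_Rintegral => t _; rewrite /haar -/b -/c mulrBl.
have H2 : \int[leb]_t (tent a h t * g t) =
    \int[leb]_(t in `[a, b[) (l1 t * g t) + \int[leb]_(t in `[b, c[) (l2 t * g t).
  have := RintegralD measurableT (i1 a b _ _ cl1 cg) (i1 b c _ _ cl2 cg).
  rewrite (Rintegral_indic_mul _ (fun t => l1 t * g t)).
  rewrite (Rintegral_indic_mul _ (fun t => l2 t * g t)) => <-.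
  by apply: eq_Rintegral => t _; rewrite /tent -/b -/c /l1 /l2; ring.
have cM (k l : R -> R) : continuous k -> continuous l -> continuous (fun t => k t * l t).
  by move=> ck cl t; apply: cvgM; [exact: ck|exact: cl].
move: left right; rewrite RintegralD//; [|exact: continuous_integrable_itvco|by apply: continuous_integrable_itvco; exact: cM].
have -> : \int[leb]_(t in `[b, c[) (- f t + l2 t * g t) =
    \int[leb]_(t in `[b, c[) (l2 t * g t) - \int[leb]_(t in `[b, c[) f t.
  rewrite -RintegralB//; [|by apply: continuous_integrable_itvco; exact: cM|exact: continuous_integrable_itvco].
  by apply: eq_Rintegral => t _; rewrite addrC.
by rewrite H1 H2 => E1 E2; lra.
Qed.

End haar_tent.

(** * Integration over slices of the space *)

Section countable_base.

(** A neighbourhood relation replaces the topology because it passes to products through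
    [filter_prod]: open sets of space are thus shown to be measurable for the product sigma-algebra,
    starting from rational intervals of the line. *)
Definition countable_base d (T : measurableType d) (nb : T -> set (set T)) :=
  exists B : nat -> set T, (forall n, measurable (B n)) /\
    forall x U, nb x U -> exists n, B n x /\ B n `<=` U.

Lemma countable_base_measurable d (T : measurableType d)
    (nb : T -> set (set T)) (U : set T) :
  countable_base nb -> (forall x, U x -> nb x U) -> measurable U.
Proof.
move=> [B [mB hB]] nbU.
have -> : U = \bigcup_(n in [set n | B n `<=` U]) B n.
  apply/seteqP; split => [x Ux|x [n /= BnU /BnU //]].
  by have [n [Bnx BnU]] := hB x U (nbU x Ux); exists n.
by apply: bigcup_measurable => n _; exact: mB.
Qed.

Lemma countable_base_prod d1 d2 (T1 : measurableType d1)
    (T2 : measurableType d2) (nb1 : T1 -> set (set T1)) (nb2 : T2 -> set (set T2)) :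
  countable_base nb1 -> countable_base nb2 ->
  countable_base (fun z : T1 * T2 => filter_prod (nb1 z.1) (nb2 z.2)).
Proof.
move=> [B1 [mB1 h1]] [B2 [mB2 h2]].
exists (fun n => let p := odflt (0%N, 0%N) (unpickle n) in B1 p.1 `*` B2 p.2).
split=> [n|[x y] U [[P Q] /= [Px Qy] PQ]]; first exact: measurableX.
have [n [Bn nP]] := h1 x P Px; have [m [Bm mQ]] := h2 y Q Qy.
exists (pickle (n, m)); rewrite pickleK /=; split => // -[a b] /= [Ba Bb].
by apply: PQ; split; [exact: nP|exact: mQ].
Qed.

Lemma countable_base_real (R : realType) :
  countable_base (fun x : measurableTypeR R => nbhs (x : R)).
Proof.
exists (fun n => let p := odflt (0, 0) (unpickle n) : rat * rat in
                 `]ratr p.1, ratr p.2[%classic).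
split=> [n|x U]; first exact: measurable_itv.
move=> /nbhs_ballP[e /= e0 eU].
have [q /[!in_itv]/= /andP[xq qe]] : exists q : rat, ratr q \in `]x, x + e[.
  by apply: rat_in_itvoo; rewrite ltrDl.
have [p /[!in_itv]/= /andP[pe px]] : exists q : rat, ratr q \in `]x - e, x[.
  by apply: rat_in_itvoo; rewrite ltrBlDr ltrDl.
exists (pickle (p, q)); rewrite pickleK /=; split; first by rewrite in_itv/= px.
move=> y /=; rewrite in_itv/= => /andP[py yq]; apply: eU.
by rewrite /ball/= ltr_norml; apply/andP; split; lra.
Qed.

End countable_base.

Lemma bounded_integrable (R : realType) d (T : measurableType d) (m : {measure set T -> \bar R})
    (F : T -> R) M (A : set T) : measurable A -> (m A < +oo)%E ->
  measurable_fun setT F -> (forall x, `|F x| <= M * \1_A x) ->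
  m.-integrable setT (EFin \o F).
Proof.
move=> mA Afin mF bF.
have iA : m.-integrable setT (EFin \o \1_A).
  apply/integrableP; split; first exact/measurable_EFinP/measurable_indic.
  rewrite (eq_integral (EFin \o \1_A)) ?integral_indic ?setIT// => x _ /=.
  by rewrite ger0_norm.
apply: (le_integrable measurableT _ _ (integrableZl measurableT M iA)).
  exact/measurable_EFinP.
by move=> x _ /=; rewrite lee_fin (le_trans (bF x)) ?ler_norm.
Qed.

Lemma product_measure_lty (R : realType) d1 d2 (T1 : measurableType d1)
    (T2 : measurableType d2) (m1 : {sigma_finite_measure set T1 -> \bar R})
    (m2 : {sigma_finite_measure set T2 -> \bar R}) A B :
  measurable A -> measurable B -> (m1 A < +oo)%E -> (m2 B < +oo)%E ->
  ((m1 \x m2) (A `*` B) < +oo)%E.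
Proof.
by move=> mA mB fA fB; rewrite product_measure1E// lte_mul_pinfty// ge0_fin_numE.
Qed.

Lemma indicX (R : realType) (T1 T2 : Type) (A : set T1) (B : set T2) z :
  \1_(A `*` B) z = \1_A z.1 * \1_B z.2 :> R.
Proof.
rewrite !indicE -natrM mulnb; congr (nat_of_bool _)%:R.
by apply/idP/andP; rewrite !inE.
Qed.

Section slices.
Context {R : realType} d1 d2 (T1 : measurableType d1) (T2 : measurableType d2).
Variables (m1 : {sigma_finite_measure set T1 -> \bar R})
  (m2 : {sigma_finite_measure set T2 -> \bar R}) (F F' : T1 * T2 -> \bar R).
Hypotheses (iF : (m1 \x m2)%E.-integrable setT F)
  (iF' : (m1 \x m2)%E.-integrable setT F').
Local Open Scope ereal_scope.

Lemma eq_integral_fst : (forall y, \int[m1]_x F (x, y) = \int[m1]_x F' (x, y)) ->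
  \int[m1 \x m2]_z F z = \int[m1 \x m2]_z F' z.
Proof.
move=> FF'; rewrite -!integral21_prod_meas1//.
by apply: eq_integral => y _; exact: FF'.
Qed.

Lemma eq_integral_snd : (forall x, \int[m2]_y F (x, y) = \int[m2]_y F' (x, y)) ->
  \int[m1 \x m2]_z F z = \int[m1 \x m2]_z F' z.
Proof.
move=> FF'; rewrite -!integral12_prod_meas1//.
by apply: eq_integral => x _; exact: FF'.
Qed.

End slices.

Section space3.
Context {R : realType}.
Local Notation leb := (@lebesgue_measure R).
Local Notation line := (measurableTypeR R).
Implicit Types (x : R3 R) (phi psi : R3 R -> R).

Lemma open_measurable3 (U : set (R3 R)) : open U -> measurable U.
Proof.
move=> oU; pose nb := fun z : line * line * line =>
  filter_prod (filter_prod (nbhs (z.1.1 : R)) (nbhs (z.1.2 : R))) (nbhs (z.2 : R)).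
apply: (@countable_base_measurable _ _ nb).
  apply: (@countable_base_prod _ _ _ _
    (fun z : line * line => filter_prod (nbhs (z.1 : R)) (nbhs (z.2 : R)))).
    by apply: countable_base_prod; exact: countable_base_real.
  exact: countable_base_real.
move=> x Ux; rewrite openE in oU; exact: (oU x Ux).
Qed.

Lemma continuous_measurable3 phi : continuous phi -> measurable_fun setT phi.
Proof.
move=> /continuousP cf; apply: (measurability _ (RGenOpens.measurableE R)).
move=> _ [_ [a [b ->] <-]]; rewrite setTI; apply: open_measurable3.
exact/cf/interval_open.
Qed.

Definition upd x (i : 'I_3) (t : R) : R3 R :=
  match val i with
  | 0%N => ((t, x.1.2), x.2) | 1%N => ((x.1.1, t), x.2) | _ => (x.1, t) end.

Lemma upd_basis x i (t h : R) : h *: basis_vec R i + upd x i t = upd x i (h + t).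
Proof.
case: x => -[x1 x2] x3; case: i => -[|[|[|//]]] Hi; rewrite /upd/basis_vec/=;
  apply/pair_equal_spec; split; try (apply/pair_equal_spec; split);
  by rewrite /= /GRing.scale/= ?mulr1 ?mulr0 ?add0r.
Qed.

Lemma continuous_upd x i : continuous (upd x i).
Proof.
move=> t U [[P Q] /= [[[P1 P2] /= [P1t P2t] P12] Qt] PQ].
case: i P1t P2t Qt => -[|[|[|//]]] Hi /= P1t P2t Qt.
- move: P1t; apply: filterS => s P1s; apply: PQ; split=> /=; last exact: nbhs_singleton Qt.
  by apply: P12; split => //=; exact: nbhs_singleton P2t.
- move: P2t; apply: filterS => s P2s; apply: PQ; split=> /=; last exact: nbhs_singleton Qt.
  by apply: P12; split => //=; exact: nbhs_singleton P1t.
- move: Qt; apply: filterS => s Qs; apply: PQ; split=> //=.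
  by apply: P12; split => /=; [exact: nbhs_singleton P1t|exact: nbhs_singleton P2t].
Qed.

Lemma is_derive_upd phi i x (t : R) :
  (forall z, derivable phi z (basis_vec R i)) ->
  is_derive t 1 (fun s => phi (upd x i s)) (partial i phi (upd x i t)).
Proof.
move=> dphi; have := dphi (upd x i t).
have E : (fun h : R => h^-1 *: (phi (h *: basis_vec R i + upd x i t) - phi (upd x i t)))
  = (fun h : R => h^-1 *: (phi (upd x i (h *: (1 : R) + t)) - phi (upd x i t))).
  by apply/funext => h; rewrite upd_basis /GRing.scale/= mulr1.
rewrite /derivable => cv; split; first by rewrite /derivable/= -E; exact: cv.
by rewrite /partial /derive/= E.
Qed.

(** The one-variable factors of all the products used below: interval indicators, Haar functions and
    tents. Boundedness and bounded support supply the integrability that Fubini's theorem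
    requires. *)
Definition bump (u : R -> R) : Prop := measurable_fun setT (u : line -> R) /\
  exists M a b : R, forall t, `|u t| <= M * \1_(`[a, b[) t.

Lemma bump_indic (a b : R) : bump \1_(`[a, b[).
Proof.
split; first exact: measurable_indic.
by exists 1, a, b => t; rewrite mul1r ger0_norm.
Qed.

Lemma bump_haar (a h : R) : 0 < h -> bump (haar a h).
Proof.
move=> h0; split; first by apply: measurable_funB; exact: measurable_indic.
exists 1, a, (a + h *+ 2) => t; rewrite mul1r /haar !indicE !mem_setE !in_itv/=.
have [ta|ta] /= := lerP a t; have [th|th] /= := ltrP t (a + h);
  have [th2|th2] /= := lerP (a + h) t; have [th3|th3] /= := ltrP t (a + h *+ 2);
  rewrite ?subr0 ?sub0r ?subrr ?normrN ?normr1 ?normr0//; rewrite mulr2n in th3; lra.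
Qed.

Lemma tent_le (a h t : R) : 0 < h ->
  `|tent a h t| <= h * \1_(`[a, a + h *+ 2[) t.
Proof.
move=> h0; rewrite /tent !indicE !mem_setE !in_itv/=.
rewrite mulr2n.
have [ta|ta] /= := lerP a t; have [th|th] /= := ltrP t (a + h);
  have [th2|th2] /= := lerP (a + h) t; have [th3|th3] /= := ltrP t (a + (h + h));
  rewrite ?mul1r ?mul0r ?mulr1 ?mulr0 ?addr0 ?add0r ?normr0//; try lra;
  rewrite ger0_norm; lra.
Qed.

Lemma bump_tent (a h : R) : 0 < h -> bump (tent a h).
Proof.
move=> h0; split.
  apply: measurable_funD; apply: measurable_funM; try exact: measurable_indic.
    by apply: measurable_funB => //; exact: measurable_id.
  by apply: measurable_funB => //; exact: measurable_id.
by exists h, a, (a + h *+ 2) => t; exact: tent_le.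
Qed.

Lemma bump_sqr u : bump u -> bump (fun t => u t ^+ 2).
Proof.
move=> [mu [M [a [b bu]]]]; split; first exact: measurable_funX.
exists (M ^+ 2), a, b => t; rewrite normrX.
have -> : M ^+ 2 * \1_`[a, b[ t = (M * \1_`[a, b[ t) ^+ 2.
  by rewrite exprMn indicE; case: (_ \in _); rewrite ?expr1n ?expr0n.
by rewrite lerXn2r ?nnegrE// (le_trans _ (bu t)).
Qed.

Lemma bumpN u : bump u -> bump (fun t => - u t).
Proof.
move=> [mu [M [a [b bu]]]]; split; first exact: measurableT_comp.
by exists M, a, b => t; rewrite normrN.
Qed.

Lemma prod_ord3 (f : 'I_3 -> R) : \prod_j f j =
  f (Ordinal (isT : 0 < 3)%N) * f (Ordinal (isT : 1 < 3)%N) * f (Ordinal (isT : 2 < 3)%N).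
Proof.
rewrite !big_ord_recl big_ord0 mulr1 mulrA.
by congr (f _ * f _ * f _); apply: val_inj.
Qed.

Lemma lebesgue_itvco_lty (a b : R) : (leb `[a, b[%classic < +oo)%E.
Proof. by rewrite lebesgue_measure_itv/=; case: ifP => _; rewrite ?ltey//= -EFinB ltey. Qed.

Lemma bump_integrable1 u (g : R -> R) (M : R) : bump u ->
  measurable_fun setT (g : line -> R) -> (forall t, `|g t| <= M) ->
  leb.-integrable setT (EFin \o (fun t => u t * g t)).
Proof.
move=> [mu [U [a [b bu]]]] mg bg.
have mug : measurable_fun setT ((fun t => u t * g t) : line -> R).
  exact: measurable_funM.
apply: (bounded_integrable _ (lebesgue_itvco_lty a b) mug (M := U * M)) => //.
by move=> t; rewrite normrM mulrAC ler_pM.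
Qed.

Lemma bump_integrable2 u v (g : R * R -> R) (M : R) : bump u -> bump v ->
  measurable_fun setT (g : line * line -> R) -> (forall t, `|g t| <= M) ->
  (@lebesgue2 R).-integrable setT (EFin \o (fun t => u t.1 * v t.2 * g t)).
Proof.
move=> [mu [U [a [b bu]]]] [mv [V [c [e bv]]]] mg bg.
have mf : measurable_fun setT ((fun t => u t.1 * v t.2 * g t) : line * line -> R).
  apply: measurable_funM => //; apply: measurable_funM.
    exact: (measurableT_comp mu).
  exact: (measurableT_comp mv).
have fin2 : (@lebesgue2 R (`[a, b[ `*` `[c, e[) < +oo)%E.
  by apply: product_measure_lty => //; exact: lebesgue_itvco_lty.
apply: (bounded_integrable _ fin2 mf (M := U * V * M)).
  by apply: measurableX; exact: measurable_itv.
move=> [s t]; rewrite indicX !normrM /=.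
have -> : U * V * M * (\1_`[a, b[ s * \1_`[c, e[ t) =
     (U * \1_`[a, b[ s) * (V * \1_`[c, e[ t) * M by ring.
by apply: ler_pM => //; apply: ler_pM.
Qed.

Lemma bump_integrable3 u v w (g : R3 R -> R) (M : R) : bump u -> bump v -> bump w ->
  measurable_fun setT g -> (forall t, `|g t| <= M) ->
  (@lebesgue3 R).-integrable setT
    (EFin \o (fun x : R3 R => u x.1.1 * v x.1.2 * w x.2 * g x)).
Proof.
move=> [mu [U [a [b bu]]]] [mv [V [c [e bv]]]] [mw [W [p [q bw]]]] mg bg.
have mf : measurable_fun setT
    ((fun x => u x.1.1 * v x.1.2 * w x.2 * g x) : line * line * line -> R).
  apply: measurable_funM => //; apply: measurable_funM; last first.
    exact: (measurableT_comp mw).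
  apply: measurable_funM.
    apply: (measurableT_comp mu).
    by apply: (measurableT_comp measurable_fst); exact: measurable_fst.
  apply: (measurableT_comp mv).
  by apply: (measurableT_comp measurable_snd); exact: measurable_fst.
have m2 : measurable ((`[a, b[%classic : set line) `*` (`[c, e[%classic : set line)).
  by apply: measurableX; exact: measurable_itv.
have fin2 : (@lebesgue2 R (`[a, b[ `*` `[c, e[) < +oo)%E.
  by apply: product_measure_lty => //; exact: lebesgue_itvco_lty.
have fin3 : (@lebesgue3 R ((`[a, b[ `*` `[c, e[) `*` `[p, q[) < +oo)%E.
  by apply: product_measure_lty => //; exact: lebesgue_itvco_lty.
apply: (bounded_integrable _ fin3 mf (M := U * V * W * M)).
  by apply: measurableX => //; exact: measurable_itv.
move=> [[s t] r]; rewrite !indicX !normrM /=.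
have -> : U * V * W * M * (\1_`[a, b[ s * \1_`[c, e[ t * \1_`[p, q[ r) =
   (U * \1_`[a, b[ s) * (V * \1_`[c, e[ t) * (W * \1_`[p, q[ r) * M by ring.
by apply: ler_pM => //; apply: ler_pM => //; apply: ler_pM.
Qed.

Lemma L2f_bump_prod (u : 'I_3 -> R -> R) : (forall j, bump (u j)) ->
  L2f mu3 (fun x => \prod_j u j (Defs.coord x j)).
Proof.
move=> bu; have mc : measurable_fun setT (cst 1 : R3 R -> R) by exact: measurable_cst.
have b1 (x : R3 R) : `|cst (1 : R) x| <= 1 by rewrite normr1.
have I v : (forall j, bump (v j)) ->
    mu3.-integrable setT (EFin \o (fun x => \prod_j v j (Defs.coord x j))).
  move=> bv; have := bump_integrable3 (bv (Ordinal (isT : 0 < 3)%N))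
    (bv (Ordinal (isT : 1 < 3)%N)) (bv (Ordinal (isT : 2 < 3)%N)) mc b1.
  by apply: eq_integrable => // x _ /=; rewrite prod_ord3 mulr1.
split; first by have /integrableP[/measurable_EFinP] := I u bu.
have := I (fun j t => u j t ^+ 2) (fun j => bump_sqr (bu j)).
by apply: eq_integrable => // x _ /=; rewrite prodrXl.
Qed.

Lemma integral_bumpZ c u (g : R -> R) (M : R) : bump u ->
  measurable_fun setT (g : line -> R) -> (forall t, `|g t| <= M) ->
  (\int[leb]_t (c * (u t * g t))%:E)%E = (c * \int[leb]_t (u t * g t))%:E.
Proof.
move=> bu mg bg; have ig := bump_integrable1 bu mg bg.
have ifin := integrable_fin_num measurableT ig.
rewrite EFinM /Rintegral fineK//.
rewrite -(integralZl measurableT ig).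
by apply: eq_integral => t _ /=; rewrite EFinM.
Qed.

Lemma measurable_upd x (i : 'I_3) phi : measurable_fun setT phi ->
  measurable_fun setT ((fun t => phi (upd x i t)) : line -> R).
Proof.
move=> mphi; apply: measurableT_comp => //; rewrite /upd.
case: i => -[|[|[|//]]] Hi /=.
- have m1 : measurable_fun setT ((fun t => (t, x.1.2)) : line -> line * line).
    exact: pair2_measurable.
  exact: (measurableT_comp (pair2_measurable (x.2 : line))).
- have m1 : measurable_fun setT ((fun t => (x.1.1, t)) : line -> line * line).
    exact: pair1_measurable.
  exact: (measurableT_comp (pair2_measurable (x.2 : line))).
- exact: (pair1_measurable (x.1 : line * line)).
Qed.

(** Space is the nested product [(R * R) * R], so each coordinate needs its own succession of Fubini
    steps to become the innermost variable. *)
Lemma integral_slice0 (u u' v w : R -> R) phi psi (M : R) : bump u -> bump u' -> bump v -> bump w ->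
  measurable_fun setT phi -> measurable_fun setT psi ->
  (forall x, `|phi x| <= M) -> (forall x, `|psi x| <= M) ->
  (forall x, \int[leb]_t (u t * phi (upd x (Ordinal (isT : 0 < 3)%N) t)) =
             \int[leb]_t (u' t * psi (upd x (Ordinal (isT : 0 < 3)%N) t))) ->
  (\int[@lebesgue3 R]_(x in [set: R3 R]) (u x.1.1 * v x.1.2 * w x.2 * phi x)%:E =
   \int[@lebesgue3 R]_(x in [set: R3 R]) (u' x.1.1 * v x.1.2 * w x.2 * psi x)%:E)%E.
Proof.
move=> bu bu' bv bw mphi mpsi bphi bpsi H.
apply: eq_integral_fst => [||z]; [exact: (bump_integrable3 bu bv bw mphi bphi)|
  exact: (bump_integrable3 bu' bv bw mpsi bpsi)|].
have i2 (k : R -> R) (g : R3 R -> R) : bump k -> measurable_fun setT g -> (forall x, `|g x| <= M) ->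
  (@lebesgue2 R).-integrable setT
    (fun t : line * line => (k t.1 * v t.2 * w z * g (t, z))%:E).
  move=> bk mg bg.
  have mgz : measurable_fun setT ((fun t => g (t, z)) : line * line -> R).
    by apply: measurableT_comp => //; exact: measurable_pair2.
  have := bump_integrable2 bk bv mgz (fun t => bg (t, z)).
  move/(integrableZl measurableT (w z)); apply: eq_integrable => // t _ /=.
  by rewrite -EFinM; congr EFin; ring.
apply: eq_integral_fst => [||y]; [exact: i2|exact: i2|].
(* The coordinate 0 of the base point is arbitrary: [upd] overwrites it. *)
have i1 (k : R -> R) (g : R3 R -> R) : bump k -> measurable_fun setT g -> (forall x, `|g x| <= M) ->
  (\int[leb]_t (k t * v y * w z * g (t, y, z))%:E =
   (v y * w z * \int[leb]_t (k t * g (upd ((0, y), z) (Ordinal (isT : 0 < 3)%N) t)))%:E)%E.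
  move=> bk mg bg.
  rewrite -(integral_bumpZ _ bk (measurable_upd ((0, y), z) (Ordinal (isT : 0 < 3)%N) mg)
     (fun t => bg _)).
  by apply: eq_integral => t _; congr EFin; rewrite /upd/=; ring.
by rewrite /= !i1// H.
Qed.

Lemma integral_slice1 (u u' v w : R -> R) phi psi (M : R) : bump u -> bump u' -> bump v -> bump w ->
  measurable_fun setT phi -> measurable_fun setT psi ->
  (forall x, `|phi x| <= M) -> (forall x, `|psi x| <= M) ->
  (forall x, \int[leb]_t (u t * phi (upd x (Ordinal (isT : 1 < 3)%N) t)) =
             \int[leb]_t (u' t * psi (upd x (Ordinal (isT : 1 < 3)%N) t))) ->
  (\int[@lebesgue3 R]_(x in [set: R3 R]) (v x.1.1 * u x.1.2 * w x.2 * phi x)%:E =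
   \int[@lebesgue3 R]_(x in [set: R3 R]) (v x.1.1 * u' x.1.2 * w x.2 * psi x)%:E)%E.
Proof.
move=> bu bu' bv bw mphi mpsi bphi bpsi H.
apply: eq_integral_fst => [||z]; [exact: (bump_integrable3 bv bu bw mphi bphi)|
  exact: (bump_integrable3 bv bu' bw mpsi bpsi)|].
have i2 (k : R -> R) (g : R3 R -> R) : bump k -> measurable_fun setT g -> (forall x, `|g x| <= M) ->
  (@lebesgue2 R).-integrable setT
    (fun t : line * line => (v t.1 * k t.2 * w z * g (t, z))%:E).
  move=> bk mg bg.
  have mgz : measurable_fun setT ((fun t => g (t, z)) : line * line -> R).
    by apply: measurableT_comp => //; exact: measurable_pair2.
  have := bump_integrable2 bv bk mgz (fun t => bg (t, z)).
  move/(integrableZl measurableT (w z)); apply: eq_integrable => // t _ /=.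
  by rewrite -EFinM; congr EFin; ring.
apply: eq_integral_snd => [||y]; [exact: i2|exact: i2|].
have i1 (k : R -> R) (g : R3 R -> R) : bump k -> measurable_fun setT g -> (forall x, `|g x| <= M) ->
  (\int[leb]_t (v y * k t * w z * g (y, t, z))%:E =
   (v y * w z * \int[leb]_t (k t * g (upd ((y, 0), z) (Ordinal (isT : 1 < 3)%N) t)))%:E)%E.
  move=> bk mg bg.
  rewrite -(integral_bumpZ _ bk (measurable_upd ((y, 0), z) (Ordinal (isT : 1 < 3)%N) mg)
     (fun t => bg _)).
  by apply: eq_integral => t _; congr EFin; rewrite /upd/=; ring.
by rewrite /= !i1// H.
Qed.

Lemma integral_slice2 (u u' v w : R -> R) phi psi (M : R) : bump u -> bump u' -> bump v -> bump w ->
  measurable_fun setT phi -> measurable_fun setT psi ->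
  (forall x, `|phi x| <= M) -> (forall x, `|psi x| <= M) ->
  (forall x, \int[leb]_t (u t * phi (upd x (Ordinal (isT : 2 < 3)%N) t)) =
             \int[leb]_t (u' t * psi (upd x (Ordinal (isT : 2 < 3)%N) t))) ->
  (\int[@lebesgue3 R]_(x in [set: R3 R]) (v x.1.1 * w x.1.2 * u x.2 * phi x)%:E =
   \int[@lebesgue3 R]_(x in [set: R3 R]) (v x.1.1 * w x.1.2 * u' x.2 * psi x)%:E)%E.
Proof.
move=> bu bu' bv bw mphi mpsi bphi bpsi H.
apply: eq_integral_snd => [||z]; [exact: (bump_integrable3 bv bw bu mphi bphi)|
  exact: (bump_integrable3 bv bw bu' mpsi bpsi)|].
have i1 (k : R -> R) (g : R3 R -> R) : bump k -> measurable_fun setT g -> (forall x, `|g x| <= M) ->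
  (\int[leb]_t (v z.1 * w z.2 * k t * g (z, t))%:E =
   (v z.1 * w z.2 * \int[leb]_t (k t * g (upd (z, 0) (Ordinal (isT : 2 < 3)%N) t)))%:E)%E.
  move=> bk mg bg.
  rewrite -(integral_bumpZ _ bk (measurable_upd (z, 0) (Ordinal (isT : 2 < 3)%N) mg)
     (fun t => bg _)).
  by apply: eq_integral => t _; congr EFin; rewrite /upd/=; ring.
by rewrite /= !i1// H.
Qed.

(** Identities along all lines of direction [i], weighted by the unchanged factors in the other
    variables, integrate to an identity in space. This lifts the one-dimensional integration by
    parts. *)
Lemma integral_slice (i : 'I_3) (u v : 'I_3 -> R -> R) phi psi (M : R) :
  (forall j, bump (u j)) -> (forall j, bump (v j)) ->
  (forall j, j != i -> u j = v j) ->
  measurable_fun setT phi -> measurable_fun setT psi ->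
  (forall x, `|phi x| <= M) -> (forall x, `|psi x| <= M) ->
  (forall x, \int[leb]_t (u i t * phi (upd x i t)) =
             \int[leb]_t (v i t * psi (upd x i t))) ->
  \int[mu3]_x ((\prod_j u j (Defs.coord x j)) * phi x) =
  \int[mu3]_x ((\prod_j v j (Defs.coord x j)) * psi x).
Proof.
move=> bu bv uv mphi mpsi bphi bpsi H; rewrite /Rintegral; congr fine.
under eq_integral do rewrite prod_ord3.
under [RHS]eq_integral do rewrite prod_ord3.
rewrite /Defs.coord /=.
case: i => -[|[|[|//]]] Hi in uv H *.
- have E : Ordinal Hi = Ordinal (isT : 0 < 3)%N by exact: val_inj.
  rewrite E in uv H.
  by rewrite -(uv (Ordinal (isT : 1 < 3)%N))// -(uv (Ordinal (isT : 2 < 3)%N))//;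
    apply: (integral_slice0 _ _ _ _ mphi mpsi bphi bpsi).
- have E : Ordinal Hi = Ordinal (isT : 1 < 3)%N by exact: val_inj.
  rewrite E in uv H.
  by rewrite -(uv (Ordinal (isT : 0 < 3)%N))// -(uv (Ordinal (isT : 2 < 3)%N))//;
    apply: (integral_slice1 _ _ _ _ mphi mpsi bphi bpsi).
- have E : Ordinal Hi = Ordinal (isT : 2 < 3)%N by exact: val_inj.
  rewrite E in uv H.
  by rewrite -(uv (Ordinal (isT : 0 < 3)%N))// -(uv (Ordinal (isT : 1 < 3)%N))//;
    apply: (integral_slice2 _ _ _ _ mphi mpsi bphi bpsi).
Qed.

End space3.

(** * Test functions and their limits in H^1_0 *)

Section Lnorm_inner_product.
Context {d : measure_display} {T : measurableType d} {R : realType}.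
Variable mu : {measure set T -> \bar R}.

Lemma Lnorm2_ip (f : T -> R) : L2f mu f ->
  'N[mu]_2%:E[EFin \o f]%E = (Num.sqrt (ip mu f f))%:E.
Proof.
move=> Lf; rewrite unlock /Lnorm.
have -> : (\int[mu]_x `|(EFin \o f) x| `^ 2 = (ip mu f f)%:E)%E.
  rewrite -integral_sqr//; apply: eq_integral => x _ /=.
  by rewrite powR_mulrn// -normrX ger0_norm ?sqr_ge0.
by rewrite poweR_EFin powR12_sqrt// ip_ge0.
Qed.

Lemma ip_cvg (f : T -> R) (fn : nat -> T -> R) g : L2f mu f ->
  (forall n, L2f mu (fn n)) -> L2f mu g ->
  'N[mu]_2%:E[EFin \o (fun x => f x - fn n x)%R]%E @[n --> \oo] --> 0%E ->
  ip mu g (fn n) @[n --> \oo] --> ip mu g f.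
Proof.
move=> Lf Lfn Lg.
under eq_cvg do rewrite (Lnorm2_ip (L2fB Lf (Lfn _))).
move=> /fine_cvg /= c0; apply/cvgrPdist_le => e e0.
(* Adding 1 keeps the divisor positive when [g] is null. *)
have c : 0 < Num.sqrt (ip mu g g) + 1 by rewrite ltr_wpDl.
move/cvgrPdist_le : c0 => /(_ (e / (Num.sqrt (ip mu g g) + 1))).
rewrite divr_gt0// => /(_ isT); apply: filterS => n.
rewrite /= sub0r normrN ger0_norm ?sqrtr_ge0// ler_pdivlMr// => H.
rewrite -ipBr//; apply: le_trans H.
have := ip_cauchy_schwarz Lg (L2fB Lf (Lfn n)).
rewrite -ler_sqrt ?mulr_ge0 ?ip_ge0// sqrtr_sqr sqrtrM ?ip_ge0// => H.
by apply: (le_trans H); rewrite mulrC ler_wpM2l// lerDl.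
Qed.

End Lnorm_inner_product.

Lemma cvgn_sum (R : realType) I (s : seq I) (f : I -> nat -> R) (l : I -> R) :
  (forall i, f i n @[n --> \oo] --> l i) ->
  \sum_(i <- s) f i n @[n --> \oo] --> \sum_(i <- s) l i.
Proof.
move=> fl; elim: s => [|i s IH].
  by rewrite big_nil; under eq_cvg do rewrite big_nil; exact: cvg_cst.
by rewrite big_cons; under eq_cvg do rewrite big_cons; exact: cvgD.
Qed.

Section test_functions.
Context {R : realType} (D : set (R3 R)).
Local Notation leb := (@lebesgue_measure R).
Implicit Types (phi : R3 R -> R).

Lemma test_continuous phi : test_function D phi -> continuous phi.
Proof. by case=> /(_ 0%N). Qed.

Lemma test_derivable phi i : test_function D phi ->
  forall z, derivable phi z (basis_vec R i).
Proof. by case=> /(_ 1%N) /= [_ /(_ i)[]]. Qed.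

Lemma test_partial_continuous phi i : test_function D phi ->
  continuous (partial i phi).
Proof. by case=> /(_ 1%N) /= [_ /(_ i)[_ +]]. Qed.

Lemma test_off phi x : test_function D phi -> ~ D x -> phi x = 0.
Proof.
case=> _ _ sD; apply: contra_notP => /eqP px; apply: sD.
exact: subset_closure.
Qed.

Lemma test_partial_off_support phi i x :
  ~ closure [set y | phi y != 0] x -> partial i phi x = 0.
Proof.
move=> ncl; rewrite /partial.
have /near_eq_derive -> : \near x, phi x = cst 0 x; last exact: derive_cst.
have : nbhs x (~` closure [set y | phi y != 0]).
  by apply: open_nbhs_nbhs; split => //; apply: closed_openC; exact: closed_closure.
apply: filterS => y ncy; apply/eqP; apply: contra_notT ncy => py.
exact: subset_closure.
Qed.

Lemma test_partial_off phi i x : test_function D phi -> ~ D x ->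
  partial i phi x = 0.
Proof.
by case=> _ _ sD nDx; apply: test_partial_off_support => /sD.
Qed.

Lemma compact_support_bounded (K : set (R3 R)) (g : R3 R -> R) :
  continuous g -> compact K -> (forall x, ~ K x -> g x = 0) ->
  exists M, forall x, `|g x| <= M.
Proof.
move=> cg cK g0; have := continuous_compact (continuous_subspaceT cg) cK.
move/compact_bounded => [M [_ HM]]; exists (`|M| + 1) => x.
have [Kx|nKx] := pselect (K x); last by rewrite g0// normr0 addr_ge0.
by apply: HM; [rewrite ltr_pwDr ?ler_norm|exists x].
Qed.

Lemma test_bounded phi i : test_function D phi ->
  exists M, (forall x, `|phi x| <= M) /\ (forall x, `|partial i phi x| <= M).
Proof.
move=> tphi; have [_ cK _] := tphi.
have [x|M1 h1] := compact_support_bounded (test_continuous tphi) cK.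
  by apply: contra_notP => /eqP ?; exact: subset_closure.
have [x|M2 h2] := compact_support_bounded (test_partial_continuous (i := i) tphi) cK.
  exact: test_partial_off_support.
exists (Num.max M1 M2); split => x; rewrite le_max.
  by rewrite h1.
by rewrite h2 orbT.
Qed.

(** The factors left after integrating by parts in the variable [i], which also produces the
    sign. *)
Definition hat (i : 'I_3) (u : 'I_3 -> R -> R) (a h : R) (j : 'I_3) (t : R) : R :=
  if j == i then - tent a h t else u j t.

(* The tent is a primitive of the Haar function, up to sign. *)
Lemma test_haar phi i u a h : test_function D phi -> 0 < h ->
  (forall j, bump (u j)) -> u i = haar a h ->
  ip mu3 (fun x => \prod_j u j (Defs.coord x j)) phi =
  ip mu3 (fun x => \prod_j hat i u a h j (Defs.coord x j)) (partial i phi).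
Proof.
move=> tphi h0 bu ui; have [M [b1 b2]] := test_bounded i tphi.
apply: (@integral_slice _ i u (hat i u a h) phi (partial i phi) M) => //.
- move=> j; rewrite /hat; case: eqP => _; last exact: bu.
  exact/bumpN/bump_tent.
- by move=> j /negbTE ji; apply/funext => t; rewrite /hat ji.
- exact: (continuous_measurable3 (test_continuous tphi)).
- exact: (continuous_measurable3 (test_partial_continuous (i := i) tphi)).
- move=> x; rewrite ui /hat eqxx.
  rewrite (integral_haar a h0 (fun t => is_derive_upd x t (test_derivable (i := i) tphi))).
    rewrite -mulN1r -RintegralZl//.
      by apply: eq_Rintegral => t _; ring.
    have mp := measurable_upd x i
      (continuous_measurable3 (test_partial_continuous (i := i) tphi)).
    exact: (bump_integrable1 (bump_tent a h0) mp (fun t => b2 _)).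
  move=> t; apply: (@continuous_comp _ _ _ (upd x i) (partial i phi)).
    exact: continuous_upd.
  exact: test_partial_continuous tphi _.
Qed.

End test_functions.

Section sobolev_zero.
Context {R : realType} (D : set (R3 R)).
Hypotheses (mD : measurable D) (Dfin : (mu3 D < +oo)%E).
Implicit Types (u : R3 R -> R) (w : 'I_3 -> R3 R -> R).

Lemma inLp2E f : inLp 2%:E D f <-> L2f mu3 (f \_ D).
Proof. by rewrite L2fE. Qed.

Lemma L2f_test phi : test_function D phi -> L2f mu3 phi.
Proof.
move=> tphi; have [M [bM _]] := test_bounded ord0 tphi.
apply: (L2f_bounded (M := M) mD Dfin).
  exact: (continuous_measurable3 (test_continuous tphi)).
move=> x; rewrite indicE; have [Dx|nDx] := pselect (D x).
  by rewrite mem_set// mulr1.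
by rewrite (test_off tphi)// memNset// mulr0 normr0.
Qed.

Lemma L2f_test_partial phi i : test_function D phi -> L2f mu3 (partial i phi).
Proof.
move=> tphi; have [M [_ bM]] := test_bounded i tphi.
apply: (L2f_bounded (M := M) mD Dfin).
  exact: (continuous_measurable3 (test_partial_continuous (i := i) tphi)).
move=> x; rewrite indicE; have [Dx|nDx] := pselect (D x).
  by rewrite mem_set// mulr1.
by rewrite (test_partial_off i tphi)// memNset// mulr0 normr0.
Qed.

(** The hypothesis says that b = - div B against test functions. Both sides are continuous for
    convergence of the functions and of their gradients in L^2, so the identity passes to the
    closure H^1_0. *)
Lemma sobolev0_ip u w (b : R3 R -> R) (B : 'I_3 -> R3 R -> R) :
  sobolev0_with 2%:E D u w -> L2f mu3 b -> (forall i, L2f mu3 (B i)) ->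
  (forall phi, test_function D phi ->
     ip mu3 b phi = \sum_i ip mu3 (B i) (partial i phi)) ->
  ip mu3 b (u \_ D) = \sum_i ip mu3 (B i) (w i \_ D).
Proof.
move=> [[/inLp2E Lu Lw _] [phi [tphi cu cw]]] Lb LB H.
have {}Lw i : L2f mu3 (w i \_ D) by apply/inLp2E.
have E1 n : EFin \o (fun x => u x - phi n x) \_ D =
    EFin \o (fun x => (u \_ D) x - phi n x).
  apply/funext => x /=; congr EFin; rewrite !patchE; case: ifPn => //.
  by rewrite notin_setE => nDx; rewrite (test_off (tphi n))// subr0.
have E2 i n : EFin \o (fun x => w i x - partial i (phi n) x) \_ D =
    EFin \o (fun x => (w i \_ D) x - partial i (phi n) x).
  apply/funext => x /=; congr EFin; rewrite !patchE; case: ifPn => //.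
  by rewrite notin_setE => nDx; rewrite (test_partial_off i (tphi n))// subr0.
have c1 : ip mu3 b (phi n) @[n --> \oo] --> ip mu3 b (u \_ D).
  apply: ip_cvg => // [n|]; first exact: L2f_test.
  by move: cu; rewrite /Lp_dist; under eq_cvg do rewrite E1.
have c2 : \sum_i ip mu3 (B i) (partial i (phi n)) @[n --> \oo] -->
    \sum_i ip mu3 (B i) (w i \_ D).
  apply: cvgn_sum => i; apply: ip_cvg => // [n|]; first exact: L2f_test_partial.
  by move: (cw i); rewrite /Lp_dist; under eq_cvg do rewrite E2.
have {}c1 : \sum_i ip mu3 (B i) (partial i (phi n)) @[n --> \oo] -->
    ip mu3 b (u \_ D).
  by move: c1; under eq_cvg do rewrite (H _ (tphi _)).
exact: (cvg_unique _ c1 c2).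
Qed.

End sobolev_zero.

(** * Ellipticity *)

Section rayleigh.
Context {R : realType} {n : nat}.
Implicit Types (M S : 'M[R]_n) (v w : 'rV[R]_n).

Definition bform M v w : R := (v *m M *m w^T) ord0 ord0.

Lemma bformDl M v1 v2 w : bform M (v1 + v2) w = bform M v1 w + bform M v2 w.
Proof. by rewrite /bform !mulmxDl mxE. Qed.

Lemma bformZl M a v w : bform M (a *: v) w = a * bform M v w.
Proof. by rewrite /bform -!scalemxAl mxE. Qed.

Lemma bform_sym M v w : M^T = M -> bform M v w = bform M w v.
Proof.
move=> MT; have E : (v *m M *m w^T)^T = w *m M *m v^T.
  by rewrite !trmx_mul trmxK MT mulmxA.
by rewrite [RHS]/bform -E mxE.
Qed.

Lemma bform_discriminant S v w : S^T = S -> (forall x, 0 <= bform S x x) ->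
  bform S v w ^+ 2 <= bform S v v * bform S w w.
Proof.
move=> ST psd; apply: psd_discriminant => a b.
have := psd (a *: v + b *: w).
rewrite bformDl !bformZl !(bform_sym _ (a *: v + b *: w) ST).
rewrite !bformDl !bformZl (bform_sym w v ST) => H; nra.
Qed.

Lemma bform1E v : bform 1%:M v v = \sum_i v ord0 i ^+ 2.
Proof. by rewrite /bform mulmx1 mxE; apply: eq_bigr => i _; rewrite mxE -expr2. Qed.

Lemma bform1_ge0 v : 0 <= bform 1%:M v v.
Proof. by rewrite bform1E; apply: sumr_ge0 => i _; exact: sqr_ge0. Qed.

Lemma bform1_gt0 v : v != 0 -> 0 < bform 1%:M v v.
Proof.
rewrite lt_def bform1_ge0 andbT; apply: contra_neq.
rewrite bform1E => /eqP; rewrite psumr_eq0 => [/allP H|i _]; last exact: sqr_ge0.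
apply/rowP => i; rewrite mxE; apply/eqP; rewrite -sqrf_eq0.
by apply: (implyP (H i _)) => //; rewrite mem_index_enum.
Qed.

Lemma bform_bound M : exists2 C, 0 < C & forall v, bform M v v <= C * bform 1%:M v v.
Proof.
exists (1 + \sum_i \sum_j `|M i j|) => [|v].
  by rewrite ltr_wpDr// sumr_ge0// => i _; apply: sumr_ge0.
have -> : bform M v v = \sum_i \sum_j M i j * (v ord0 i * v ord0 j).
  rewrite /bform -mulmxA mxE; apply: eq_bigr => i _; rewrite !mxE mulr_sumr.
  by apply: eq_bigr => j _; rewrite !mxE; ring.
apply: (@le_trans _ _ (\sum_i \sum_j `|M i j| * bform 1%:M v v)); last first.
  rewrite mulrDl mul1r mulr_suml; under [X in _ <= _ + X]eq_bigr do rewrite mulr_suml.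
  by rewrite lerDr bform1_ge0.
apply: ler_sum => i _; apply: ler_sum => j _.
apply: (le_trans (ler_norm _)); rewrite normrM ler_wpM2l//.
have le k : v ord0 k ^+ 2 <= bform 1%:M v v.
  by rewrite bform1E (bigD1 k)//= lerDl sumr_ge0// => ? _; exact: sqr_ge0.
have := le i; have := le j; have := sqr_ge0 (v ord0 i - v ord0 j).
have := sqr_ge0 (v ord0 i + v ord0 j) => *.
by rewrite ler_norml; apply/andP; split; nra.
Qed.

(** Invertibility bounds |v|^2 by a multiple of |v S|^2. Cauchy-Schwarz for the form of [S] at v and
    v S gives |v S|^4 <= (v S v^T) C |v S|^2, hence |v S|^2 <= C (v S v^T). *)
Lemma psd_unit_coercive S : S^T = S -> (forall v, 0 <= bform S v v) ->
  S \in unitmx -> exists2 e, 0 < e & forall v, e * bform 1%:M v v <= bform S v v.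
Proof.
move=> ST psd uS.
have [C C0 hC] := bform_bound S.
have [C' C'0 hC'] := bform_bound (invmx S *m (invmx S)^T).
exists (C * C')^-1 => [|v]; first by rewrite invr_gt0 mulr_gt0.
rewrite ler_pdivrMl ?mulr_gt0//.
have H1 : bform 1%:M v v <= C' * bform 1%:M (v *m S) (v *m S).
  apply: le_trans (hC' (v *m S)).
  rewrite /bform mulmx1 trmx_mul ST -!mulmxA !mulmxA.
  rewrite mulmxK// -mulmxA; rewrite [X in _ *m X *m _]trmx_inv ST.
  by rewrite -mulmxA (mulmxA _ S) mulVmx// mul1mx.
apply: (le_trans H1); rewrite (mulrC C) -mulrA ler_pM2l//.
have := bform_discriminant v (v *m S) ST psd.
have -> : bform S v (v *m S) = bform 1%:M (v *m S) (v *m S).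
  by rewrite /bform mulmx1.
have := hC (v *m S); have := bform1_ge0 (v *m S); have := psd v.
move: (bform _ _ _) (bform _ _ _) (bform _ _ _) => x y z z0 y0 xy yz.
have [{}y0|y1] := ltrP 0 y; last by nra.
have : y ^+ 2 <= z * (C * y) by apply: (le_trans yz); rewrite ler_wpM2l.
by rewrite mulrA expr2 ler_pM2r// mulrC.
Qed.

(* The largest [t] with [t |v|^2 <= v M v^T] is an eigenvalue: were [M - t I]
   invertible, it would be coercive and [t] could be increased. *)
Lemma rayleigh_min M : (0 < n)%N -> M^T = M -> (forall v, 0 <= bform M v v) ->
  forall v, inf [set l | eigenvalue M l] * bform 1%:M v v <= bform M v v.
Proof.
move=> n0 MT psd.
pose T := [set t | forall v, t * bform 1%:M v v <= bform M v v].
have T0 : T 0 by move=> v; rewrite mul0r.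
have supT : has_sup T.
  split; first by exists 0.
  have [C C0 hC] := bform_bound M.
  pose e : 'rV[R]_n := const_mx 1.
  have e0 : 0 < bform 1%:M e e.
    apply: bform1_gt0; apply/eqP => /rowP /(_ (Ordinal n0)).
    by rewrite !mxE => /eqP; rewrite oner_eq0.
  by exists C => t /(_ e) /le_trans /(_ (hC e)); rewrite ler_pM2r.
have Tsup : T (sup T).
  move=> v; have [->|v0] := eqVneq v 0; first by rewrite /bform !mul0mx mxE mulr0.
  rewrite -ler_pdivlMr ?bform1_gt0//; apply: ge_sup; first by exists 0.
  by move=> t Tt; rewrite ler_pdivlMr ?bform1_gt0.
pose S := M - (sup T)%:M.
have SE v : bform S v v = bform M v v - sup T * bform 1%:M v v.
  rewrite /S /bform mulmxBr mulmxBl mxE [X in _ + X]mxE; congr (_ - _).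
  by rewrite mul_mx_scalar mulmx1 -scalemxAl mxE.
have eigS : eigenvalue M (sup T).
  rewrite /eigenvalue /eigenspace kermx_eq0 row_free_unit; apply/negP => uS.
  have [|v|e e0 he] := psd_unit_coercive _ _ uS.
  - by rewrite /S linearB /= MT tr_scalar_mx.
  - by rewrite SE subr_ge0.
  have /(sup_upper_bound supT) : T (sup T + e).
    by move=> v; have := he v; rewrite SE mulrDl; lra.
  by rewrite gerDl leNgt e0.
have infle : inf [set l | eigenvalue M l] <= sup T.
  apply: ge_inf => //; exists 0 => l /eigenvalueP[v vM v0].
  have := psd v; rewrite {1}/bform vM -scalemxAl mxE -[v in X in X *m _]mulmx1.
  by rewrite pmulr_lge0// bform1_gt0.
move=> v; apply: le_trans (Tsup v).
by rewrite ler_wpM2r ?bform1_ge0.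
Qed.

End rayleigh.

Section elliptic_energy.
Context {R : realType} (D : set (R3 R)) (A : R3 R -> 'M[R]_3).
Hypotheses (mD : measurable D) (Dfin : (mu3 D < +oo)%E).
Hypothesis (HA : elliptic_coefficient D A).
Implicit Types (f u : R3 R -> R) (w : 'I_3 -> R3 R -> R).

Lemma elliptic_coercive : exists2 l, 0 < l & forall x, D x ->
  forall v : 'I_3 -> R,
  l * (\sum_i v i ^+ 2) <= \sum_i \sum_j A x i j * v j * v i.
Proof.
case: HA => symA posA _ lmin _.
set l := inf _ in lmin.
exists l => // x Dx v.
pose r : 'rV[R]_3 := \row_j v j.
have psd y : 0 <= bform (A x) y y.
  have [->|y0] := eqVneq y 0; first by rewrite /bform !mul0mx mxE.
  by apply: ltW; exact: posA.
have := rayleigh_min (isT : (0 < 3)%N) (symA x Dx) psd r.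
have -> : bform 1%:M r r = \sum_i v i ^+ 2.
  by rewrite bform1E; apply: eq_bigr => i _; rewrite mxE.
have -> : bform (A x) r r = \sum_i \sum_j A x i j * v j * v i.
  rewrite /bform -mulmxA mxE; apply: eq_bigr => i _; rewrite !mxE mulr_sumr.
  by apply: eq_bigr => j _; rewrite !mxE; ring.
apply: le_trans; rewrite ler_wpM2r ?sumr_ge0// => [i _|]; first exact: sqr_ge0.
rewrite -/(lambda_min (A x)) /l; apply: ge_inf; last by exists x.
(* The infimum of a set without lower bound is 0 by convention, so the positivity of [l] provides
   the lower bound. *)
apply: contrapT => nlb; suff l0 : l = 0 by rewrite l0 ltxx in lmin.
by rewrite /l inf_out// => -[_ /nlb].
Qed.

Lemma L2f_ae_le (f g : R3 R -> R) : measurable_fun setT f -> L2f mu3 g ->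
  {ae mu3, forall x, `|f x| <= `|g x|} -> L2f mu3 f.
Proof.
move=> mf [mg g2] fg; split => //.
have mf2 : measurable_fun setT (fun x => (f x ^+ 2)%:E).
  by apply/measurable_EFinP; exact: measurable_funX.
apply/integrableP; split => //.
have /integrableP[mg2] := g2; apply: le_lt_trans.
apply: ae_ge0_le_integral => //.
- exact: measurableT_comp.
- exact: measurableT_comp.
- move: fg; apply: filterS => x fgx _ /=.
  by rewrite lee_fin !normrX lerXn2r ?nnegrE.
Qed.

Lemma coef_ae_bounded i j : exists M,
  {ae mu3, forall x, `|((fun y => A y i j) \_ D) x| <= M}.
Proof.
have := coef_Linfty HA i j; rewrite /inLp inE => /andP[].
rewrite inE /= => mf; rewrite inE /= /finite_norm unlock /Lnorm.
(* The sup norm is defined by cases on whether the whole space is null; if it is, any bound holds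
   almost everywhere. *)
case: ifPn => [mu0 eoo|mu0 _]; last first.
  exists 0; exists setT; split => //.
  by apply/eqP; rewrite eq_le measure_ge0 andbT leNgt.
pose g := EFin \o ((fun y => A y i j) \_ D).
have [M gM] : exists M : R, (ess_sup_inf.ess_sup mu3 (abse \o g) <= M%:E)%E.
  move: eoo; rewrite -/g; case: (ess_sup_inf.ess_sup _ _) => [r _|//|_]; first by exists r.
  by exists 0; rewrite leNye.
exists M; move/ess_sup_inf.ess_supP : gM; apply: filterS => x /=.
by rewrite lee_fin.
Qed.

Lemma L2f_coef w i j : L2f mu3 (w j \_ D) ->
  L2f mu3 ((fun x => A x i j * w j x) \_ D).
Proof.
move=> Lw; have [M hM] := coef_ae_bounded i j.
have -> : (fun x => A x i j * w j x) \_ D =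
  (fun x => ((fun y => A y i j) \_ D) x * (w j \_ D) x).
  by apply/funext => x; rewrite !patchE; case: ifP => _; rewrite ?mulr0.
apply: (L2f_ae_le _ (L2fZ M Lw)); last first.
  move: hM; apply: filterS => x h.
  by rewrite !normrM ler_wpM2r// (le_trans h)// ler_norm.
apply: measurable_funM; last by case: Lw.
by have := coef_Linfty HA i j; rewrite /inLp inE => /andP[]; rewrite inE.
Qed.

Definition flux w i : R3 R -> R := (fun x => \sum_j A x i j * w j x) \_ D.

Lemma L2f_flux w i : (forall j, L2f mu3 (w j \_ D)) -> L2f mu3 (flux w i).
Proof.
move=> Lw; have -> : flux w i = fun x => \sum_j ((fun x => A x i j * w j x) \_ D) x.
  apply/funext => x; rewrite /flux patchE; case: ifPn => xD.
    by apply: eq_bigr => j _; rewrite patchE xD.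
  by rewrite big1// => j _; rewrite patchE (negbTE xD).
by apply: L2f_sum => j _; exact: L2f_coef.
Qed.

(** The Dirichlet form, the integral of A w . w' over D. Written as a sum of inner products with the
    fluxes, it has the form of the right-hand side in [sobolev0_ip]. *)
Definition energy w w' : R := \sum_i ip mu3 (flux w i) (w' i \_ D).

Lemma energyE w w' : (forall j, L2f mu3 (w j \_ D)) ->
  (forall j, L2f mu3 (w' j \_ D)) ->
  mu3.-integrable setT
    (EFin \o ((fun x => \sum_i \sum_j A x i j * w j x * w' i x) \_ D)) /\
  energy w w' = \int[mu3]_x
    ((fun x => \sum_i \sum_j A x i j * w j x * w' i x) \_ D) x.
Proof.
move=> Lw Lw'.
have E : (fun x => \sum_i \sum_j A x i j * w j x * w' i x) \_ D =
   (fun x => \sum_i flux w i x * (w' i \_ D) x).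
  apply/funext => x; rewrite patchE; case: ifPn => xD.
    by apply: eq_bigr => i _; rewrite /flux !patchE xD mulr_suml.
  by rewrite big1// => i _; rewrite /flux !patchE (negbTE xD) mul0r.
have I i : mu3.-integrable setT (EFin \o (fun x => flux w i x * (w' i \_ D) x)).
  exact: (L2f_mul (L2f_flux _ Lw) (Lw' i)).
rewrite E; split.
  have := @integrable_sum _ _ _ mu3 _ measurableT _ (index_enum 'I_3) xpredT _
    (fun i _ => I i).
  by apply: eq_integrable => // x _ /=; rewrite sumEFin.
rewrite /energy !big_ord_recl !big_ord0 addr0 /ip.
under [RHS]eq_Rintegral do rewrite !big_ord_recl big_ord0 addr0.
rewrite RintegralD ?RintegralD//.
have := integrableD measurableT (I (lift ord0 ord0)) (I (lift ord0 (lift ord0 ord0))).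
by apply: eq_integrable => // x _ /=.
Qed.

Lemma energyC w w' : (forall j, L2f mu3 (w j \_ D)) ->
  (forall j, L2f mu3 (w' j \_ D)) -> energy w w' = energy w' w.
Proof.
move=> Lw Lw'; rewrite (energyE Lw Lw').2 (energyE Lw' Lw).2.
apply: eq_Rintegral => x _; rewrite !patchE; case: ifPn => // /set_mem xD.
rewrite exchange_big; apply: eq_bigr => i _; apply: eq_bigr => j _.
by rewrite -{1}(coef_sym HA xD) mxE; ring.
Qed.

Lemma energy_coercive : exists2 l, 0 < l &
  forall w, (forall j, L2f mu3 (w j \_ D)) ->
  l * \sum_i ip mu3 (w i \_ D) (w i \_ D) <= energy w w.
Proof.
have [l l0 hl] := elliptic_coercive; exists l => // w Lw.
have [I ->] := energyE Lw Lw.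
have Iw i : mu3.-integrable setT (EFin \o (fun x => (w i \_ D) x * (w i \_ D) x)).
  exact: L2f_mul.
have IS : mu3.-integrable setT
    (EFin \o (fun x => l * \sum_i (w i \_ D) x * (w i \_ D) x)).
  have := @integrable_sum _ _ _ mu3 _ measurableT _ (index_enum 'I_3) xpredT _
    (fun i _ => Iw i).
  move/(integrableZl measurableT l).
  by apply: eq_integrable => // x _ /=; rewrite sumEFin.
have -> : l * \sum_i ip mu3 (w i \_ D) (w i \_ D) =
   \int[mu3]_x (l * \sum_i (w i \_ D) x * (w i \_ D) x).
  rewrite RintegralZl//; last first.
    have := @integrable_sum _ _ _ mu3 _ measurableT _ (index_enum 'I_3) xpredT _
      (fun i _ => Iw i).
    by apply: eq_integrable => // x _ /=; rewrite sumEFin.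
  congr (_ * _); rewrite !big_ord_recl !big_ord0 addr0 /ip.
  under [RHS]eq_Rintegral do rewrite !big_ord_recl big_ord0 addr0.
  rewrite RintegralD ?RintegralD//.
  have := integrableD measurableT (Iw (lift ord0 ord0)) (Iw (lift ord0 (lift ord0 ord0))).
  by apply: eq_integrable => // x _ /=.
apply: le_Rintegral => // x _; rewrite patchE; case: ifPn => xD.
  under eq_bigr do rewrite patchE xD -expr2.
  exact/hl/set_mem.
by rewrite big1 ?mulr0// => i _; rewrite patchE (negbTE xD) mulr0.
Qed.

(** The weak equation, given on test functions, extends to H^1_0, so that a solution can be tested
    against another solution. *)
Lemma solves_gradient f u : solves D A f u -> exists w,
  [/\ sobolev0_with 2%:E D u w, forall j, L2f mu3 (w j \_ D), L2f mu3 (u \_ D),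
      L2f mu3 (f \_ D) &
      forall u' w', sobolev0_with 2%:E D u' w' ->
        ip mu3 (f \_ D) (u' \_ D) = energy w w'].
Proof.
move=> [/inLp2E Lf [w [H0 Hw]]]; exists w.
have [[/inLp2E Lu Lw _] _] := H0.
have {}Lw j : L2f mu3 (w j \_ D) by apply/inLp2E.
split => // u' w' H0'.
apply: (sobolev0_ip mD Dfin H0' Lf (fun i => L2f_flux i Lw)) => phi tphi.
have := Hw phi tphi; rewrite /inner Rintegral_mkcond [RHS]Rintegral_mkcond => H.
have Lp i : L2f mu3 (partial i phi \_ D).
  have -> : partial i phi \_ D = partial i phi.
    apply/funext => x; rewrite patchE; case: ifPn => //.
    by rewrite notin_setE => nDx; rewrite (test_partial_off i tphi).
  exact: L2f_test_partial tphi.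
have -> : ip mu3 (f \_ D) phi = energy w (fun i => partial i phi).
  rewrite (energyE Lw Lp).2 [RHS]H; apply: eq_Rintegral => x _.
  by rewrite !patchE; case: ifPn => //; rewrite mul0r.
apply: eq_bigr => i _; congr ip.
apply/funext => x; rewrite !patchE; case: ifPn => //.
by rewrite notin_setE => nDx; rewrite (test_partial_off i tphi).
Qed.

End elliptic_energy.

(** * Dyadic step functions *)

Section L2_density.
Context {d : measure_display} {T : measurableType d} {R : realType}.
Variable mu : {measure set T -> \bar R}.
Implicit Types (f g s : T -> R) (A B : set T).

Lemma ipDD_le f g : L2f mu f -> L2f mu g ->
  ip mu (fun x => f x + g x) (fun x => f x + g x) <=
  2 * ip mu f f + 2 * ip mu g g.
Proof.
move=> Lf Lg; have := ip_ge0 mu (fun x => f x - g x).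
rewrite (ipBl Lf Lg (L2fB Lf Lg)) !(ipBr Lf Lg)//.
rewrite (ipDl Lf Lg (L2fD Lf Lg)) !(ipDr Lf Lg)// (ipC mu g f); lra.
Qed.

(* [rl M] relates the points that no function of level [M] distinguishes. *)
Variables (rl : nat -> T -> T -> Prop) (X0 : set T).
Hypothesis rlS : forall M x y, rl M.+1 x y -> rl M x y.

Definition step s : Prop :=
  L2f mu s /\ exists M, forall x y, rl M x y -> s x = s y.

Definition approximable f : Prop :=
  forall e, 0 < e -> exists2 s, step s &
    ip mu (fun x => f x - s x) (fun x => f x - s x) < e.

Lemma rl_le M N x y : (M <= N)%N -> rl N x y -> rl M x y.
Proof.
move=> /subnK <-; elim: (N - M)%N => // k IH; rewrite addSn => /rlS; exact: IH.
Qed.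

Lemma stepD s t : step s -> step t -> step (fun x => s x + t x).
Proof.
move=> [Ls [M hM]] [Lt [N hN]]; split; first exact: L2fD.
exists (maxn M N) => x y rxy; congr (_ + _).
  by apply: hM; apply: rl_le rxy; exact: leq_maxl.
by apply: hN; apply: rl_le rxy; exact: leq_maxr.
Qed.

Lemma stepZ a s : step s -> step (fun x => a * s x).
Proof.
move=> [Ls [M hM]]; split; first exact: L2fZ.
by exists M => x y /hM ->.
Qed.

Lemma approximableD f g : L2f mu f -> L2f mu g ->
  approximable f -> approximable g -> approximable (fun x => f x + g x).
Proof.
move=> Lf Lg af ag e e0; have e4 : 0 < e / 4 by rewrite divr_gt0.
have [s Ss hs] := af _ e4; have [t St ht] := ag _ e4.
exists (fun x => s x + t x); first exact: stepD.
rewrite (_ : (fun x => _) = (fun x => (f x - s x) + (g x - t x))); last first.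
  by apply/funext => x; ring.
have := ipDD_le (L2fB Lf Ss.1) (L2fB Lg St.1); lra.
Qed.

Lemma approximableZ a f : L2f mu f -> approximable f ->
  approximable (fun x => a * f x).
Proof.
move=> Lf af e e0; have c0 : 0 < a ^+ 2 + 1 by rewrite ltr_wpDl ?sqr_ge0.
have [s Ss hs] := af (e / (a ^+ 2 + 1)) (divr_gt0 e0 c0).
exists (fun x => a * s x); first exact: stepZ.
rewrite (_ : (fun x => _) = (fun x => a * (f x - s x))); last first.
  by apply/funext => x; ring.
have Lfs := L2fB Lf Ss.1.
rewrite ipZl ?ipZr//; last exact: L2fZ.
move: hs; rewrite ltr_pdivlMr//; have := ip_ge0 mu (fun x => f x - s x).
move: (ip _ _ _) => p p0 H; apply: le_lt_trans H.
by rewrite mulrA -expr2 mulrC ler_wpM2l// lerDl.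
Qed.

Lemma approximable_lim f : L2f mu f ->
  (forall e, 0 < e -> exists2 g, L2f mu g /\ approximable g &
     ip mu (fun x => f x - g x) (fun x => f x - g x) < e) -> approximable f.
Proof.
move=> Lf H e e0; have e4 : 0 < e / 4 by rewrite divr_gt0.
have [g [Lg ag] hg] := H _ e4; have [s Ss hs] := ag _ e4.
exists s => //.
rewrite (_ : (fun x => _) = (fun x => (f x - g x) + (g x - s x))); last first.
  by apply/funext => x; ring.
have := ipDD_le (L2fB Lf Lg) (L2fB Lg Ss.1); lra.
Qed.

Lemma approximable_step s : step s -> approximable s.
Proof.
move=> Ss e e0; exists s => //.
rewrite (_ : (fun x => _) = (fun=> 0)); first by rewrite ip0l.
by apply/funext => x; rewrite subrr.
Qed.

Hypotheses (mX0 : measurable X0) (X0fin : (mu X0 < +oo)%E).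

Lemma L2f_indicI A : measurable A -> L2f mu (\1_(A `&` X0)).
Proof.
move=> mA; apply: L2f_indic; first exact: measurableI.
by apply: le_lt_trans X0fin; apply: le_measure; rewrite ?inE//; exact: measurableI.
Qed.

Lemma ip_indic A : measurable A -> ip mu \1_A \1_A = fine (mu A).
Proof.
move=> mA; rewrite /ip /Rintegral; congr fine.
rewrite (eq_integral (EFin \o \1_A)) ?integral_indic ?setIT// => x _ /=.
by rewrite indicE; case: (_ \in _); rewrite ?mulr1 ?mulr0.
Qed.

Lemma approximable_bigcup (F : (set T)^nat) : (forall n, measurable (F n)) ->
  nondecreasing_seq F -> (forall n, approximable \1_(F n `&` X0)) ->
  approximable \1_(\bigcup_n F n `&` X0).
Proof.
move=> mF ndF aF; have mU : measurable (\bigcup_n F n) by exact: bigcup_measurable.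
apply: approximable_lim; first exact: L2f_indicI.
move=> e e0.
pose G n := F n `&` X0.
have mG n : measurable (G n) by exact: measurableI.
have UG : \bigcup_n G n = \bigcup_n F n `&` X0 by rewrite setI_bigcupl.
have ndG : nondecreasing_seq G.
  by move=> m n mn; apply/subsetPset; apply: setSI; exact/subsetPset/ndF.
have Gfin n : (mu (G n) < +oo)%E.
  by apply: le_lt_trans X0fin; apply: le_measure; rewrite ?inE//; exact: subIsetr.
have Ufin : (mu (\bigcup_n G n) < +oo)%E.
  apply: le_lt_trans X0fin; apply: le_measure; rewrite ?inE//.
    exact: bigcup_measurable.
  by rewrite UG; exact: subIsetr.
have mUG : measurable (\bigcup_n G n) by exact: bigcup_measurable.
have := @nondecreasing_cvg_mu _ _ _ mu G mG mUG ndG.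
have Ufn : mu (\bigcup_n G n) \is a fin_num by rewrite ge0_fin_numE.
rewrite -[X in _ --> X -> _]fineK// => /fine_cvg /cvgrPdist_lt /(_ e e0) [N _ hN].
exists \1_(G N); first by split; [exact: L2f_indicI|exact: aF].
rewrite -UG (_ : (fun x => _) = \1_(\bigcup_n G n `\` G N)); last first.
  apply/funext => x; rewrite !indicE in_setD.
  have [xG|xG] := boolP (x \in G N); last by rewrite subr0 andbT.
  rewrite mem_set ?subrr//=; exists N => //; exact: set_mem.
rewrite ip_indic; last exact: measurableD.
have := hN N (leqnn N); rewrite /= => H.
rewrite measureD// setIidr; last exact: bigcup_sup.
have Gfn : mu (G N) \is a fin_num by rewrite ge0_fin_numE.
by rewrite (fineB Ufn Gfn); move: H; rewrite ltr_norml => /andP[].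
Qed.

(** Dynkin's argument: the sets whose trace on [X0] is approximable form a lambda-system containing
    the pi-system [G]. The traces keep all measures finite, and [X0] itself is a step set. *)
Lemma approximable_generated (G : set (set T)) :
  @measurable _ T = <<s G >> -> setI_closed G -> step \1_X0 ->
  (forall A, G A -> approximable \1_(A `&` X0)) ->
  forall A, measurable A -> approximable \1_(A `&` X0).
Proof.
move=> mG GI SX0 GA.
pose P := [set A | measurable A /\ approximable \1_(A `&` X0)].
suff H : <<s G >> `<=` P by move=> A; rewrite mG => /H[].
apply: lambda_system_subset; [by []| | |by []]; last first.
  by move=> A GAA; split; [rewrite mG; exact: sub_sigma_algebra|exact: GA].
split=> //.
- by split => //; rewrite setTI; exact: approximable_step.
- move=> A B BA [mA aA] [mB aB]; split; first exact: measurableD.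
  rewrite (_ : \1_(_ `&` _) = (fun x => \1_(A `&` X0) x + (-1) * \1_(B `&` X0) x)).
    apply: approximableD => //; try exact: L2f_indicI.
      by apply: L2fZ; exact: L2f_indicI.
    by apply: approximableZ => //; exact: L2f_indicI.
  apply/funext => x; rewrite !indicE in_setI in_setD !in_setI.
  have [xA|xA] := boolP (x \in A); have [xB|xB] := boolP (x \in B);
    have [xX|xX] := boolP (x \in X0) => /=; rewrite ?mulr0 ?mulr1 ?addr0 ?subrr//.
  by rewrite (mem_set (BA _ (set_mem xB))) in xA.
- move=> F ndF HF; split; first by apply: bigcup_measurable => n _; have [] := HF n.
  by apply: approximable_bigcup => // n; have [] := HF n.
Qed.

Hypothesis dense_sets : forall A, measurable A -> approximable \1_(A `&` X0).

Import HBNNSimple.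

(** Simple functions increase to [f], and the squares of the differences are dominated by f^2, so
    they converge in L^2. A simple function is in turn a finite sum of multiples of indicators. *)
Lemma approximable_ge0 f : L2f mu f -> (forall x, 0 <= f x) ->
  (forall x, ~ X0 x -> f x = 0) -> approximable f.
Proof.
move=> Lf f0 fX0; apply: approximable_lim => // e e0.
have mf : measurable_fun setT (EFin \o f) by apply/measurable_EFinP; case: Lf.
pose g n := nnsfun_approx measurableT mf n.
have fE0 x : setT x -> (0 <= (EFin \o f) x)%E by rewrite /= lee_fin.
have gle n x : 0 <= g n x <= f x.
  apply/andP; split; first exact: fun_ge0.
  by rewrite /g nnsfun_approxE -lee_fin; exact: (le_approx n fE0).
have Lg n : L2f mu (g n).
  apply: (L2f_le _ Lf) => // x; have /andP[g0 gf] := gle n x.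
  by rewrite !ger0_norm.
have gc x : g n x @[n --> \oo] --> f x.
  by have := cvg_nnsfun_approx measurableT mf fE0 (I : setT x); move/fine_cvg.
have ig : mu.-integrable setT (EFin \o (fun x => f x ^+ 2)) by case: Lf.
have [|||||_ + _] := @dominated_convergence _ _ _ mu _ measurableT
    (fun n => EFin \o (fun x => (f x - g n x) ^+ 2)) (fun=> 0%E)
    (EFin \o (fun x => f x ^+ 2)).
- move=> n; apply/measurable_EFinP; apply: measurable_funX; apply: measurable_funB.
    by case: Lf.
  by [].
- exact: measurable_cst.
- apply: aeW => x _; apply/fine_cvgP; split; first exact: nearW.
  rewrite [X in _ --> X](_ : _ = (f x - f x) ^+ 2); last by rewrite subrr expr0n.
  by apply: cvgM; apply: cvgB => //; exact: cvg_cst.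
- exact: ig.
- apply: aeW => x n _ /=; rewrite lee_fin ger0_norm ?sqr_ge0//.
  have /andP[g0 gf] := gle n x.
  by rewrite lerXn2r ?nnegrE ?subr_ge0// gerBl.
under eq_fun do under eq_integral do
  rewrite sube0 gee0_abs ?lee_fin ?sqr_ge0//.
move=> /fine_cvg /cvgrPdist_lt /(_ e e0) [N _ hN].
exists (g N); last first.
  have := hN N (leqnn N); rewrite /= sub0r normrN (integral_sqr (L2fB Lf (Lg N))).
  exact: le_lt_trans (ler_norm _).
split => //.
have gX0 x : ~ X0 x -> g N x = 0.
  by move=> nX; apply/eqP; rewrite eq_le; have := gle N x; rewrite (fX0 x nX) andbC.
have [k [a Ea]] : exists k (a : 'I_k -> R),
    forall x, g N x = \sum_(i < k) a i * \1_(g N @^-1` [set a i]) x.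
  by do 2!eexists; exact: fimfunEord.
(* The approximant vanishes off [X0], so its level sets may be cut by [X0]; this makes the level set
   of the value 0 finite as well. *)
have -> : (g N : T -> R) = fun x => \sum_(i < k)
    a i * \1_(g N @^-1` [set a i] `&` X0) x.
  apply/funext => x; have [Xx|nX] := pselect (X0 x).
    rewrite {1}Ea; apply: eq_bigr => i _.
    by rewrite !indicE in_setI (mem_set Xx) andbT.
  rewrite gX0// big1 => // i _.
  by rewrite indicE in_setI (memNset nX) andbF mulr0.
have mpre i : measurable (g N @^-1` [set a i]) by [].
elim: k a {Ea} mpre => [|n IH] a mpre.
  under eq_fun do rewrite big_ord0.
  by apply: approximable_step; split; [exact: L2f0|exists 0%N].
under eq_fun do rewrite big_ord_recr /=.
apply: approximableD => //.
- by apply: L2f_sum => i _; apply: L2fZ; exact: L2f_indicI.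
- by apply: L2fZ; exact: L2f_indicI.
- exact: (IH (fun i => a (widen_ord (leqnSn n) i))).
- by apply: approximableZ; [exact: L2f_indicI|exact: dense_sets].
Qed.

End L2_density.

Section tensor.
Context {R : realType} d1 d2 (T1 : measurableType d1) (T2 : measurableType d2).
Variables (m1 : {sigma_finite_measure set T1 -> \bar R})
  (m2 : {sigma_finite_measure set T2 -> \bar R}).
Implicit Types (f s : T1 -> R) (g t : T2 -> R).

Definition tensor f g : T1 * T2 -> R := fun z => f z.1 * g z.2.

Lemma measurable_tensor f g : measurable_fun setT f -> measurable_fun setT g ->
  measurable_fun setT (tensor f g).
Proof.
move=> mf mg; apply: measurable_funM.
  exact: (measurableT_comp mf measurable_fst).
exact: (measurableT_comp mg measurable_snd).
Qed.

Lemma integral_tensor f g : m1.-integrable setT (EFin \o f) ->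
  m2.-integrable setT (EFin \o g) ->
  (m1 \x m2)%E.-integrable setT (EFin \o tensor f g) /\
  \int[(m1 \x m2)%E]_z tensor f g z = \int[m1]_x f x * \int[m2]_y g y.
Proof.
move=> If Ig.
have mf : measurable_fun setT f by have /integrableP[/measurable_EFinP] := If.
have mg : measurable_fun setT g by have /integrableP[/measurable_EFinP] := Ig.
have mfg : measurable_fun setT (EFin \o tensor f g).
  by apply/measurable_EFinP; exact: measurable_tensor.
have ffin := integrable_fin_num measurableT If.
have gfin := integrable_fin_num measurableT Ig.
have afin := integrable_fin_num measurableT (integrable_abse Ig).
have I12 : (m1 \x m2)%E.-integrable setT (EFin \o tensor f g).
  apply/integrable12ltyP => //.
  have -> : (fun x => \int[m2]_y `|(EFin \o tensor f g) (x, y)|)%E =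
    (fun x => (fine (\int[m2]_y `|(g y)%:E|))%:E * `|(f x)%:E|)%E.
    apply/funext => x; rewrite fineK// muleC -ge0_integralZl//.
      by apply: eq_integral => y _; rewrite /tensor /= normrM EFinM.
    by apply: measurableT_comp => //; exact/measurable_EFinP.
  rewrite ge0_integralZl//.
  - by rewrite lte_mul_pinfty ?lee_fin ?fine_ge0 ?integral_ge0//; have /integrableP[] := If.
  - by apply: measurableT_comp => //; exact/measurable_EFinP.
  - by rewrite lee_fin fine_ge0// integral_ge0.
split => //; rewrite /Rintegral -integral12_prod_meas1//.
have -> : (\int[m1]_x fubini_F m2 (EFin \o tensor f g) x)%E =
    (\int[m1]_x ((fine (\int[m2]_y (g y)%:E))%:E * (f x)%:E))%E.
  apply: eq_integral => x _; rewrite /fubini_F fineK// muleC.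
  rewrite -(integralZl measurableT Ig).
  by apply: eq_integral => y _; rewrite /tensor /= EFinM.
by rewrite (integralZl measurableT If) fineM// mulrC.
Qed.

Lemma L2f_tensor f g : L2f m1 f -> L2f m2 g -> L2f (m1 \x m2)%E (tensor f g).
Proof.
move=> [mf f2] [mg g2]; split; first exact: measurable_tensor.
have [+ _] := integral_tensor f2 g2; apply: eq_integrable => // z _ /=.
by rewrite /tensor exprMn.
Qed.

Lemma ip_tensor f s g t : L2f m1 f -> L2f m1 s -> L2f m2 g -> L2f m2 t ->
  ip (m1 \x m2)%E (tensor f g) (tensor s t) = ip m1 f s * ip m2 g t.
Proof.
move=> Lf Ls Lg Lt.
have [_ <-] := integral_tensor (L2f_mul Lf Ls) (L2f_mul Lg Lt).
by apply: eq_Rintegral => z _; rewrite /tensor; ring.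
Qed.

Variables (rl1 : nat -> T1 -> T1 -> Prop) (rl2 : nat -> T2 -> T2 -> Prop).
Variables (X1 : set T1) (X2 : set T2).
Hypotheses (rl1S : forall M x y, rl1 M.+1 x y -> rl1 M x y)
  (rl2S : forall M x y, rl2 M.+1 x y -> rl2 M x y).

Definition rl_prod M (z z' : T1 * T2) := rl1 M z.1 z'.1 /\ rl2 M z.2 z'.2.

Lemma rl_prodS M z z' : rl_prod M.+1 z z' -> rl_prod M z z'.
Proof. by move=> [? ?]; split; [exact: rl1S|exact: rl2S]. Qed.

Lemma step_tensor s t : step m1 rl1 s -> step m2 rl2 t ->
  step (m1 \x m2)%E rl_prod (tensor s t).
Proof.
move=> [Ls [M hM]] [Lt [N hN]]; split; first exact: L2f_tensor.
exists (maxn M N) => x y [r1 r2]; congr (_ * _).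
  by apply: hM; apply: (rl_le rl1S) r1; exact: leq_maxl.
by apply: hN; apply: (rl_le rl2S) r2; exact: leq_maxr.
Qed.

Hypotheses (mX1 : measurable X1) (mX2 : measurable X2)
  (X1fin : (m1 X1 < +oo)%E) (X2fin : (m2 X2 < +oo)%E).
Hypotheses (SX1 : step m1 rl1 \1_X1) (SX2 : step m2 rl2 \1_X2).

Lemma indic_tensor (A : set T1) (B : set T2) : \1_(A `*` B) = tensor \1_A \1_B.
Proof. by apply/funext => z; rewrite indicX. Qed.

Lemma step_setX : step (m1 \x m2)%E rl_prod \1_(X1 `*` X2).
Proof. by rewrite indic_tensor; exact: step_tensor. Qed.

Hypotheses
  (dense1 : forall A, measurable A -> approximable m1 rl1 \1_(A `&` X1))
  (dense2 : forall A, measurable A -> approximable m2 rl2 \1_(A `&` X2)).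

Lemma approximable_setX (A : set T1) (B : set T2) : measurable A -> measurable B ->
  approximable (m1 \x m2)%E rl_prod \1_((A `*` B) `&` (X1 `*` X2)).
Proof.
move=> mA mB e e0.
have LA : L2f m1 \1_(A `&` X1) by exact: L2f_indicI.
have LB : L2f m2 \1_(B `&` X2) by exact: L2f_indicI.
have B0 := ip_ge0 m2 \1_(B `&` X2).
have e1 : 0 < e / (4 * (ip m2 \1_(B `&` X2) \1_(B `&` X2) + 1)).
  by rewrite divr_gt0// mulr_gt0// ltr_wpDl.
have [s Ss hs] := dense1 mA e1.
have s0 := ip_ge0 m1 s.
(* The tolerance for [t] depends on the norm of [s], so [t] is chosen second. The difference splits
   as (1_A - s) 1_B + s (1_B - t), and [ipDD_le] doubles both terms: hence the quarters. *)
have e2 : 0 < e / (4 * (ip m1 s s + 1)) by rewrite divr_gt0// mulr_gt0// ltr_wpDl.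
have [t St ht] := dense2 mB e2.
exists (tensor s t); first exact: step_tensor.
have LfB : L2f m1 (fun x => \1_(A `&` X1) x - s x) by exact: L2fB LA Ss.1.
have LgB : L2f m2 (fun x => \1_(B `&` X2) x - t x) by exact: L2fB LB St.1.
rewrite -setXI (_ : (fun x => _) = (fun z =>
   tensor (fun x => \1_(A `&` X1) x - s x) \1_(B `&` X2) z +
   tensor s (fun y => \1_(B `&` X2) y - t y) z)); last first.
  by apply/funext => z; rewrite indicX /tensor; ring.
apply: (le_lt_trans (ipDD_le (L2f_tensor LfB LB) (L2f_tensor Ss.1 LgB))).
rewrite !ip_tensor//; [|exact: Ss.1..].
move: hs ht; rewrite !ltr_pdivlMr ?mulr_gt0 ?ltr_wpDl//.
have := ip_ge0 m1 (fun x => \1_(A `&` X1) x - s x).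
have := ip_ge0 m2 (fun x => \1_(B `&` X2) x - t x).
move: (ip m1 s s) s0 (ip m2 \1_(B `&` X2) _) B0 => p p0 q q0.
move: (ip _ _ _) (ip _ _ _) => a b a0 b0 ha hb; nra.
Qed.

Lemma dense_setX A : measurable A ->
  approximable (m1 \x m2)%E rl_prod \1_(A `&` (X1 `*` X2)).
Proof.
apply: (approximable_generated rl_prodS (measurableX mX1 mX2)
  (product_measure_lty mX1 mX2 X1fin X2fin) (measurable_prod_measurableType _ _)).
- move=> Y Z [Y1 mY1 [Y2 mY2 <-]] [Z1 mZ1 [Z2 mZ2 <-]].
  exists (Y1 `&` Z1); first exact: measurableI.
  by exists (Y2 `&` Z2); [exact: measurableI|rewrite setXI].
- exact: step_setX.
- by move=> _ [B mB [C mC <-]]; exact: approximable_setX.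
Qed.

End tensor.

Section dyadic_line.
Context {R : realType} (r : R).
Hypothesis r0 : 0 < r.
Local Notation leb := (@lebesgue_measure R).
Local Notation line := (measurableTypeR R).
Implicit Types t x y : R.

(* The line is scaled so that [-r, 3r) becomes [0, 1).  The domain will lie in
   [-r, r)^3, so that some boxes of every level of the big cube avoid it. *)
Definition grid (n : nat) (t : R) : R := 2 ^+ n * ((t + r) / (4 * r)).

Definition same_cell (n : nat) (x y : line) : Prop :=
  Num.floor (grid n x) = Num.floor (grid n y).

Lemma floor_grid_half n t :
  Num.floor (grid n t) = (Num.floor (grid n.+1 t) %/ 2)%Z.
Proof.
clear r0; apply/floor_def; set k := Num.floor (grid n.+1 t).
have := floor_itv (grid n.+1 t); rewrite -/k /grid exprS -mulrA.
move: ((2 ^+ n * _)) => g /andP[k1 k2].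
have E1 : k = ((k %/ 2)%Z * 2 + (k %% 2)%Z)%R by exact: divz_eq.
have m0 : 0 <= (k %% 2)%Z by exact: modz_ge0.
have m1 : (k %% 2)%Z < 2 by exact: ltz_pmod.
have K1 : ((k %/ 2)%Z * 2)%R%:~R <= k%:~R :> R by rewrite ler_int; lia.
have K2 : (k + 1)%:~R <= (((k %/ 2)%Z + 1) * 2)%:~R :> R by rewrite ler_int; lia.
by rewrite !intrM in K1 K2; apply/andP; split; lra.
Qed.

Lemma same_cellS n x y : same_cell n.+1 x y -> same_cell n x y.
Proof. by rewrite /same_cell => E; rewrite (floor_grid_half n x) (floor_grid_half n y) E. Qed.

Definition line0 : set line := `[- r, 3 * r[%classic.

Lemma line0P t : line0 t <-> 0 <= Num.floor (grid 0 t) < 1.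
Proof.
rewrite /line0 /= in_itv /= /grid expr0 mul1r.
have r4 : 0 < 4 * r by rewrite mulr_gt0.
rewrite floor_ge0 -[(_ < 1)%R]/(_ < 1)%R floor_lt_int.
rewrite pmulr_lge0 ?invr_gt0// ltr_pdivrMr// mul1r.
by split => /andP[h1 h2]; apply/andP; split; lra.
Qed.

Lemma step_line0 : step leb same_cell \1_line0.
Proof.
split; first by apply: L2f_indic; [exact: measurable_itv|exact: lebesgue_itvco_lty].
exists 0%N => x y xy; rewrite !indicE; congr (nat_of_bool _)%:R.
by apply/idP/idP; rewrite !inE => /line0P h; apply/line0P; rewrite ?xy// -xy.
Qed.

Lemma pow2_gt (x : R) : exists M, x < 2 ^+ M.
Proof.
exists (Num.truncn x).+1; apply: (lt_le_trans (truncnS_gt x)).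
by rewrite -natrX ler_nat; exact/ltnW/ltn_expl.
Qed.

Definition corner (n : nat) (k : int) : R := 4 * r * k%:~R / 2 ^+ n - r.

Lemma grid_lt n k t : (grid n t < k%:~R) = (t < corner n k).
Proof.
have r4 : 0 < 4 * r by rewrite mulr_gt0.
have p2 : 0 < 2 ^+ n :> R by rewrite exprn_gt0.
rewrite /grid /corner mulrA ltr_pdivrMr// ltrBrDr ltr_pdivlMr//.
by congr (_ < _); ring.
Qed.

Lemma cellE n k t : (Num.floor (grid n t) == k) = (t \in `[corner n k, corner n (k + 1)[).
Proof.
rewrite in_itv/= -grid_lt leNgt -grid_lt -leNgt.
apply/eqP/idP => [<-|]; first exact: floor_itv.
exact: floor_def.
Qed.

Lemma grid_le n x y : x <= y -> grid n x <= grid n y.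
Proof.
move=> xy; have i4 : 0 <= (4 * r)^-1 by rewrite invr_ge0 mulr_ge0// ltW.
have p2 : 0 <= 2 ^+ n :> R by rewrite exprn_ge0.
by rewrite /grid; apply: ler_wpM2l => //; apply: ler_wpM2r => //; rewrite lerD2r.
Qed.

(** The ray is cut at the left end of the cell of level [M] that contains [a]. The error is carried
    by this single cell, of length 4 r / 2^M < e. *)
Lemma approximable_ray a : approximable leb same_cell \1_(`]-oo, a[ `&` line0).
Proof.
move=> e e0.
have r4 : 0 < 4 * r by rewrite mulr_gt0.
have [M hM] := pow2_gt (4 * r / e).
have p2 : 0 < 2 ^+ M :> R by rewrite exprn_gt0.
set k := Num.floor (grid M a).
have ml (x : R) : measurable ((`]-oo, x[%classic : set line) `&` line0).
  by apply: measurableI; exact: measurable_itv.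
have L x : L2f leb \1_(`]-oo, x[ `&` line0).
  apply: (L2f_indic (ml x)).
  have := lebesgue_itvco_lty (- r) (3 * r); apply: le_lt_trans.
  apply: le_measure; rewrite ?inE; [exact: ml|exact: measurable_itv|].
  exact: subIsetr.
exists \1_(`]-oo, corner M k[ `&` line0).
  split => //; exists M => x y xy; rewrite !indicE; congr (nat_of_bool _)%:R.
  have xy0 : same_cell 0 x y by exact: (rl_le same_cellS (leq0n M)).
  have H u v : same_cell M u v -> same_cell 0 u v ->
      (`]-oo, corner M k[ `&` line0) u -> (`]-oo, corner M k[ `&` line0) v.
    move=> uv uv0 [/= h1 h2]; split; last by apply/line0P; rewrite -uv0; apply/line0P.
    move: h1; rewrite /= !in_itv/= -!grid_lt -!floor_lt_int.
    by rewrite (uv : Num.floor _ = Num.floor _).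
  by apply/idP/idP; rewrite !inE; apply: H.
have Lc : L2f leb (\1_(`[corner M k, corner M (k + 1)[)).
  by apply: L2f_indic; [exact: measurable_itv|exact: lebesgue_itvco_lty].
apply: (@le_lt_trans _ _ (ip leb (\1_(`[corner M k, corner M (k + 1)[))
   (\1_(`[corner M k, corner M (k + 1)[)))).
  apply: ip_norm_le => //; first exact: L2fB.
  move=> t; rewrite !indicE !in_setI.
  have [t0|t0] := boolP (t \in line0); last by rewrite !andbF subrr normr0.
  rewrite !andbT !mem_setE -cellE !in_itv/= -!grid_lt -floor_lt_int.
  have [ta|ta] := ltrP t a; last first.
    have : k <= Num.floor (grid M t).
      by apply: le_floor; exact: grid_le.
    by rewrite leNgt => /negbTE ->; rewrite subrr normr0.
  have : Num.floor (grid M t) <= k.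
    by apply: le_floor; apply: grid_le; exact: ltW.
  rewrite le_eqVlt => /predU1P[->|h].
    by rewrite eqxx ltxx subr0.
  by rewrite h subrr normr0.
have E : corner M (k + 1) - corner M k = 4 * r / 2 ^+ M.
  by rewrite /corner intrD; field; exact: lt0r_neq0.
have El : @lebesgue_measure R `[corner M k, corner M (k + 1)[%classic =
    (4 * r / 2 ^+ M)%:E.
  by rewrite lebesgue_measure_itv/= lte_fin -subr_gt0 E divr_gt0// -EFinB E.
rewrite ip_indic; last exact: measurable_itv.
rewrite [X in fine X]El /= ltr_pdivrMr//.
by move: hM; rewrite ltr_pdivrMr// [X in _ < X -> _]mulrC.
Qed.

Lemma dense_line (A : set line) : measurable A ->
  approximable leb same_cell \1_(A `&` line0).
Proof.
have mX : measurable line0 by exact: measurable_itv.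
apply: (@approximable_generated _ line _ leb same_cell line0 same_cellS mX
  (lebesgue_itvco_lty (- r) (3 * r)) (@RGenInftyO.G R) (RGenInftyO.measurableE R)).
- move=> _ _ [x ->] [y ->]; exists (Num.min x y); apply/seteqP.
  split=> t /=; rewrite !in_itv/= lt_min; first by move=> [-> ->].
  by move=> /andP.
- exact: step_line0.
- by move=> _ [a ->]; exact: approximable_ray.
Qed.

End dyadic_line.

Section dyadic_space.
Context {R : realType} (r : R).
Hypothesis r0 : 0 < r.
Local Notation line := (measurableTypeR R).

Definition rl2 : nat -> line * line -> line * line -> Prop :=
  rl_prod (same_cell r) (same_cell r).
Definition rl3 : nat -> R3 R -> R3 R -> Prop := rl_prod rl2 (same_cell r).
Definition rl6 : nat -> R3 R * R3 R -> R3 R * R3 R -> Prop := rl_prod rl3 rl3.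
Definition box0 : set (R3 R) := (line0 r `*` line0 r) `*` line0 r.

Lemma rl2S M x y : rl2 M.+1 x y -> rl2 M x y.
Proof. exact: (rl_prodS (same_cellS (r := r)) (same_cellS (r := r))). Qed.

Lemma rl3S M x y : rl3 M.+1 x y -> rl3 M x y.
Proof. exact: (rl_prodS rl2S (same_cellS (r := r))). Qed.

Lemma rl6S M z z' : rl6 M.+1 z z' -> rl6 M z z'.
Proof. exact: (rl_prodS rl3S rl3S). Qed.

Lemma measurable_line0 : measurable (line0 r).
Proof. exact: measurable_itv. Qed.

Lemma line0_lty : (@lebesgue_measure R (line0 r) < +oo)%E.
Proof. exact: lebesgue_itvco_lty. Qed.

Let mline2 : measurable (line0 r `*` line0 r).
Proof. exact: (measurableX measurable_line0 measurable_line0). Qed.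

Let line2_lty : (@lebesgue2 R (line0 r `*` line0 r) < +oo)%E.
Proof. exact: product_measure_lty measurable_line0 measurable_line0 line0_lty line0_lty. Qed.

Lemma measurable_box0 : measurable box0.
Proof. exact: (measurableX mline2 measurable_line0). Qed.

Lemma box0_lty : (mu3 box0 < +oo)%E.
Proof. exact: (product_measure_lty mline2 measurable_line0 line2_lty line0_lty). Qed.

Let step2 : step (@lebesgue2 R) rl2 \1_(line0 r `*` line0 r).
Proof.
exact: (@step_setX R _ _ _ _ (@lebesgue_measure R) (@lebesgue_measure R)
  _ _ _ _ (same_cellS (r := r)) (same_cellS (r := r))
  (step_line0 r0) (step_line0 r0)).
Qed.

Let dense2 A : measurable A ->
  approximable (@lebesgue2 R) rl2 \1_(A `&` (line0 r `*` line0 r)).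
Proof.
exact: (@dense_setX R _ _ _ _ (@lebesgue_measure R) (@lebesgue_measure R)
  _ _ _ _ (same_cellS (r := r)) (same_cellS (r := r))
  measurable_line0 measurable_line0 line0_lty line0_lty
  (step_line0 r0) (step_line0 r0) (dense_line r0) (dense_line r0)).
Qed.

Lemma step_box0 : step mu3 rl3 \1_box0.
Proof. exact: (@step_setX R _ _ _ _ (@lebesgue2 R) (@lebesgue_measure R) _ _ _ _
  rl2S (same_cellS (r := r)) step2 (step_line0 r0)). Qed.

Lemma dense3 A : measurable A -> approximable mu3 rl3 \1_(A `&` box0).
Proof.
exact: (@dense_setX R _ _ _ _ (@lebesgue2 R) (@lebesgue_measure R) _ _ _ _
  rl2S (same_cellS (r := r)) mline2 measurable_line0
  line2_lty line0_lty step2 (step_line0 r0) dense2 (dense_line r0)).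
Qed.

Lemma dense6 A : measurable A -> approximable mu6 rl6 \1_(A `&` (box0 `*` box0)).
Proof.
exact: (@dense_setX R _ _ _ _ (@mu3 R) (@mu3 R) _ _ _ _
  rl3S rl3S measurable_box0 measurable_box0 box0_lty box0_lty
  step_box0 step_box0 dense3 dense3).
Qed.

End dyadic_space.

(** * Boxes and their children *)

Section boxes.
Context {R : realType} (r : R).
Hypothesis r0 : 0 < r.
Local Notation coord := Defs.coord.
Implicit Types (x : R3 R) (L : nat) (p q c : 'I_3 -> nat).

Definition cellnum L (t : R) : int := Num.floor (grid r L t).

Definition in_box L p x : bool := [forall j, cellnum L (coord x j) == (p j)%:Z].

Definition qbox L p x : R := (in_box L p x)%:R.

Definition side L : R := 4 * r / 2 ^+ L.

Definition pos L := {ffun 'I_3 -> 'I_(2 ^ L)}.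

Definition pos_nat L (p : pos L) : 'I_3 -> nat := fun j => p j.

Definition chi L (k : nat) (t : R) : R := (cellnum L t == k%:Z)%:R.

Lemma side_gt0 L : 0 < side L.
Proof. by rewrite divr_gt0 ?exprn_gt0// mulr_gt0. Qed.

Lemma sideS L : side L.+1 = side L / 2.
Proof. by rewrite /side exprS; field; rewrite expf_neq0. Qed.

Lemma chiE L k :
  chi L k = \1_(`[corner r L k, corner r L k + side L[) :> (R -> R).
Proof.
apply/funext => t; rewrite /chi /cellnum cellE// indicE mem_setE.
by congr (nat_of_bool (_ \in `[_, _[))%:R; rewrite /corner /side intrD; field; rewrite expf_neq0.
Qed.

Lemma bump_chi L k : bump (chi L k).
Proof. by rewrite chiE; exact: bump_indic. Qed.

Lemma qbox_prod L p x : qbox L p x = \prod_j chi L (p j) (coord x j).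
Proof.
rewrite /qbox /in_box; case: (boolP [forall j, _]) => [/forallP H|].
  by rewrite big1// => j _; rewrite /chi H.
rewrite negb_forall => /existsP[j /negbTE Hj].
by rewrite (bigD1 j)//= /chi Hj mul0r.
Qed.

Lemma qbox_setE L p : qbox L p =
  \1_((`[corner r L (p (Ordinal (isT : 0 < 3)%N)),
         corner r L (p (Ordinal (isT : 0 < 3)%N)) + side L[ `*`
       `[corner r L (p (Ordinal (isT : 1 < 3)%N)),
         corner r L (p (Ordinal (isT : 1 < 3)%N)) + side L[) `*`
       `[corner r L (p (Ordinal (isT : 2 < 3)%N)),
         corner r L (p (Ordinal (isT : 2 < 3)%N)) + side L[).
Proof.
by apply/funext => x; rewrite qbox_prod prod_ord3 !chiE !indicX.
Qed.

Let mI L k : measurable (`[corner r L k, corner r L k + side L[%classic :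
  set (measurableTypeR R)).
Proof. exact: measurable_itv. Qed.

Let muI L k : @lebesgue_measure R `[corner r L k, corner r L k + side L[%classic =
  (side L)%:E.
Proof.
rewrite lebesgue_measure_itv/= lte_fin ltrDl side_gt0 -EFinB; congr EFin; ring.
Qed.

Let mu3_setX (A B C : set (measurableTypeR R)) :
  measurable A -> measurable B -> measurable C ->
  mu3 ((A `*` B) `*` C) = (lebesgue_measure A * lebesgue_measure B * lebesgue_measure C)%E.
Proof.
move=> mA mB mC; rewrite /mu3/= /lebesgue3 product_measure1E//; last exact: measurableX.
by congr (_ * _)%E; exact: product_measure1E.
Qed.

Lemma L2f_qbox L p : L2f mu3 (qbox L p).
Proof.
rewrite qbox_setE; apply: L2f_indic.
  by apply: measurableX => //; apply: measurableX.
apply: product_measure_lty => //; first exact: measurableX.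
  by apply: product_measure_lty => //; exact: lebesgue_itvco_lty.
exact: lebesgue_itvco_lty.
Qed.

Lemma ip_qbox L p : ip mu3 (qbox L p) (qbox L p) = side L ^+ 3.
Proof.
rewrite qbox_setE ip_indic; last by apply: measurableX => //; apply: measurableX.
rewrite [X in fine X]mu3_setX// [X in (X * _ * _)%E]muI [X in (_ * X * _)%E]muI [X in (_ * _ * X)%E]muI.
by rewrite /= !exprS expr0 mulr1 mulrA.
Qed.

Lemma in_box_inj L p q x : in_box L p x -> in_box L q x -> p =1 q.
Proof.
move=> /forallP hp /forallP hq j; have := hp j; rewrite (eqP (hq j)).
by move=> /eqP[].
Qed.

Lemma pos_in_box_inj L (p q : pos L) x : in_box L (pos_nat p) x -> in_box L (pos_nat q) x -> p = q.
Proof. by move=> hp hq; apply/ffunP => j; apply: ord_inj; exact: (in_box_inj hp hq). Qed.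

Lemma sum_qbox L (P : pred (pos L)) x :
  \sum_(p | P p) qbox L (pos_nat p) x = [exists p : pos L, P p && in_box L (pos_nat p) x]%:R.
Proof.
case: (boolP [exists p, _]) => [/existsP[p /andP[Pp hp]]|].
  rewrite (bigD1 p)//= {1}/qbox hp big1 ?addr0// => q /andP[_ qp].
  rewrite /qbox; case: (boolP (in_box L (pos_nat q) x)) => // hq.
  by rewrite (pos_in_box_inj hq hp) eqxx in qp.
rewrite negb_exists => /forallP H; apply: big1 => p Pp.
by have := H p; rewrite Pp /= /qbox => /negbTE ->.
Qed.

Lemma cellnum_half L t : cellnum L t = (cellnum L.+1 t %/ 2)%Z.
Proof. exact: floor_grid_half. Qed.

Lemma half_pos_subproof L (k : 'I_(2 ^ L.+1)) : (k./2 < 2 ^ L)%N.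
Proof. by rewrite ltn_half_double -mul2n -expnS. Qed.

Definition parent_pos L (q : pos L.+1) : pos L :=
  [ffun j => Ordinal (half_pos_subproof (q j))].

Lemma in_box_parent L (q : pos L.+1) x :
  in_box L.+1 (pos_nat q) x -> in_box L (pos_nat (parent_pos q)) x.
Proof.
move=> /forallP H; apply/forallP => j.
by rewrite cellnum_half (eqP (H j)) /pos_nat ffunE /=; lia.
Qed.

Lemma qbox_children L (p : pos L) x :
  qbox L (pos_nat p) x = \sum_(q | parent_pos q == p) qbox L.+1 (pos_nat q) x.
Proof.
rewrite sum_qbox /qbox; congr (nat_of_bool _)%:R.
apply/idP/existsP => [/forallP H|[q /andP[/eqP <-]]]; last exact: in_box_parent.
have /fin_all_exists[f Hf] : forall j, exists k : 'I_(2 ^ L.+1),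
    cellnum L.+1 (coord x j) = k%:Z.
  move=> j; have := H j; rewrite cellnum_half => /eqP E.
  have pj := ltn_ord (p j).
  rewrite /pos_nat in E; have e2 := expnS 2 L.
  have lt : (`|cellnum L.+1 (coord x j)| < 2 ^ L.+1)%N by lia.
  by exists (Ordinal lt) => /=; lia.
exists [ffun j => f j]; apply/andP; split.
  apply/eqP/ffunP => j; apply: ord_inj; rewrite ffunE /= ffunE.
  by have := H j; rewrite cellnum_half Hf /pos_nat => /eqP; lia.
by apply/forallP => j; rewrite Hf /pos_nat ffunE.
Qed.

(* By comparing the volumes. *)
Lemma card_children L (p : pos L) : #|[pred q | parent_pos q == p]| = 8%N.
Proof.
have E : qbox L (pos_nat p) = fun x => \sum_(q | parent_pos q == p) qbox L.+1 (pos_nat q) x.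
  by apply/funext => x; exact: qbox_children.
have := ip_qbox L (pos_nat p); rewrite {1}E ip_suml; last 2 first.
- by move=> q _; exact: L2f_qbox.
- exact: L2f_qbox.
have -> : \sum_(q | parent_pos q == p) ip mu3 (qbox L.+1 (pos_nat q)) (qbox L (pos_nat p)) =
    \sum_(q | parent_pos q == p) side L.+1 ^+ 3.
  apply: eq_bigr => q /eqP qp; rewrite -(ip_qbox L.+1 (pos_nat q)).
  apply: eq_Rintegral => x _; rewrite /qbox -!natrM !mulnb -qp.
  congr (nat_of_bool _)%:R; rewrite andbb.
  by apply/andP/idP => [[]//|h]; split => //; exact: in_box_parent.
rewrite sumr_const sideS => H.
have s0 : side L ^+ 3 != 0 by rewrite expf_neq0// gt_eqF// side_gt0.
move: H; set N := #|_| => H.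
have {}H : N%:R * (side L / 2) ^+ 3 = side L ^+ 3 by rewrite mulr_natl.
apply/eqP; rewrite -(eqr_nat R); apply/eqP/(mulIf s0).
clearbody N; move: (side L) (N%:R) H {s0} => t n H.
have -> : n * t ^+ 3 = 8 * (n * (t / 2) ^+ 3) by field.
by rewrite H.
Qed.

Lemma ip_qbox_neq L (p q : pos L) : p != q -> ip mu3 (qbox L (pos_nat p)) (qbox L (pos_nat q)) = 0.
Proof.
move=> pq; rewrite -(ip0l mu3 (qbox L (pos_nat q))); apply: eq_Rintegral => x _.
rewrite mul0r /qbox -natrM mulnb; case: (boolP (in_box L (pos_nat p) x)) => //= hp.
case: (boolP (in_box L (pos_nat q) x)) => //= hq.
by rewrite (pos_in_box_inj hp hq) eqxx in pq.
Qed.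

Lemma box0_coord x : box0 r x <-> forall j, line0 r (coord x j).
Proof.
split=> [[[h1 h2] h3] j|H].
  by case: j => -[|[|[|//]]] Hj.
by split; [split; [exact: (H (Ordinal (isT : 0 < 3)%N))|exact: (H (Ordinal (isT : 1 < 3)%N))]|
  exact: (H (Ordinal (isT : 2 < 3)%N))].
Qed.

Lemma line0_cellnum L t : line0 r t -> exists k : 'I_(2 ^ L), cellnum L t = k%:Z.
Proof.
rewrite /line0 /= in_itv /= => /andP[h1 h2].
have r4 : 0 < 4 * r by rewrite mulr_gt0.
have p2 : 0 < 2 ^+ L :> R by rewrite exprn_gt0.
have c0 : 0 <= cellnum L t.
  by rewrite /cellnum floor_ge0 /grid mulr_ge0 ?(ltW p2)// divr_ge0 ?(ltW r4)//; lra.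
have c1 : cellnum L t < (2 ^ L)%N%:Z.
  rewrite /cellnum floor_lt_int /grid -[X in _ < X]/((2 ^ L)%N%:R) natrX.
  rewrite -[X in _ < X]mulr1 ltr_pM2l// ltr_pdivrMr//; lra.
have lt : (`|cellnum L t| < 2 ^ L)%N by lia.
by exists (Ordinal lt) => /=; lia.
Qed.

Lemma box0_in_box L x : box0 r x -> exists p : pos L, in_box L (pos_nat p) x.
Proof.
move=> /box0_coord H.
have /fin_all_exists[f Hf] : forall j, exists k : 'I_(2 ^ L),
    cellnum L (coord x j) = k%:Z.
  by move=> j; exact: line0_cellnum.
by exists [ffun j => f j]; apply/forallP => j; rewrite Hf /pos_nat ffunE.
Qed.

Lemma in_box_box0 L (p : pos L) x : in_box L (pos_nat p) x -> box0 r x.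
Proof.
move=> /forallP H; apply/box0_coord => j; apply/line0P => //.
rewrite -/(cellnum 0 _).
have [k kL E] : exists2 k : nat, (k < 2 ^ L)%N & cellnum L (coord x j) = k%:Z.
  by exists (p j); [exact: ltn_ord|exact/eqP/H].
elim: L k kL E {p H} => [k|L IH k kL E]; first by rewrite expn0 => ? ->; lia.
apply: (IH k./2); first by rewrite ltn_half_double -mul2n -expnS.
by rewrite cellnum_half E; lia.
Qed.

Lemma sum_qbox1 L x : \sum_(p : pos L) qbox L (pos_nat p) x = \1_(box0 r) x.
Proof.
rewrite sum_qbox indicE; congr (nat_of_bool _)%:R.
apply/existsP/idP => [[p hp]|/set_mem/(@box0_in_box L)[p hp]].
  by rewrite mem_set//; exact: in_box_box0 hp.
by exists p.
Qed.

(** A representative point of each box: a function that is constant on the boxes takes there its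
    value on the box. *)
Definition box_corner L p : R3 R :=
  ((corner r L (p (Ordinal (isT : 0 < 3)%N)), corner r L (p (Ordinal (isT : 1 < 3)%N))),
   corner r L (p (Ordinal (isT : 2 < 3)%N))).

Lemma box_cornerP L p x : in_box L p x -> rl3 r L x (box_corner L p).
Proof.
have E (k : nat) : Num.floor (grid r L (corner r L k)) = k%:Z.
  apply/eqP; rewrite cellE// in_itv /= lexx /=.
  rewrite /corner ltrBlDr subrK ltr_pM2r ?invr_gt0 ?exprn_gt0//.
  by rewrite ltr_pM2l ?mulr_gt0// ltr_int; lia.
move=> /forallP H; have e j : Num.floor (grid r L (coord x j)) = (p j)%:Z.
  exact/eqP/H.
have e0 := e (Ordinal (isT : 0 < 3)%N); have e1 := e (Ordinal (isT : 1 < 3)%N).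
have e2 := e (Ordinal (isT : 2 < 3)%N); rewrite /coord/= in e0 e1 e2.
by split; [split|]; rewrite /same_cell /box_corner /= E ?e0 ?e1 ?e2.
Qed.

End boxes.

Lemma qboxE (R : realType) (r : R) L p x : qbox r L p x = (in_box r L p x)%:R.
Proof. by []. Qed.

Section children.
Context {R : realType} (r : R).
Hypothesis r0 : 0 < r.
Local Notation coord := Defs.coord.
Local Notation qbox := (qbox r).
Local Notation side := (side r).
Implicit Types (x : R3 R) (L : nat).

Lemma side_double L : side L = side L.+1 *+ 2.
Proof. by rewrite sideS mulr2n -splitr. Qed.

Lemma corner_double L (p : nat) : corner r L.+1 p.*2 = corner r L p.
Proof.
rewrite /corner exprS -[p.*2%:~R]/(p.*2%:R) -muln2 natrM.
by field; rewrite expf_neq0.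
Qed.

Lemma corner_doubleS L (p : nat) : corner r L.+1 p.*2.+1 = corner r L p + side L.+1.
Proof.
have -> : side L.+1 = (4 * r) / 2 ^+ L.+1 by [].
rewrite -(corner_double L) /corner -[p.*2.+1%:~R]/(p.*2.+1%:R) -natr1.
by rewrite -[p.*2%:~R]/(p.*2%:R); field; rewrite expf_neq0.
Qed.

Lemma haar_chi L (p : nat) t :
  haar (corner r L p) (side L.+1) t = chi r L.+1 p.*2 t - chi r L.+1 p.*2.+1 t.
Proof.
by rewrite /haar !chiE// corner_double corner_doubleS mulr2n addrA.
Qed.

Lemma chi_half L (k p : nat) : k./2 = p -> k = p.*2 \/ k = p.*2.+1.
Proof. by move=> <-; rewrite -{1 3}(odd_double_half k); case: (odd k); [right|left]. Qed.

(** Both indices are 2 p or 2 p + 1, so the factor l - k is -1, 0 or 1; it treats equal and opposite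
    halves in one formula. *)
Lemma chi_sub L (k l p : nat) t : k./2 = p -> l./2 = p ->
  chi r L.+1 k t - chi r L.+1 l t =
  (l%:R - k%:R) * haar (corner r L p) (side L.+1) t.
Proof.
rewrite haar_chi => /(chi_half L)[] -> /(chi_half L)[] ->; rewrite ?subrr ?mul0r//.
  by rewrite -natr1; ring.
by rewrite -natr1; ring.
Qed.

Lemma chi_ge0 L k t : 0 <= chi r L k t :> R.
Proof. by rewrite /chi. Qed.

Lemma chi_child L (k p : nat) t : k./2 = p -> chi r L.+1 k t <= chi r L p t.
Proof.
move=> kp; rewrite /chi (cellnum_half r L t) ler_nat.
case: eqP => // ->; rewrite (_ : (k%:Z %/ 2)%Z == p) //; lia.
Qed.

Variable D : set (R3 R).
Hypotheses (mD : measurable D) (Dfin : (mu3 D < +oo)%E).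

(* Two siblings are joined by moving one coordinate at a time; each move changes
   the indicator by a Haar function of that coordinate. *)
Lemma child_haar L (p c c' : 'I_3 -> nat) :
  (forall j, (c j)./2 = p j) -> (forall j, (c' j)./2 = p j) ->
  exists B : 'I_3 -> R3 R -> R,
  [/\ forall i, L2f mu3 (B i),
      forall i x, `|B i x| <= side L.+1 * qbox L p x &
      forall phi, test_function D phi ->
      ip mu3 (fun x => qbox L.+1 c x - qbox L.+1 c' x) phi =
      \sum_i ip mu3 (B i) (partial i phi)].
Proof.
move=> hc hc'; have h0 := side_gt0 r0 L.+1.
pose m (k : nat) (j : 'I_3) := if (j < k)%N then c' j else c j.
have hm k j : (m k j)./2 = p j by rewrite /m; case: ifP.
pose u (k j : 'I_3) (t : R) : R :=
  if j == k then haar (corner r L (p k)) (side L.+1) t else chi r L.+1 (m k j) t.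
have bu k j : bump (u k j).
  by rewrite /u; case: eqP => _; [exact: bump_haar|exact: bump_chi].
have bh k j : bump (hat k (u k) (corner r L (p k)) (side L.+1) j).
  by rewrite /hat; case: eqP => _; [exact/bumpN/bump_tent|exact: bu].
pose s (k : 'I_3) : R := (c' k)%:R - (c k)%:R.
pose B k x := s k * \prod_j hat k (u k) (corner r L (p k)) (side L.+1) j (coord x j).
have s1 k : `|s k| <= 1.
  rewrite /s; have := chi_half L (hc k); have := chi_half L (hc' k).
  by move=> [] -> [] ->; rewrite ?subrr ?normr0 ?ler01// -natr1 ler_norml;
    apply/andP; split; lra.
exists B; split.
- by move=> i; apply: L2fZ; exact: L2f_bump_prod.
- move=> i x; rewrite /B normrM -[X in _ <= X]mul1r ler_pM//.
  (* The tent is bounded by the side of the children on the cell of the parent; each remaining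
     factor is the indicator of a child cell, hence at most that of the parent. *)
  rewrite normr_prod (bigD1 i)//= qbox_prod [X in _ <= _ * X](bigD1 i)//= mulrA.
  apply: ler_pM => //; first by apply: prodr_ge0.
    rewrite /hat eqxx normrN; apply: le_trans (tent_le _ _ h0) _.
    by rewrite chiE// (side_double L).
  apply: ler_prod => j ji; rewrite normr_ge0 /= /hat (negbTE ji) /u (negbTE ji).
  by rewrite ger0_norm ?chi_ge0// chi_child.
move=> phi tphi; have Lphi := L2f_test mD Dfin tphi.
have -> : ip mu3 (fun x => qbox L.+1 c x - qbox L.+1 c' x) phi =
    \sum_i s i * ip mu3 (fun x => \prod_j u i j (coord x j)) phi.
  rewrite (eq_bigr (fun i => ip mu3 (fun x => s i * \prod_j u i j (coord x j)) phi)); last first.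
    by move=> i _; rewrite ipZl//; exact: L2f_bump_prod.
  rewrite -ip_suml//; last by move=> i _; apply: L2fZ; exact: L2f_bump_prod.
  congr ip; apply/funext => x.
  have Ec : qbox L.+1 c x = qbox L.+1 (m 0%N) x by [].
  have Ec' : qbox L.+1 c' x = qbox L.+1 (m 3) x.
    by rewrite !qbox_prod; apply: eq_bigr => j _; rewrite /m ltn_ord.
  (* The terms are negated because a telescoping sum is its last term minus its first. *)
  have := telescope_sumr (fun k => - qbox L.+1 (m k) x) (leq0n 3).
  rewrite Ec Ec' opprK addrC => <-; rewrite big_mkord; apply: eq_bigr => i _.
  rewrite opprK addrC !qbox_prod (bigD1 i)//= [X in _ - X](bigD1 i)//=.
  rewrite [in RHS](bigD1 i)//= {1}/u eqxx mulrA -(chi_sub L _ (hc i) (hc' i)).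
  have -> : m i i = c i by rewrite /m ltnn.
  have -> : m i.+1 i = c' i by rewrite /m leqnn.
  rewrite mulrBl; congr (_ * _ - _ * _); apply: eq_bigr => j ji.
    by rewrite /u (negbTE ji).
  rewrite /u (negbTE ji) /m ltnS leq_eqVlt.
  by rewrite (_ : (j == i :> nat) = false)//; apply/negbTE.
apply: eq_bigr => i _.
have ui : u i i = haar (corner r L (p i)) (side L.+1).
  by apply/funext => t; rewrite /u eqxx.
rewrite (test_haar tphi h0 (bu i) ui) ipZl//; first exact: L2f_bump_prod.
exact: L2f_test_partial tphi.
Qed.

Definition box_dev L (c : pos L.+1) : R3 R -> R :=
  fun x => qbox L.+1 (pos_nat c) x - 8^-1 * qbox L (pos_nat (parent_pos c)) x.

Lemma parent_half L (c : pos L.+1) j : (pos_nat c j)./2 = pos_nat (parent_pos c) j.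
Proof. by rewrite /pos_nat ffunE. Qed.

Lemma L2f_box_dev L (c : pos L.+1) : L2f mu3 (box_dev c).
Proof. by apply: L2fB; [exact: L2f_qbox|apply: L2fZ; exact: L2f_qbox]. Qed.

(** [box_dev c] is the average, over the eight children c' of the parent of [c] (including [c]), of
    the differences handled by [child_haar]. Averaging the fields preserves their bound, since all
    of them live on the parent box. *)
Lemma child_mean L (c : pos L.+1) : exists B : 'I_3 -> R3 R -> R,
  [/\ forall i, L2f mu3 (B i),
      forall i x, `|B i x| <= side L.+1 * qbox L (pos_nat (parent_pos c)) x &
      forall phi, test_function D phi ->
      ip mu3 (box_dev c) phi = \sum_i ip mu3 (B i) (partial i phi)].
Proof.
set p := parent_pos c.
have /choice[B HB] : forall c' : pos L.+1, exists B : 'I_3 -> R3 R -> R,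
    parent_pos c' = p ->
    [/\ forall i, L2f mu3 (B i),
      forall i x, `|B i x| <= side L.+1 * qbox L (pos_nat p) x &
      forall phi, test_function D phi ->
      ip mu3 (fun x => qbox L.+1 (pos_nat c) x - qbox L.+1 (pos_nat c') x) phi =
      \sum_i ip mu3 (B i) (partial i phi)].
  move=> c'; have [E|nE] := pselect (parent_pos c' = p); last first.
    by exists (fun _ _ => 0).
  have [B HB] := @child_haar L _ _ _ (parent_half c) (fun j => etrans (parent_half c' j)
    (congr1 (fun q : pos L => pos_nat q j) E)).
  by exists B.
have LB c' i : parent_pos c' == p -> L2f mu3 (B c' i).
  by move=> /eqP /HB[].
exists (fun i x => 8^-1 * \sum_(c' | parent_pos c' == p) B c' i x); split.
- by move=> i; apply: L2fZ; apply: L2f_sum => c' E; exact: LB.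
- move=> i x; rewrite normrM ger0_norm ?invr_ge0// ler_pdivrMl//.
  apply: (le_trans (ler_norm_sum _ _ _)).
  apply: (@le_trans _ _ (\sum_(c' | parent_pos c' == p)
     side L.+1 * qbox L (pos_nat p) x)).
    by apply: ler_sum => c' /eqP /HB[].
  by rewrite sumr_const (card_children r0) mulr_natl.
move=> phi tphi; have Lphi := L2f_test mD Dfin tphi.
have E : box_dev c = fun x => 8^-1 * \sum_(c' | parent_pos c' == p)
    (qbox L.+1 (pos_nat c) x - qbox L.+1 (pos_nat c') x).
  apply/funext => x; rewrite /box_dev -/p (@qbox_children _ r r0 _ p) sumrB sumr_const (card_children r0).
  by rewrite -mulr_natl; field.
have Lcc c' : L2f mu3 (fun x => qbox L.+1 (pos_nat c) x - qbox L.+1 (pos_nat c') x).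
  by apply: L2fB; exact: L2f_qbox.
rewrite E ipZl//; last by apply: L2f_sum.
rewrite ip_suml//.
under [RHS]eq_bigr => i _.
  rewrite ipZl; [|by apply: L2f_sum => c' /LB|exact: L2f_test_partial tphi].
  rewrite ip_suml; [|by move=> c' /LB|exact: L2f_test_partial tphi].
  over.
rewrite -mulr_sumr exchange_big /=; congr (_ * _).
by apply: eq_bigr => c' /eqP /HB[_ _]; exact.
Qed.

(** Gradients are restricted to one box before the bounds are summed: over disjoint boxes the local
    energies add up to a single global one, instead of one for each box. *)
Definition localize L (p : pos L) (g : R3 R -> R) : R3 R -> R :=
  fun x => qbox L (pos_nat p) x * g x.

Lemma L2f_localize L (p : pos L) g : L2f mu3 g -> L2f mu3 (localize p g).
Proof.
move=> Lg; apply: (L2f_le _ Lg) => [|x].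
  by apply: measurable_funM; [have [] := L2f_qbox r0 L (pos_nat p)|case: Lg].
rewrite /localize normrM !qboxE ger0_norm//.
by case: in_box; rewrite ?mul1r ?mul0r.
Qed.

Lemma sum_localize L g : L2f mu3 g ->
  \sum_(p : pos L) ip mu3 (localize p g) (localize p g) <= ip mu3 g g.
Proof.
move=> Lg.
have E (p : pos L) : ip mu3 (localize p g) (localize p g) = ip mu3 (localize p g) g.
  apply: eq_Rintegral => x _; rewrite /localize !qboxE.
  by case: in_box; rewrite ?mul1r// !mul0r.
under eq_bigr do rewrite E.
rewrite -ip_suml//; last by move=> p _; exact: L2f_localize.
have Ls : L2f mu3 (fun x => \sum_(p : pos L) localize p g x).
  by apply: L2f_sum => p _; exact: L2f_localize.
apply: le_Rintegral => //; [exact: L2f_mul|exact: L2f_mul|move=> x _].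
rewrite -mulr_suml sum_qbox1// -mulrA indicE.
by case: (_ \in _); rewrite ?mul1r ?mul0r// -expr2 sqr_ge0.
Qed.

(** Cauchy-Schwarz in each coordinate: the squared norm of B_i is at most [side L.+1 ^+ 2] times the
    volume [side L ^+ 3] of the parent. The factor 3 is the cost of squaring a sum over three
    coordinates. *)
Lemma box_dev_ip_sqr L (c : pos L.+1) u w : sobolev0_with 2%:E D u w ->
  ip mu3 (box_dev c) (u \_ D) ^+ 2 <= 3 * (side L.+1) ^+ 2 * side L ^+ 3 *
    \sum_i ip mu3 (localize (parent_pos c) (w i \_ D)) (localize (parent_pos c) (w i \_ D)).
Proof.
move=> H0; have [B [LB bB HB]] := child_mean c.
rewrite (sobolev0_ip mD Dfin H0 (L2f_box_dev c) LB HB).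
have Lw i : L2f mu3 (w i \_ D) by case: H0 => -[_ /(_ i) /inLp2E].
set p := parent_pos c in bB *.
have key i : ip mu3 (B i) (w i \_ D) ^+ 2 <= side L.+1 ^+ 2 * side L ^+ 3 *
    ip mu3 (localize p (w i \_ D)) (localize p (w i \_ D)).
  have -> : ip mu3 (B i) (w i \_ D) = ip mu3 (B i) (localize p (w i \_ D)).
    apply: eq_Rintegral => x _; rewrite /localize; have := bB i x.
    rewrite !qboxE; case: in_box; rewrite ?mul1r// mulr0 normr_le0 => /eqP ->.
    by rewrite !mul0r.
  apply: (le_trans (ip_cauchy_schwarz (LB i) (L2f_localize p (Lw i)))).
  rewrite ler_wpM2r ?ip_ge0// -(ip_qbox r0 L (pos_nat p)).
  have Lq := L2f_qbox r0 L (pos_nat p); have Lsq := L2fZ (side L.+1) Lq.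
  apply: (@le_trans _ _ (ip mu3 (fun x => side L.+1 * qbox L (pos_nat p) x)
     (fun x => side L.+1 * qbox L (pos_nat p) x))).
    apply: ip_norm_le => // x; rewrite [X in _ <= X]ger0_norm ?bB//.
    by rewrite mulr_ge0 ?(ltW (side_gt0 r0 _)).
  by rewrite ipZl// ipZr// mulrA -expr2.
set k := side L.+1 ^+ 2 * side L ^+ 3 in key *.
rewrite -[3 * _ * _]mulrA -/k -mulrA mulr_sumr.
have : \sum_i ip mu3 (B i) (w i \_ D) ^+ 2 <= \sum_i (k *
    ip mu3 (localize p (w i \_ D)) (localize p (w i \_ D))).
  by apply: ler_sum => i _; exact: key.
move=> K; apply: le_trans (ler_wpM2l _ K) => //.
rewrite !big_ord_recl !big_ord0 !addr0.
move: (ip _ _ _) (ip _ _ _) (ip _ _ _) => x y z.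
have := sqr_ge0 (x - y); have := sqr_ge0 (y - z); have := sqr_ge0 (x - z); nra.
Qed.

(** In a parent of volume V with pairing X, the gain is a variance: (8 / V) times the sum over the
    children of (x_c - X / 8)^2, that is, of squared pairings with [box_dev c]. The constant 192 is
    8 * 8 * 3: the factor above, the number of children, and the 3 of [box_dev_ip_sqr]. *)
Lemma refine_gain L u w : sobolev0_with 2%:E D u w ->
  \sum_(q : pos L.+1) ip mu3 (qbox L.+1 (pos_nat q)) (u \_ D) ^+ 2 / side L.+1 ^+ 3 -
  \sum_(p : pos L) ip mu3 (qbox L (pos_nat p)) (u \_ D) ^+ 2 / side L ^+ 3 <=
  192 * side L.+1 ^+ 2 * \sum_i ip mu3 (w i \_ D) (w i \_ D).
Proof.
move=> H0; have Lw i : L2f mu3 (w i \_ D) by case: H0 => -[_ /(_ i) /inLp2E].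
have Lu : L2f mu3 (u \_ D) by case: H0 => -[/inLp2E].
rewrite (partition_big (@parent_pos L) xpredT)//= -sumrB.
apply: (@le_trans _ _ (\sum_(p : pos L) 192 * side L.+1 ^+ 2 *
    \sum_i ip mu3 (localize p (w i \_ D)) (localize p (w i \_ D)))); last first.
  rewrite -mulr_sumr; apply: ler_wpM2l; first by rewrite mulr_ge0 ?sqr_ge0.
  by rewrite exchange_big /=; apply: ler_sum => i _; exact: sum_localize.
apply: ler_sum => p _.
set X := ip mu3 (qbox L (pos_nat p)) (u \_ D).
pose x (c : pos L.+1) := ip mu3 (qbox L.+1 (pos_nat c)) (u \_ D).
have XE : X = \sum_(c | parent_pos c == p) x c.
  rewrite /X /x -ip_suml//; last by move=> c _; exact: L2f_qbox.
  by congr ip; apply/funext => y; exact: qbox_children.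
have s0 := side_gt0 r0 L; have s1 := side_gt0 r0 L.+1.
have V : side L.+1 ^+ 3 = side L ^+ 3 / 8 by rewrite sideS; field.
have card8 := card_children r0 p.
have -> : \sum_(c | parent_pos c == p) x c ^+ 2 / side L.+1 ^+ 3 - X ^+ 2 / side L ^+ 3 =
    8 / side L ^+ 3 * \sum_(c | parent_pos c == p) (x c - 8^-1 * X) ^+ 2.
  have -> : \sum_(c | parent_pos c == p) (x c - 8^-1 * X) ^+ 2 =
      \sum_(c | parent_pos c == p) x c ^+ 2 - 8^-1 * X ^+ 2.
    transitivity (\sum_(c | parent_pos c == p)
        (x c ^+ 2 + (- 4^-1 * X) * x c + 64^-1 * X ^+ 2)).
      by apply: eq_bigr => c _; field.
    by rewrite !big_split -mulr_sumr -XE sumr_const card8 -[_ *+ 8]mulr_natl /=; field.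
  by rewrite -mulr_suml V; field; rewrite gt_eqF.
set W := \sum_i ip mu3 (localize p (w i \_ D)) (localize p (w i \_ D)).
have : \sum_(c | parent_pos c == p) (x c - 8^-1 * X) ^+ 2 <=
    \sum_(c | parent_pos c == p) (3 * side L.+1 ^+ 2 * side L ^+ 3 * W).
  apply: ler_sum => c /eqP cp; have := box_dev_ip_sqr c H0; rewrite /box_dev cp.
  rewrite ipBl ?ipZl//; try exact: L2f_qbox.
  by apply: L2fZ; exact: L2f_qbox.
rewrite sumr_const card8 -[X in _ <= X]mulr_natl => K.
have k0 : 0 <= 8 / side L ^+ 3 by rewrite divr_ge0// exprn_ge0// ltW.
apply: (le_trans (ler_wpM2l k0 K)); rewrite le_eqVlt; apply/orP; left; apply/eqP.
by field; rewrite gt_eqF.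
Qed.

End children.

(** * The quadratic form of the Green operator *)

Section green_form.
Context {R : realType} (r : R).
Hypothesis r0 : 0 < r.
Local Notation qbox := (qbox r).
Local Notation side := (side r).
Variables (D : set (R3 R)) (A : R3 R -> 'M[R]_3).
Hypotheses (mD : measurable D) (Dfin : (mu3 D < +oo)%E).
Hypothesis HA : elliptic_coefficient D A.
Variables (U : (R3 R -> R) -> R3 R -> R) (W : (R3 R -> R) -> 'I_3 -> R3 R -> R).
Hypothesis US : forall f, L2f mu3 f -> sobolev0_with 2%:E D (U f) (W f).
Hypothesis UE : forall f u w, L2f mu3 f -> sobolev0_with 2%:E D u w ->
  ip mu3 f (u \_ D) = energy D A (W f) w.
Implicit Types (f g h : R3 R -> R).

Definition gform f g := ip mu3 f (U g \_ D).

Lemma L2f_W f i : L2f mu3 f -> L2f mu3 (W f i \_ D).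
Proof. by move=> /US[[_ /(_ i) /inLp2E]]. Qed.

Lemma L2f_U f : L2f mu3 f -> L2f mu3 (U f \_ D).
Proof. by move=> /US[[/inLp2E]]. Qed.

Lemma gformE f g : L2f mu3 f -> L2f mu3 g -> gform f g = energy D A (W f) (W g).
Proof. by move=> Lf Lg; rewrite /gform (UE Lf (US Lg)). Qed.

Lemma gformC f g : L2f mu3 f -> L2f mu3 g -> gform f g = gform g f.
Proof.
move=> Lf Lg; rewrite !gformE//.
by apply: (energyC HA) => j; exact: L2f_W.
Qed.

Lemma gform_coercive : exists2 l, 0 < l & forall f, L2f mu3 f ->
  l * \sum_i ip mu3 (W f i \_ D) (W f i \_ D) <= gform f f.
Proof.
have [l l0 hl] := energy_coercive HA.
by exists l => // f Lf; rewrite gformE//; apply: hl => j; exact: L2f_W.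
Qed.

Lemma gform_ge0 f : L2f mu3 f -> 0 <= gform f f.
Proof.
move=> Lf; have [l l0 hl] := gform_coercive; apply: le_trans (hl _ Lf).
by rewrite mulr_ge0 ?(ltW l0)// sumr_ge0// => i _; exact: ip_ge0.
Qed.

Lemma gformDl f g h : L2f mu3 f -> L2f mu3 g -> L2f mu3 h ->
  gform (fun x => f x + g x) h = gform f h + gform g h.
Proof. by move=> Lf Lg Lh; rewrite /gform ipDl//; exact: L2f_U. Qed.

Lemma gformZl a f h : L2f mu3 f -> L2f mu3 h ->
  gform (fun x => a * f x) h = a * gform f h.
Proof. by move=> Lf Lh; rewrite /gform ipZl//; exact: L2f_U. Qed.

Lemma gform_sqrD f g : L2f mu3 f -> L2f mu3 g ->
  gform (fun x => f x + g x) (fun x => f x + g x) =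
  gform f f + 2 * gform f g + gform g g.
Proof.
move=> Lf Lg; have Lfg := L2fD Lf Lg.
rewrite gformDl// (gformC Lf Lfg) (gformC Lg Lfg) !gformDl// (gformC Lg Lf); ring.
Qed.

Lemma gform_sqrZ a f : L2f mu3 f ->
  gform (fun x => a * f x) (fun x => a * f x) = a ^+ 2 * gform f f.
Proof.
move=> Lf; have La := L2fZ a Lf.
by rewrite gformZl// (gformC Lf La) gformZl// mulrA -expr2.
Qed.

(** Nonnegativity of the form at f - 2 g. The weights are unequal because the usual factor 2 on the
    first term would give exactly 2 / 64 = 1 / 32 in the recursion over levels and leave no room for
    the second term. *)
Lemma gform_sqrD_le f g : L2f mu3 f -> L2f mu3 g ->
  gform (fun x => f x + g x) (fun x => f x + g x) <=
  3 / 2 * gform f f + 3 * gform g g.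
Proof.
move=> Lf Lg; have Lh := L2fZ (-2) Lg.
have := gform_ge0 (L2fD Lf Lh); rewrite !gform_sqrD// gform_sqrZ//.
by rewrite (gformC Lf Lh) gformZl// (gformC Lg Lf); lra.
Qed.

(** The function is paired with its own potential. With g the value of the form and k the constant
    of [box_dev_ip_sqr], this gives g^2 <= k times the gradient energy, which coercivity bounds by g
    / l; hence g <= k / l. *)
Lemma gform_box_dev_le l L (c : pos L.+1) : 0 < l ->
  (forall f, L2f mu3 f ->
    l * \sum_i ip mu3 (W f i \_ D) (W f i \_ D) <= gform f f) ->
  gform (box_dev r c) (box_dev r c) <= 3 * side L.+1 ^+ 2 * side L ^+ 3 / l.
Proof.
move=> l0 hl; have Lb := L2f_box_dev r0 c.
have := box_dev_ip_sqr r0 mD Dfin c (US Lb); rewrite -/(gform _ _) => H1.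
have := gform_ge0 Lb; have := hl _ Lb.
have k0 : 0 <= 3 * side L.+1 ^+ 2 * side L ^+ 3.
  apply: mulr_ge0; first by rewrite mulr_ge0 ?sqr_ge0.
  by apply: exprn_ge0; exact: ltW (side_gt0 r0 _).
have : \sum_i ip mu3 (localize r (parent_pos c) (W (box_dev r c) i \_ D))
    (localize r (parent_pos c) (W (box_dev r c) i \_ D)) <=
    \sum_i ip mu3 (W (box_dev r c) i \_ D) (W (box_dev r c) i \_ D).
  apply: ler_sum => i _; have LW := L2f_W i Lb.
  apply: ip_norm_le => //; first exact: L2f_localize.
  move=> x; rewrite /localize normrM !qboxE ger0_norm//.
  by case: in_box; rewrite ?mul1r ?mul0r.
move: H1 k0; set k := 3 * _ * _; move: (gform _ _) (\sum_i _) (\sum_i _) => g s t.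
move=> g2 k0 st lt g0; rewrite ler_pdivlMr//.
move: g0; rewrite le_eqVlt => /orP[/eqP <-|g0]; first by rewrite mul0r.
rewrite -(ler_pM2l g0) mulrA -expr2; apply: (@le_trans _ _ (k * s * l)).
  by apply: ler_wpM2r; [exact: ltW|apply: (le_trans g2); exact: ler_wpM2l].
rewrite -mulrA [g * k]mulrC; apply: ler_wpM2l => //.
by apply: le_trans lt; rewrite mulrC; apply: ler_wpM2l => //; exact: ltW.
Qed.

(* A child is an eighth of its parent plus a [box_dev]; the induction closes since
   3/2 * (1/8)^2 < 1/32. *)
Lemma gform_qbox_le : exists2 K, 0 <= K & forall L (p : pos L),
  gform (qbox L (pos_nat p)) (qbox L (pos_nat p)) <= K / 32 ^+ L.
Proof.
have [l l0 hl] := gform_coercive.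
have g0 L (p : pos L) : 0 <= gform (qbox L (pos_nat p)) (qbox L (pos_nat p)).
  by apply: gform_ge0; exact: L2f_qbox.
(* The first term covers level 0. The second makes the [box_dev] bound at most K / 384 / 32^L, as
   288 / 384 = 3 / 4 = 3 (1 / 2)^2, and 384 is such that 3 / 128 + 3 / 384 = 1 / 32. *)
pose K := \sum_(p : pos 0) gform (qbox 0 (pos_nat p)) (qbox 0 (pos_nat p)) +
  288 * (4 * r) ^+ 5 / l.
have c0 : 0 <= 288 * (4 * r) ^+ 5 / l.
  by rewrite divr_ge0 ?(ltW l0)// mulr_ge0// exprn_ge0// mulr_ge0// ltW.
exists K; first by rewrite addr_ge0// sumr_ge0.
elim=> [p|L IH c].
  rewrite expr0 divr1 /K (bigD1 p)//= -addrA lerDl addr_ge0//.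
  by apply: sumr_ge0.
have Lq : L2f mu3 (qbox L (pos_nat (parent_pos c))) by exact: L2f_qbox.
have Lb := L2f_box_dev r0 c.
have -> : qbox L.+1 (pos_nat c) =
    fun x => 8^-1 * qbox L (pos_nat (parent_pos c)) x + box_dev r c x.
  by apply/funext => x; rewrite /box_dev; ring.
apply: (le_trans (gform_sqrD_le (L2fZ _ Lq) Lb)); rewrite gform_sqrZ//.
have := IH (parent_pos c); have := gform_box_dev_le c l0 hl.
have -> : 3 * side L.+1 ^+ 2 * side L ^+ 3 / l =
   (288 * (4 * r) ^+ 5 / l) / 384 / 32 ^+ L.
  have -> : side L.+1 = 4 * r / 2 ^+ L / 2 by rewrite sideS.
  have -> : side L = 4 * r / 2 ^+ L by [].
  have -> : 32 ^+ L = (2 ^+ L) ^+ 5 :> R by rewrite -exprM mulnC exprM; congr (_ ^+ _); ring.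
  by field; rewrite ?(gt_eqF l0) ?expf_neq0.
move=> hb hp; rewrite [32 ^+ L.+1]exprS.
have hK : 288 * (4 * r) ^+ 5 / l <= K by rewrite lerDr sumr_ge0.
have p0 : 0 <= (32 ^+ L)^-1 :> R by rewrite invr_ge0 exprn_ge0.
rewrite invfM [K * (_ / _)]mulrCA.
have {}hb : gform (box_dev r c) (box_dev r c) <= K / 384 / 32 ^+ L.
  by apply: (le_trans hb); rewrite ler_wpM2r// ler_wpM2r.
move: (gform _ _) (gform _ _) hb hp => x y.
rewrite [K / 384 / _]mulrAC; move: (K / 32 ^+ L) => z; lra.
Qed.

Definition box_energy L M := \sum_(p : pos L) \sum_(q : pos M)
  gform (qbox L (pos_nat p)) (qbox M (pos_nat q)) ^+ 2 / (side L ^+ 3 * side M ^+ 3).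

Lemma box_energyC L M : box_energy L M = box_energy M L.
Proof.
rewrite /box_energy exchange_big; apply: eq_bigr => q _; apply: eq_bigr => p _.
by rewrite gformC ?[side L ^+ 3 * _]mulrC//; exact: L2f_qbox.
Qed.

Lemma card_pos L : #|{: pos L}| = (8 ^ L)%N.
Proof. by rewrite card_ffun !card_ord -expnM mulnC expnM. Qed.

(** There are 8^M boxes, each with energy of order 32^-M divided by a volume of order 8^-M: a total
    of order 2^M. The squared side 4^-L compensates for it when M is L or L + 1, the two cases
    needed. *)
Lemma box_energy_step : exists2 C, 0 <= C & forall L M,
  box_energy L.+1 M - box_energy L M <= C * 2 ^+ M / 4 ^+ L.
Proof.
have [l l0 hl] := gform_coercive; have [K K0 hK] := gform_qbox_le.
exists (48 * K / (4 * r * l)).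
  by rewrite divr_ge0 ?mulr_ge0// ltW.
move=> L M; rewrite /box_energy exchange_big /= [X in _ - X]exchange_big /= -sumrB.
have sM := side_gt0 r0 M.
have c0 : 0 <= 192 * side L.+1 ^+ 2 by rewrite mulr_ge0 ?sqr_ge0.
have B (q : pos M) : \sum_(p : pos L.+1) gform (qbox L.+1 (pos_nat p)) (qbox M (pos_nat q)) ^+ 2 /
      (side L.+1 ^+ 3 * side M ^+ 3) -
    \sum_(p : pos L) gform (qbox L (pos_nat p)) (qbox M (pos_nat q)) ^+ 2 /
      (side L ^+ 3 * side M ^+ 3) <=
    192 * side L.+1 ^+ 2 * (K / 32 ^+ M / l) / side M ^+ 3.
  have Lq : L2f mu3 (qbox M (pos_nat q)) by exact: L2f_qbox.
  have := refine_gain r0 mD Dfin L (US Lq); rewrite -!mulr_suml => H.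
  have E (x y a b m : R) : x / (a * m) - y / (b * m) = (x / a - y / b) / m.
    by rewrite !invfM mulrBl !mulrA.
  rewrite E ler_wpM2r ?invr_ge0 ?exprn_ge0 ?(ltW sM)//.
  apply: (le_trans H); apply: ler_wpM2l => //.
  rewrite ler_pdivlMr// mulrC; apply: (le_trans (hl _ Lq)); exact: hK.
apply: (le_trans (ler_sum _ (fun q _ => B q))).
have -> k : \sum_(q : pos M) k = 8 ^+ M * k :> R.
  by rewrite -natrX -card_pos mulr_natl -sumr_const.
rewrite le_eqVlt; apply/orP; left; apply/eqP.
have -> : side L.+1 = 4 * r / 2 ^+ L / 2 by rewrite sideS.
have -> : side M = 4 * r / 2 ^+ M by [].
have -> : 32 ^+ M = (2 ^+ M) ^+ 5 :> R by rewrite -exprM mulnC exprM; congr (_ ^+ _); ring.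
have -> : 8 ^+ M = (2 ^+ M) ^+ 3 :> R by rewrite -exprM mulnC exprM; congr (_ ^+ _); ring.
have -> : 4 ^+ L = (2 ^+ L) ^+ 2 :> R by rewrite -exprM mulnC exprM; congr (_ ^+ _); ring.
by field; rewrite !(gt_eqF l0, gt_eqF r0, expf_neq0).
Qed.

Lemma box_energy_tail : exists2 C, 0 <= C & forall L M, (L <= M)%N ->
  box_energy M M <= box_energy L L + C / 2 ^+ L.
Proof.
have [C C0 H] := box_energy_step; exists (6 * C); first by rewrite mulr_ge0.
move=> L M /subnKC <-; set k := (M - L)%N.
have p0 n : 0 < 2 ^+ n :> R by rewrite exprn_gt0.
(* From level n to n + 1, the two variables cost C / 2^n and 2 C / 2^n. The subtracted term makes
   the induction close: it drops from 6 C / 2^n to 3 C / 2^n. *)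
suff : box_energy (L + k) (L + k) <=
    box_energy L L + 6 * C / 2 ^+ L - 6 * C / 2 ^+ (L + k).
  move=> h; apply: (le_trans h).
  by rewrite gerBl divr_ge0 ?mulr_ge0// ltW.
elim: k => [|k IH]; first by rewrite addn0 addrK.
rewrite addnS; move: (L + k)%N IH => n IH.
have h1 := H n n; have h2 := H n n.+1; rewrite (box_energyC n n.+1) in h2.
have E : 4 ^+ n = (2 ^+ n) ^+ 2 :> R by rewrite -exprM mulnC exprM; congr (_ ^+ _); ring.
have e1 : C * 2 ^+ n / 4 ^+ n = C / 2 ^+ n by rewrite E; field; rewrite gt_eqF.
have e2 : C * 2 ^+ n.+1 / 4 ^+ n = 2 * (C / 2 ^+ n).
  by rewrite E exprS; field; rewrite gt_eqF.
have e3 : 6 * C / 2 ^+ n.+1 = 3 * (C / 2 ^+ n) by rewrite exprS; field; rewrite gt_eqF.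
have e4 : 6 * C / 2 ^+ n = 6 * (C / 2 ^+ n) by rewrite mulrA.
rewrite e1 in h1; rewrite e2 in h2; rewrite e3; rewrite e4 in IH.
move: h1 h2 IH; move: (C / 2 ^+ n) (6 * C / 2 ^+ L) => x y; lra.
Qed.

End green_form.

(** * Orthogonal projections and uniqueness of weak solutions *)

Section orthogonal_projection.
Context d (T : measurableType d) (R : realType) (mu : {measure set T -> \bar R}).
Variables (I : finType) (e : I -> T -> R).
Hypothesis Le : forall i, L2f mu (e i).
Hypothesis orth : forall i j, i != j -> ip mu (e i) (e j) = 0.
Hypothesis e0 : forall i, 0 < ip mu (e i) (e i).
Implicit Types (f s : T -> R) (c : I -> R).

Lemma L2f_comb c : L2f mu (fun x => \sum_i c i * e i x).
Proof. by apply: L2f_sum => i _; exact: L2fZ. Qed.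

Lemma projection_le f : L2f mu f ->
  \sum_i ip mu f (e i) ^+ 2 / ip mu (e i) (e i) <= ip mu f f.
Proof.
move=> Lf; pose c i := ip mu f (e i) / ip mu (e i) (e i).
have := ip_ge0 mu (fun x => f x - \sum_i c i * e i x).
rewrite (ip_bessel c Lf Le orth).
have -> : \sum_i c i ^+ 2 * ip mu (e i) (e i) =
    \sum_i ip mu f (e i) ^+ 2 / ip mu (e i) (e i).
  by apply: eq_bigr => i _; rewrite /c; field; rewrite gt_eqF.
have -> : \sum_i c i * ip mu f (e i) = \sum_i ip mu f (e i) ^+ 2 / ip mu (e i) (e i).
  by apply: eq_bigr => i _; rewrite /c; field; rewrite gt_eqF.
by move: (\sum_i _) => S; lra.
Qed.

(** Converse of Bessel's inequality up to the distance to [s]. The comparison is pointwise, rather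
    than an equality of [s] with the combination, because a step function may be nonzero outside the
    big cube, where the boxes stop. *)
Lemma projection_ge f s c : L2f mu f -> L2f mu s ->
  (forall x, `|f x - \sum_i c i * e i x| <= `|f x - s x|) ->
  ip mu f f <= \sum_i ip mu f (e i) ^+ 2 / ip mu (e i) (e i) +
    ip mu (fun x => f x - s x) (fun x => f x - s x).
Proof.
move=> Lf Ls H.
have := ip_norm_le (L2fB Lf (L2f_comb c)) (L2fB Lf Ls) H.
rewrite (ip_bessel c Lf Le orth) => K.
have : 2 * (\sum_i c i * ip mu f (e i)) - \sum_i c i ^+ 2 * ip mu (e i) (e i) <=
    \sum_i ip mu f (e i) ^+ 2 / ip mu (e i) (e i).
  rewrite mulr_sumr -sumrB; apply: ler_sum => i _; rewrite ler_pdivlMr//.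
  have := sqr_ge0 (c i * ip mu (e i) (e i) - ip mu f (e i)).
  move: (c i) (ip mu f (e i)) (ip mu (e i) (e i)) => x y z; nra.
move: K; move: (\sum_i _) (\sum_i _) (\sum_i _) => x y z; lra.
Qed.

End orthogonal_projection.

Section uniqueness.
Context {R : realType} (r : R).
Hypothesis r0 : 0 < r.
Local Notation coord := Defs.coord.
Variables (D : set (R3 R)) (A : R3 R -> 'M[R]_3).
Hypotheses (mD : measurable D) (Dfin : (mu3 D < +oo)%E).
Hypothesis Dr : forall x, D x -> forall j, - r <= coord x j < r.
Hypothesis HA : elliptic_coefficient D A.

Lemma ip_qbox_gt0 L p : 0 < ip mu3 (qbox r L p) (qbox r L p).
Proof. by rewrite ip_qbox// exprn_gt0// side_gt0. Qed.

Lemma box_domain x : D x -> box0 r x.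
Proof.
move=> /Dr H; apply/box0_coord => j; rewrite /line0 /= in_itv /=.
by have /andP[-> h] := H j; rewrite (lt_trans h)// ltr_pMl// ltr1n.
Qed.

(* The points of [D] have coordinates below [r], so they avoid the upper corner
   box of level 1. *)
Lemma corner_box_off x (c : pos 1) : (forall j, c j = 1%N :> nat) -> D x ->
  qbox r 1 (pos_nat c) x = 0.
Proof.
move=> c1 /Dr H; rewrite /qbox; case: (boolP (in_box r 1 (pos_nat c) x)) => //.
move=> /forallP/(_ ord0); rewrite /pos_nat c1 cellE// in_itv /= => /andP[+ _].
have /andP[_ h] := H ord0; rewrite /corner expr1 mulr1 => h'.
by exfalso; move: h h'; lra.
Qed.

(** Step functions are dense, and on the big cube each is a combination of the boxes of some level,
    to which [d] is orthogonal. The positive and negative parts are approximated separately, as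
    [approximable_ge0] requires. *)
Lemma null_of_boxes d : L2f mu3 d -> (forall x, ~ box0 r x -> d x = 0) ->
  (forall L (p : pos L), ip mu3 (qbox r L (pos_nat p)) d = 0) -> ip mu3 d d = 0.
Proof.
move=> Ld d0 H.
have Lpos : L2f mu3 (fun x => Num.max (d x) 0).
  apply: (L2f_le _ Ld) => [|x]; first by apply: measurable_maxr => //; case: Ld.
  by rewrite /Num.max; case: ltP; rewrite ?normr0.
have Lneg : L2f mu3 (fun x => Num.max (- d x) 0).
  apply: (L2f_le _ Ld) => [|x].
    by apply: measurable_maxr => //; apply: measurableT_comp => //; case: Ld.
  by rewrite /Num.max; case: ltP; rewrite ?normr0 ?normrN.
have dE : d = fun x => Num.max (d x) 0 + (-1) * Num.max (- d x) 0.
  apply/funext => x; have [h|h] := leP 0 (d x).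
    by rewrite max_r ?oppr_le0// mulr0 addr0.
  by rewrite max_l ?oppr_ge0 ?(ltW h)// mulN1r opprK add0r.
have ge0 (f : R3 R -> R) : L2f mu3 f -> (forall x, 0 <= f x) ->
    (forall x, ~ box0 r x -> f x = 0) -> approximable mu3 (rl3 r) f.
  exact: (approximable_ge0 (@rl3S _ r) (measurable_box0 r) (box0_lty r) (dense3 r0)).
have ad : approximable mu3 (rl3 r) d.
  rewrite dE; apply: approximableD => //.
  - exact: rl3S.
  - exact: L2fZ.
  - apply: ge0 => // [x|x nx]; first by rewrite le_max lexx orbT.
    by rewrite d0// maxxx.
  - apply: approximableZ => //; apply: ge0 => // [x|x nx].
      by rewrite le_max lexx orbT.
    by rewrite d0// oppr0 maxxx.
apply/eqP; rewrite eq_le ip_ge0 andbT; apply/ler_addgt0Pr => e e0.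
have [s [Ls [M sM]] hs] := ad _ e0; rewrite add0r; apply: le_trans (ltW hs).
pose c (p : pos M) := s (box_corner r M (pos_nat p)).
have := @projection_ge _ _ _ mu3 _ (fun p : pos M => qbox r M (pos_nat p))
  (fun p => L2f_qbox r0 M (pos_nat p)) (fun p q => @ip_qbox_neq _ r M p q)
  (fun p => ip_qbox_gt0 M (pos_nat p)) d s c Ld Ls.
rewrite big1 ?add0r; last by move=> p _; rewrite ipC H expr0n /= mul0r.
apply => x; have [bx|nbx] := pselect (box0 r x).
  have [p hp] := box0_in_box r0 M bx.
  suff -> : \sum_i c i * qbox r M (pos_nat i) x = s x by [].
  rewrite (bigD1 p)//= big1 ?addr0; last first.
    move=> q qp; rewrite /qbox; case: (boolP (in_box r M (pos_nat q) x)) => [hq|]; last by rewrite mulr0.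
    by rewrite (pos_in_box_inj hq hp) eqxx in qp.
  by rewrite /qbox hp mulr1 /c -(sM _ _ (box_cornerP r0 hp)).
rewrite d0// sub0r big1 ?normrN ?normr0// => p _; rewrite /qbox.
by case: (boolP (in_box r M (pos_nat p) x)) => [/(in_box_box0 r0)//|]; rewrite mulr0.
Qed.

(** Coercivity kills the gradient of the difference [d], hence its pairings with all the [box_dev]:
    the integral of [d] over a child is an eighth of that over the parent. One box free of D then
    forces all these integrals to vanish; this takes the place of Poincare's inequality. *)
Lemma solves_unique f u1 u2 : solves D A f u1 -> solves D A f u2 ->
  ip mu3 ((fun x => u1 x - u2 x) \_ D) ((fun x => u1 x - u2 x) \_ D) = 0.
Proof.
move=> S1 S2.
have [w1 [H1 Lw1 L1 Lf E1]] := solves_gradient mD Dfin HA S1.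
have [w2 [H2 Lw2 L2 _ E2]] := solves_gradient mD Dfin HA S2.
pose w i x := w1 i x - w2 i x.
have wE i : w i \_ D = fun x => (w1 i \_ D) x - (w2 i \_ D) x.
  by apply/funext => x; rewrite !patchE; case: ifP => _; rewrite ?subr0.
have Lw i : L2f mu3 (w i \_ D) by rewrite wE; exact: L2fB.
have fluxE i : flux D A w i = fun x => flux D A w1 i x - flux D A w2 i x.
  apply/funext => x; rewrite /flux !patchE; case: ifP => _; rewrite ?subr0//.
  by rewrite -sumrB; apply: eq_bigr => j _; rewrite mulrBr.
have w0 i : ip mu3 (w i \_ D) (w i \_ D) = 0.
  have [l l0 hl] := energy_coercive HA.
  have : energy D A w w = 0.
    have LF1 j : L2f mu3 (flux D A w1 j) by exact: (L2f_flux HA).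
    have LF2 j : L2f mu3 (flux D A w2 j) by exact: (L2f_flux HA).
    transitivity ((energy D A w1 w1 - energy D A w2 w1) -
      (energy D A w1 w2 - energy D A w2 w2)).
      rewrite /energy -!sumrB; apply: eq_bigr => i' _.
      by rewrite fluxE wE ipBl ?ipBr//; try exact: L2fB; ring.
    by rewrite -(E1 _ _ H1) -(E2 _ _ H1) -(E1 _ _ H2) -(E2 _ _ H2) !subrr.
  move=> ww; have := hl w Lw; rewrite ww pmulr_rle0// => S0.
  apply/eqP; rewrite eq_le ip_ge0 andbT; apply: le_trans S0.
  by rewrite (bigD1 i)//= lerDl sumr_ge0// => j _; exact: ip_ge0.
have ipw i B : L2f mu3 B -> ip mu3 B (w1 i \_ D) = ip mu3 B (w2 i \_ D).
  move=> LB; apply/eqP; rewrite -subr_eq0 -ipBr//; rewrite -wE.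
  have := ip_cauchy_schwarz LB (Lw i); rewrite w0 mulr0 => h.
  by rewrite -sqrf_eq0 eq_le h sqr_ge0.
set d := (fun x => u1 x - u2 x) \_ D.
have dE : d = fun x => (u1 \_ D) x - (u2 \_ D) x.
  by apply/funext => x; rewrite /d !patchE; case: ifP => _; rewrite ?subr0.
have Ld : L2f mu3 d by rewrite dE; exact: L2fB.
have bc0 L (c : pos L.+1) : ip mu3 (box_dev r c) d = 0.
  have [B [LB _ HB]] := child_mean r0 mD Dfin c.
  rewrite dE ipBr//; last exact: L2f_box_dev.
  rewrite (sobolev0_ip mD Dfin H1 (L2f_box_dev r0 c) LB HB).
  rewrite (sobolev0_ip mD Dfin H2 (L2f_box_dev r0 c) LB HB).
  by apply/eqP; rewrite subr_eq0; apply/eqP/eq_bigr => i _; exact: ipw.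
have child L (c : pos L.+1) : ip mu3 (qbox r L.+1 (pos_nat c)) d =
    8^-1 * ip mu3 (qbox r L (pos_nat (parent_pos c))) d.
  apply/eqP; rewrite -subr_eq0 -ipZl//; last exact: L2f_qbox.
  rewrite -ipBl//; [|exact: L2f_qbox|by apply: L2fZ; exact: L2f_qbox].
  by apply/eqP; exact: bc0.
apply: null_of_boxes => //.
  move=> x nbx; rewrite /d patchE; case: ifPn => // /set_mem /box_domain//.
(* Level 0 has a single box. Its pairing with [d] is eight times that of its upper corner child,
   which avoids D. *)
elim=> [p|L IH c]; last by rewrite child IH mulr0.
pose c1 : pos 1 := [ffun=> Ordinal (isT : (1 < 2 ^ 1)%N)].
have -> : p = parent_pos c1.
  by apply/ffunP => j; apply: ord_inj; have := ltn_ord (p j); rewrite !ffunE /=; lia.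
have := child _ c1; have -> : ip mu3 (qbox r 1 (pos_nat c1)) d = 0.
  rewrite -(ip0l mu3 d); apply: eq_Rintegral => x _; rewrite mul0r /d patchE.
  case: ifPn => [/set_mem Dx|_]; last by rewrite mulr0.
  by rewrite corner_box_off ?mul0r// => j; rewrite ffunE.
by move/esym/eqP; rewrite mulf_eq0 invr_eq0 pnatr_eq0 /= => /eqP.
Qed.

End uniqueness.

(** * The approximation error *)

Lemma sqr_fin_num (R : realType) (x : \bar R) :
  (`|x| `^ 2)%E \is a fin_num -> x \is a fin_num.
Proof. by case: x => //=; rewrite pnatr_eq0. Qed.

Section extended_valued.
Context d (T : measurableType d) (R : realType) (mu : {measure set T -> \bar R}).
Implicit Types (F : T -> \bar R) (f : T -> R).

Lemma Lnorm2_ae_eq F f : measurable_fun setT F -> L2f mu f ->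
  ae_eq mu setT F (EFin \o f) -> 'N[mu]_2%:E[F]%E = (Num.sqrt (ip mu f f))%:E.
Proof.
move=> mF Lf Ff; rewrite -Lnorm2_ip// unlock /Lnorm; congr (_ `^ _)%E.
apply: ae_eq_integral => //.
- by apply: (measurableT_comp (measurable_poweR _)); exact: measurableT_comp.
- apply: (measurableT_comp (measurable_poweR _)); apply: measurableT_comp => //.
  by apply/measurable_EFinP; case: Lf.
- by move: Ff; apply: filterS => x h xT; rewrite /= h.
Qed.

Lemma Lnorm2_lty F : measurable_fun setT F -> ('N[mu]_2%:E[F] < +oo)%E ->
  [/\ mu.-integrable setT (fun x => `|F x| `^ 2)%E,
      ae_eq mu setT F (EFin \o (fine \o F)) & L2f mu (fine \o F)].
Proof.
move=> mF; rewrite unlock /Lnorm => /lty_poweRy; rewrite invr_eq0 pnatr_eq0 => /(_ isT) Foo.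
have m2 : measurable_fun setT (fun x => `|F x| `^ 2)%E.
  by apply: (measurableT_comp (measurable_poweR _)); exact: measurableT_comp.
have I2 : mu.-integrable setT (fun x => `|F x| `^ 2)%E.
  apply/integrableP; split => //; apply: le_lt_trans Foo.
  by apply: ge0_le_integral => //; [exact: measurableT_comp|move=> x _; rewrite gee0_abs// poweR_ge0].
have mf : measurable_fun setT (fine \o F).
  by apply: measurableT_comp => //; exact: fine_measurable.
split => //.
  have := integrable_ae measurableT I2; apply: filterS => x h /h /sqr_fin_num Fx.
  by rewrite /= fineK.
split => //; apply: (le_integrable measurableT _ _ I2).
  by apply/measurable_EFinP; exact: measurable_funX.
move=> x _; rewrite [X in (_ <= X)%E]gee0_abs ?poweR_ge0//=.
case: (F x) => [y||] /=; rewrite ?expr0n ?normr0 ?pnatr_eq0 ?leey//.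
by rewrite lee_fin normrX powR_mulrn.
Qed.

End extended_valued.

Section green_kernel.
Context {R : realType} (r : R).
Hypothesis r0 : 0 < r.
Local Notation coord := Defs.coord.
Variables (D : set (R3 R)) (A : R3 R -> 'M[R]_3) (G : R3 R * R3 R -> \bar R).
Hypotheses (mD : measurable D) (Dfin : (mu3 D < +oo)%E).
Hypothesis Dr : forall x, D x -> forall j, - r <= coord x j < r.
Hypothesis HA : elliptic_coefficient D A.
Hypothesis HG : green_function D A G.
Hypothesis HF : green_function_facts D A G.

Definition green0 : R3 R * R3 R -> \bar R := G \_ (D `*` D).
(** The kernel may be infinite while inner products are real; finiteness of its L^2 norm makes the
    two versions agree almost everywhere. *)
Definition real_green : R3 R * R3 R -> R := fine \o green0.

Lemma measurable_green0 : measurable_fun setT green0.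
Proof.
by apply/(measurable_restrictT _ (measurableX mD mD)); exact: green_measurable HG.
Qed.

Lemma real_greenP : [/\ mu6.-integrable setT (fun x => `|green0 x| `^ 2)%E,
  ae_eq mu6 setT green0 (EFin \o real_green) & L2f mu6 real_green].
Proof. by apply: Lnorm2_lty; [exact: measurable_green0|exact: green_L2 HF]. Qed.

Lemma real_green_ge0 z : 0 <= real_green z.
Proof.
rewrite /real_green /green0 /= patchE; case: ifPn => // /set_mem [Dx Dy].
by apply: fine_ge0; case: z Dx Dy => x y; exact: (green_ge0 HG).
Qed.

Lemma real_green_off z : ~ (D `*` D) z -> real_green z = 0.
Proof. by move=> nz; rewrite /real_green /green0 /= patchE memNset. Qed.

Lemma L2f_potential g : L2f mu3 g -> L2f mu3 (green_potential D G g \_ D).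
Proof.
move=> Lg; have Lg' : inLp 2%:E D g by apply/inLp2E; exact: L2f_restrict.
by have [_ [w [[[/inLp2E]]]]] := green_solves_L2 HF Lg'.
Qed.

(** Fubini's theorem. For almost every x the slice of the kernel is square integrable and finite
    almost everywhere, so that the extended-valued integral in [green_potential] is the real inner
    product. *)
Lemma ip_real_green f g : L2f mu3 f -> L2f mu3 g ->
  ip mu6 real_green (tensor f g) = ip mu3 f (green_potential D G g \_ D).
Proof.
move=> Lf Lg; have [I2 _ LH] := real_greenP.
have Hf := L2f_mul LH (L2f_tensor Lf Lg).
rewrite /ip /Rintegral -[X in fine X = _](integral12_prod_meas1 Hf).
congr fine; apply: ae_eq_integral => //.
- by have /measurable_int := integrable_fubini_F Hf.
- by apply/measurable_EFinP; apply: measurable_funM; [case: Lf|case: (L2f_potential Lg)].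
have := ae_integrable1 LH.2; have := ae_integrable1 I2.
apply: filterS2 => x Gx Hx _ /=.
have mH : measurable_fun setT (fun y => real_green (x, y)).
  by apply: measurableT_comp => //; case: LH.
have LHx : L2f mu3 (fun y => real_green (x, y)) by split.
rewrite /fubini_F /tensor /=.
have -> : (\int[mu3]_y (real_green (x, y) * (f x * g y))%:E)%E =
    (f x * ip mu3 (fun y => real_green (x, y)) g)%:E.
  rewrite -(ipZl _ LHx Lg) /ip /Rintegral fineK; last first.
    apply: integrable_fin_num => //.
    by have := L2f_mul (L2fZ (f x) LHx) Lg.
  by apply: eq_integral => y _; congr EFin; ring.
congr (_ * _)%:E; rewrite patchE; case: ifPn => [/set_mem Dx|]; last first.
  rewrite notin_setE => nDx; rewrite -[RHS](ip0l mu3 g); congr ip.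
  by apply/funext => y; rewrite real_green_off// => -[].
rewrite /green_potential integral_mkcond /ip /Rintegral; congr fine.
have gE : ((fun y => G (x, y) * (g y)%:E) \_ D)%E = (fun y => green0 (x, y) * (g y)%:E)%E.
  apply/funext => y; rewrite /green0 !patchE.
  case: ifPn => [/set_mem Dy|]; first by rewrite mem_set.
  by rewrite notin_setE => nDy; rewrite memNset ?mul0e// => -[].
rewrite gE; apply: ae_eq_integral => //.
- by apply/measurable_EFinP; apply: measurable_funM => //; case: Lg.
- apply: emeasurable_funM; last by apply/measurable_EFinP; case: Lg.
  by apply: measurableT_comp => //; exact: measurable_green0.
have := integrable_ae measurableT Gx; apply: filterS => y /(_ I) /sqr_fin_num h _.
by rewrite EFinM; congr (_ * _)%E; rewrite /real_green /= fineK.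
Qed.

End green_kernel.

Section approximation_error.
Context {R : realType} (r : R).
Hypothesis r0 : 0 < r.
Local Notation coord := Defs.coord.
Local Notation qbox := (qbox r).
Local Notation side := (side r).
Variables (D : set (R3 R)) (A : R3 R -> 'M[R]_3) (G : R3 R * R3 R -> \bar R).
Hypotheses (mD : measurable D) (Dfin : (mu3 D < +oo)%E).
Hypothesis Dr : forall x, D x -> forall j, - r <= coord x j < r.
Hypothesis HA : elliptic_coefficient D A.
Hypothesis HG : green_function D A G.
Hypothesis HF : green_function_facts D A G.
Local Notation U := (green_potential D G).
Local Notation H := (real_green D G).

Lemma potential_solves f : L2f mu3 f -> solves D A f (U f).
Proof.
by move=> Lf; apply: (green_solves_L2 HF); apply/inLp2E; exact: L2f_restrict.
Qed.

(** Supplies the map [W] required by the abstract form [gform]: a weak gradient is chosen for each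
    square-integrable input. *)
Lemma potential_gradient : exists W : (R3 R -> R) -> 'I_3 -> R3 R -> R,
  (forall f, L2f mu3 f -> sobolev0_with 2%:E D (U f) (W f)) /\
  (forall f u w, L2f mu3 f -> sobolev0_with 2%:E D u w ->
     ip mu3 f (u \_ D) = energy D A (W f) w).
Proof.
have /choice[W HW] : forall f, exists w, L2f mu3 f ->
    sobolev0_with 2%:E D (U f) w /\ forall u' w', sobolev0_with 2%:E D u' w' ->
    ip mu3 (f \_ D) (u' \_ D) = energy D A w w'.
  move=> f; have [Lf|nLf] := pselect (L2f mu3 f); last by exists (fun _ _ => 0).
  have [w [? _ _ _ ?]] := solves_gradient mD Dfin HA (potential_solves Lf).
  by exists w.
exists W; split=> [f /HW[]//|f u w Lf H0].
rewrite -((HW f Lf).2 _ _ H0).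
apply: eq_Rintegral => x _; rewrite !patchE; case: ifP => // _.
by rewrite mulr0 mul0r.
Qed.

Definition box2 L (i : pos L * pos L) : R3 R * R3 R -> R :=
  tensor (qbox L (pos_nat i.1)) (qbox L (pos_nat i.2)).

Lemma L2f_box2 L (i : pos L * pos L) : L2f mu6 (box2 i).
Proof. by apply: L2f_tensor; exact: L2f_qbox. Qed.

Lemma ip_box2 L (i : pos L * pos L) :
  ip mu6 (box2 i) (box2 i) = side L ^+ 3 * side L ^+ 3.
Proof. by rewrite ip_tensor ?ip_qbox//; exact: L2f_qbox. Qed.

Lemma ip_box2_neq L (i j : pos L * pos L) : i != j -> ip mu6 (box2 i) (box2 j) = 0.
Proof.
move=> ij; rewrite ip_tensor; try exact: L2f_qbox.
have [E|ne] := eqVneq i.1 j.1; last by rewrite (ip_qbox_neq r ne) mul0r.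
have [E'|ne] := eqVneq i.2 j.2; last by rewrite (ip_qbox_neq r ne) mulr0.
by move: ij; rewrite (surjective_pairing i) (surjective_pairing j) E E' eqxx.
Qed.

Lemma box_energyE L : box_energy r D U L L =
  \sum_(i : pos L * pos L) ip mu6 H (box2 i) ^+ 2 / ip mu6 (box2 i) (box2 i).
Proof.
rewrite /box_energy pair_bigA /=; apply: eq_bigr => -[p q] _.
by rewrite ip_box2 (ip_real_green mD HG HF)//; exact: L2f_qbox.
Qed.

Lemma green_approximable : approximable mu6 (rl6 r) H.
Proof.
have [_ _ LH] := real_greenP mD HG HF.
apply: (approximable_ge0 (@rl6S _ r)
  (measurableX (measurable_box0 r) (measurable_box0 r))
  (product_measure_lty (measurable_box0 r) (measurable_box0 r) (box0_lty r) (box0_lty r))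
  (dense6 r0)) => //.
- exact: (real_green_ge0 HG).
- move=> z nz; apply: real_green_off => -[D1 D2]; apply: nz.
  by split; exact: (box_domain r0 Dr).
Qed.

(** Density of step functions on the product, hence without a rate. The level can be taken beyond
    any [M], so as to be reached by [box_energy_tail]. *)
Lemma green_energy_lim M e : 0 < e -> exists2 N, (M <= N)%N &
  ip mu6 H H <= box_energy r D U N N + e.
Proof.
move=> e0; have [s [Ls [N' sN']] hs] := green_approximable e0.
have [_ _ LH] := real_greenP mD HG HF.
set N := maxn M N'; exists N; first exact: leq_maxl.
have sN x y : rl6 r N x y -> s x = s y.
  by move=> h; apply: sN'; apply: (rl_le (@rl6S _ r) _ h); exact: leq_maxr.
pose c (i : pos N * pos N) := s (box_corner r N (pos_nat i.1), box_corner r N (pos_nat i.2)).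
have n0 (i : pos N * pos N) : 0 < ip mu6 (box2 i) (box2 i).
  by rewrite ip_box2 mulr_gt0// exprn_gt0// side_gt0.
apply: le_trans (_ : _ <= box_energy r D U N N +
  ip mu6 (fun x => H x - s x) (fun x => H x - s x)) _; last first.
  by rewrite lerD2l ltW.
rewrite box_energyE.
apply: (projection_ge (@L2f_box2 N) (@ip_box2_neq N) n0 (c := c) LH Ls) => z.
have [[b1 b2]|nbz] := pselect ((box0 r `*` box0 r) z).
  have [p hp] := box0_in_box r0 N b1; have [q hq] := box0_in_box r0 N b2.
  suff -> : \sum_i c i * box2 i z = s z by [].
  rewrite (bigD1 (p, q))//= big1 ?addr0; last first.
    move=> [p' q'] pq; rewrite /box2 /tensor !qboxE /=.
    case: (boolP (in_box r N (pos_nat p') z.1)) => [hp'|]; last by rewrite mul0r mulr0.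
    case: (boolP (in_box r N (pos_nat q') z.2)) => [hq'|]; last by rewrite !mulr0.
    by rewrite (pos_in_box_inj hp' hp) (pos_in_box_inj hq' hq) eqxx in pq.
  rewrite /box2 /tensor !qboxE /= hp hq !mulr1 /c /=.
  by apply/esym/sN; split; exact: box_cornerP.
rewrite real_green_off; last first.
  by move=> [D1 D2]; apply: nbz; split; exact: (box_domain r0 Dr).
rewrite sub0r big1 ?normrN ?normr0// => -[p q] _; rewrite /box2 /tensor !qboxE /=.
case: (boolP (in_box r N (pos_nat p) z.1)) => [hp|]; last by rewrite mul0r mulr0.
case: (boolP (in_box r N (pos_nat q) z.2)) => [hq|]; last by rewrite !mulr0.
by exfalso; apply: nbz; split; [exact: (in_box_box0 r0 hp)|exact: (in_box_box0 r0 hq)].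
Qed.

(** The tail bound from [L] to a level where the energy is nearly complete. The constant is divided
    by the squared norm of the kernel, to make the error relative; a null kernel is set apart. *)
Lemma green_energy : exists2 C, 0 <= C & forall L,
  ip mu6 H H <= box_energy r D U L L + C / 2 ^+ L * ip mu6 H H.
Proof.
have [W [US UE]] := potential_gradient.
have [C C0 HC] := box_energy_tail r0 mD Dfin HA US UE.
have [H0|nH0] := eqVneq (ip mu6 H H) 0.
  exists 0 => // L; rewrite H0 mulr0 addr0 sumr_ge0// => p _; apply: sumr_ge0 => q _.
  by rewrite divr_ge0 ?sqr_ge0// mulr_ge0// exprn_ge0// ltW// side_gt0.
have H0 : 0 < ip mu6 H H by rewrite lt_def nH0 ip_ge0.
exists (C / ip mu6 H H) => [|L]; first by rewrite divr_ge0// ltW.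
rewrite mulrAC divfK//; apply/ler_addgt0Pr => e e0.
have [N LN h] := green_energy_lim L e0.
by apply: (le_trans h); rewrite lerD2r; exact: HC.
Qed.

Definition box_approximation L (u : pos L -> R3 R -> R) (z : R3 R * R3 R) : R :=
  \sum_q (side L ^+ 3)^-1 * (u q z.1 * qbox L (pos_nat q) z.2).

(** With coefficients 1 / |Q|, the cross terms and the squares in the expansion are both sums of
    ||u_Q||^2 / |Q|, so the error is ||G||^2 minus this sum. Bessel's inequality for each u_Q
    against the boxes then bounds the sum below by the box energy. *)
Lemma approximation_energy L (u : pos L -> R3 R -> R) :
  (forall q, solves D A (qbox L (pos_nat q)) (u q)) ->
  ip mu6
    (fun z => H z - \sum_q (side L ^+ 3)^-1 * tensor (u q \_ D) (qbox L (pos_nat q)) z)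
    (fun z => H z - \sum_q (side L ^+ 3)^-1 * tensor (u q \_ D) (qbox L (pos_nat q)) z)
  <= ip mu6 H H - box_energy r D U L L.
Proof.
move=> Su; have [_ _ LH] := real_greenP mD HG HF.
have Lq (q : pos L) : L2f mu3 (qbox L (pos_nat q)) by exact: L2f_qbox.
have Lu q : L2f mu3 (u q \_ D).
  by have [_ [w [[[/inLp2E]]]]] := Su q.
have LU (q : pos L) : L2f mu3 (U (qbox L (pos_nat q)) \_ D).
  by have [_ [w [[[/inLp2E]]]]] := potential_solves (Lq q).
(* The outputs are only known to solve the equation; uniqueness makes them interchangeable with the
   potentials in inner products. *)
have ipu q f : L2f mu3 f ->
    ip mu3 f (U (qbox L (pos_nat q)) \_ D) = ip mu3 f (u q \_ D).
  move=> Lf; apply/eqP; rewrite -subr_eq0 -ipBr//.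
  have := solves_unique r0 mD Dfin Dr HA (potential_solves (Lq q)) (Su q).
  set d := _ \_ D; have -> : (fun x => (U (qbox L (pos_nat q)) \_ D) x - (u q \_ D) x) = d.
    by apply/funext => x; rewrite /d !patchE; case: ifP => _; rewrite ?subr0.
  move=> d0; have Ld : L2f mu3 d.
    have -> : d = (fun x => (U (qbox L (pos_nat q)) \_ D) x - (u q \_ D) x).
      by apply/funext => x; rewrite /d !patchE; case: ifP => _; rewrite ?subr0.
    exact: L2fB.
  have := ip_cauchy_schwarz Lf Ld; rewrite d0 mulr0 => h.
  by rewrite -sqrf_eq0 eq_le h sqr_ge0.
have Le q : L2f mu6 (tensor (u q \_ D) (qbox L (pos_nat q))) by exact: L2f_tensor.
have orth (p q : pos L) : p != q -> ip mu6 (tensor (u p \_ D) (qbox L (pos_nat p)))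
    (tensor (u q \_ D) (qbox L (pos_nat q))) = 0.
  by move=> pq; rewrite ip_tensor// (ip_qbox_neq r pq) mulr0.
have V0 : 0 < side L ^+ 3 by rewrite exprn_gt0// side_gt0.
rewrite (ip_bessel (fun=> (side L ^+ 3)^-1) LH Le orth).
have -> : \sum_q (side L ^+ 3)^-1 * ip mu6 H (tensor (u q \_ D) (qbox L (pos_nat q))) =
    \sum_q (side L ^+ 3)^-1 * ip mu3 (u q \_ D) (u q \_ D).
  by apply: eq_bigr => q _; rewrite (ip_real_green mD HG HF)// ipu.
have -> : \sum_q (side L ^+ 3)^-1 ^+ 2 * ip mu6 (tensor (u q \_ D) (qbox L (pos_nat q)))
      (tensor (u q \_ D) (qbox L (pos_nat q))) =
    \sum_q (side L ^+ 3)^-1 * ip mu3 (u q \_ D) (u q \_ D).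
  apply: eq_bigr => q _; rewrite ip_tensor// ip_qbox//.
  by move: (side L ^+ 3) V0 (ip _ _ _) => V V0 x; field; rewrite gt_eqF.
suff : box_energy r D U L L <= \sum_q (side L ^+ 3)^-1 * ip mu3 (u q \_ D) (u q \_ D).
  by move: (\sum_q _) (box_energy _ _ _ _ _) => x y; lra.
rewrite /box_energy exchange_big /=; apply: ler_sum => q _.
have := @projection_le _ _ _ mu3 _ (fun p : pos L => qbox L (pos_nat p))
  (fun p => L2f_qbox r0 L (pos_nat p)) (fun p p' => @ip_qbox_neq _ r L p p')
  (fun p => ip_qbox_gt0 r0 L (pos_nat p)) _ (Lu q).
move=> /(ler_wpM2l (ltW (etrans (invr_gt0 _) V0))); apply: le_trans.
rewrite mulr_sumr; apply: ler_sum => p _.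
rewrite ip_qbox// /gform ipu// ipC invfM.
by rewrite [X in _ <= X]mulrC mulrA.
Qed.

Lemma approximation_error : exists2 C, 0 <= C &
  forall L (u : pos L -> R3 R -> R),
  (forall q, solves D A (qbox L (pos_nat q)) (u q)) ->
  (L2norm2 D D (fun z => G z - (box_approximation u z)%:E) <=
   (Num.sqrt (C / 2 ^+ L))%:E * L2norm2 D D G)%E.
Proof.
have [C C0 HC] := green_energy; exists C => // L u Su.
have [_ GH LH] := real_greenP mD HG HF.
have Lq (q : pos L) : L2f mu3 (qbox L (pos_nat q)) by exact: L2f_qbox.
have Lu q : L2f mu3 (u q \_ D).
  by have [_ [w [[[/inLp2E]]]]] := Su q.
pose t z := \sum_q (side L ^+ 3)^-1 * tensor (u q \_ D) (qbox L (pos_nat q)) z.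
have Lt : L2f mu6 t by apply: L2f_sum => q _; apply: L2fZ; exact: L2f_tensor.
have mDD : measurable (D `*` D) by exact: measurableX.
have tE z : (box_approximation u \_ (D `*` D)) z = (t \_ (D `*` D)) z.
  rewrite !patchE; case: ifPn => // /set_mem [D1 D2].
  by apply: eq_bigr => q _; rewrite /tensor patchE mem_set.
have Ld : L2f mu6 (fun z => H z - (t \_ (D `*` D)) z).
  by apply: L2fB => //; exact: L2f_restrict.
have E : (fun z => (G z - (box_approximation u z)%:E)%E) \_ (D `*` D) =
    (fun z => (green0 D G z - ((t \_ (D `*` D)) z)%:E)%E).
  apply/funext => z; rewrite -tE /green0 !patchE; case: ifP => // _.
  by rewrite sube0.
have -> : L2norm2 D D G = (Num.sqrt (ip mu6 H H))%:E.
  by apply: Lnorm2_ae_eq => //; exact: (measurable_green0 mD HG).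
rewrite /L2norm2 E (@Lnorm2_ae_eq _ _ _ _ _ _ _ Ld).
- rewrite -EFinM lee_fin -sqrtrM ?divr_ge0 ?exprn_ge0//; apply: ler_wsqrtr.
  apply: (@le_trans _ _ (ip mu6 (fun z => H z - t z) (fun z => H z - t z))).
    (* The boxes overlap the complement of D; cutting by [D x D] can only decrease the error, since
       the kernel vanishes outside. *)
    apply: ip_norm_le => //; first exact: L2fB.
    move=> z; rewrite patchE; case: ifPn => // /negP nz.
    by rewrite real_green_off ?subr0 ?normr0// => /mem_set.
  by apply: (le_trans (approximation_energy Su)); rewrite lerBlDl.
- apply: emeasurable_funB; first exact: (measurable_green0 mD HG).
  by apply/measurable_EFinP; case: (L2f_restrict mDD Lt).
- by move: GH; apply: filterS => z h zT; rewrite h.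
Qed.

End approximation_error.

(** * The quality of the covariance matrices *)

Section trace_inverse.
Context {R : realType} (k : nat) (C : 'M[R]_k) (m : R).
Hypothesis Csym : C^T = C.
Hypothesis Cpos : forall x : 'rV[R]_k, x != 0 -> 0 < (x *m C *m x^T) 0 0.
Hypothesis Cdiag : forall i, C i i <= m.

Let C_ge0 x : 0 <= bform C x x.
Proof. by rewrite /bform; have [->|/Cpos/ltW//] := eqVneq x 0; rewrite !mul0mx mxE. Qed.

Lemma posdef_unitmx : C \in unitmx.
Proof.
rewrite -row_free_unit -kermx_eq0 -submx0; apply/row_subP => i; rewrite submx0.
apply: contraT => /Cpos; have := mulmx_ker C; rewrite -row_mul.
by move=> ->; rewrite row0 mul0mx mxE ltxx.
Qed.

(* Cauchy-Schwarz for the form of [C] and the vectors [e_i C^-1] and [e_i]. *)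
Lemma posdef_inv_diag i : 1 <= invmx C i i * m.
Proof.
have Cu := posdef_unitmx.
pose e : 'rV[R]_k := delta_mx 0 i; pose y := e *m invmx C.
have yC : y *m C = e by rewrite /y mulmxKV.
have e1 : e 0 i = 1 by rewrite /e mxE !eqxx.
have mule (u : 'rV[R]_k) : (u *m e^T) 0 0 = u 0 i.
  rewrite mxE (bigD1 i)//= [e^T _ _]mxE e1 mulr1 big1 ?addr0// => j ji.
  by rewrite !mxE (negbTE ji) andbF mulr0.
have qye : bform C y e = 1 by rewrite /bform yC mule e1.
have qyy : bform C y y = invmx C i i.
  have -> : bform C y y = (e *m y^T)^T 0 0 by rewrite /bform yC [RHS]mxE.
  by rewrite trmx_mul trmxK mule /y -rowE mxE.
have qee : bform C e e = C i i by rewrite /bform mule -rowE mxE.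
have := bform_discriminant y e Csym C_ge0.
rewrite qye qyy qee expr1n => h; apply: (le_trans h); apply: ler_wpM2l => //.
by rewrite -qyy.
Qed.

Lemma tr_invmx_ge : 0 < m -> k%:R <= m * \tr (invmx C).
Proof.
move=> m0; rewrite /mxtrace mulr_sumr.
apply: (@le_trans _ _ (\sum_(i < k) 1)); first by rewrite sumr_const card_ord.
by apply: ler_sum => i _; rewrite mulrC; exact: posdef_inv_diag.
Qed.

End trace_inverse.

Section mercer.
Context {R : realType} (D : set (R3 R)).
Hypotheses (mD : measurable D) (Dfin : (mu3 D < +oo)%E).
Variables (K : R3 R * R3 R -> R) (lam : nat -> R) (psi : nat -> R3 R -> R).
Hypothesis HK : covariance_kernel D K lam psi.
Implicit Types (f g : R3 R -> R).

Lemma inner_ip (Y : set (R3 R)) f g : inner Y f g = ip mu3 (f \_ Y) (g \_ Y).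
Proof.
rewrite /inner Rintegral_mkcond; apply: eq_Rintegral => x _.
by rewrite !patchE; case: ifP => // _; rewrite mul0r.
Qed.

Let p j : R3 R -> R := psi j \_ D.

Let Lp j : L2f mu3 (p j).
Proof. by have [[/(_ j) /inLp2E]] := kernel_basis HK. Qed.

Let ipp i j : ip mu3 (p i) (p j) = (i == j)%:R.
Proof. by have [[_ <-] _] := kernel_basis HK; rewrite inner_ip. Qed.

Let mDD : measurable (D `*` D).
Proof. exact: measurableX. Qed.

Let DDfin : (mu6 (D `*` D) < +oo)%E.
Proof. exact: product_measure_lty. Qed.

Definition mercer_sum n (z : R3 R * R3 R) : R := \sum_(j < n) lam j * tensor (p j) (p j) z.

Lemma L2f_mercer_sum n : L2f mu6 (mercer_sum n).
Proof. by apply: L2f_sum => j _; apply: L2fZ; exact: L2f_tensor. Qed.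

Local Notation k0 := (K \_ (D `*` D)).

Lemma mercer_close e : 0 < e -> \forall n \near \oo,
  forall z, `|k0 z - mercer_sum n z| <= e * \1_(D `*` D) z.
Proof.
move=> /(kernel_unif_cvg HK); apply: filterS => n hn -[x y].
rewrite patchE indicE; case: ifPn => [xyD|nxyD].
  have [Dx Dy] := set_mem xyD; rewrite mulr1; apply: ltW.
  have := hn x y Dx Dy; congr (`|_ - _| < _); apply: eq_bigr => j _.
  by rewrite /tensor /p !patchE !mem_set//= mulrA.
rewrite mulr0 sub0r normrN normr_le0; apply/eqP/big1 => j _.
rewrite /tensor /p !patchE /=.
have [Dx|nDx] := boolP (x \in D); last by rewrite mul0r mulr0.
have [Dy|nDy] := boolP (y \in D); last by rewrite !mulr0.
by rewrite mem_set// in nxyD; split; exact: set_mem.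
Qed.

(** [K] is continuous only within [D x D]; the measurability of its extension by zero is read off
    the uniform limit of the Mercer sums. *)
Lemma measurable_kernel : measurable_fun setT k0.
Proof.
apply: (measurable_fun_cvg (h := mercer_sum)) => [n|z _].
  by case: (L2f_mercer_sum n).
apply/cvgrPdist_le => e e0; have := mercer_close e0; apply: filterS => n /(_ z) h.
apply: (le_trans h); rewrite indicE ger_pMr//.
by case: (_ \in _).
Qed.

Lemma L2f_kernel : L2f mu6 k0.
Proof.
have [n _ /(_ n (leqnn n)) h] := mercer_close ltr01.
have -> : k0 = fun z => (k0 z - mercer_sum n z) + mercer_sum n z.
  by apply/funext => z; rewrite subrK.
apply: L2fD; last exact: L2f_mercer_sum.
apply: (L2f_bounded mDD DDfin _ h); apply: measurable_funB.
  exact: measurable_kernel.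
by case: (L2f_mercer_sum n).
Qed.

Definition mform f g := ip mu6 k0 (tensor f g).

Lemma mform_lim f g e : L2f mu3 f -> L2f mu3 g -> 0 < e -> \forall n \near \oo,
  `|mform f g - \sum_(j < n) lam j * (ip mu3 (p j) f * ip mu3 (p j) g)| <= e.
Proof.
move=> Lf Lg e0; have Lfg := L2f_tensor Lf Lg.
have sqr_large (t : R) : 0 <= t -> t <= (1 + t) ^+ 2 by move=> t0; nra.
set V := ip mu6 (\1_(D `*` D)) (\1_(D `*` D)) * ip mu6 (tensor f g) (tensor f g).
have V0 : 0 <= V by rewrite mulr_ge0 ?ip_ge0.
(* With this tolerance, Cauchy-Schwarz bounds the squared error by e^2 V / (1 + V)^2, and V <= (1 +
   V)^2. *)
have c0 : 0 < e / (1 + V) by rewrite divr_gt0// ltr_wpDr.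
have := mercer_close c0; apply: filterS => n hn.
have L1 : L2f mu6 (fun z => e / (1 + V) * \1_(D `*` D) z).
  by apply: L2fZ; exact: L2f_indic.
have Ln := L2f_mercer_sum n; have Lk := L2fB L2f_kernel Ln.
have -> : \sum_(j < n) lam j * (ip mu3 (p j) f * ip mu3 (p j) g) =
    ip mu6 (mercer_sum n) (tensor f g).
  rewrite ip_suml//; last by move=> j _; apply: L2fZ; exact: L2f_tensor.
  by apply: eq_bigr => j _; rewrite ipZl ?ip_tensor//; exact: L2f_tensor.
rewrite /mform -ipBl//; last exact: L2f_kernel.
rewrite -(@ler_pXn2r _ 2)// ?nnegrE ?(ltW e0)// real_normK ?num_real//.
apply: (le_trans (ip_cauchy_schwarz Lk Lfg)).
have h := ip_norm_le Lk L1 (fun z => le_trans (hn z) (ler_norm _)).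
apply: (le_trans (ler_wpM2r (ip_ge0 _ _) h)).
rewrite ipZl ?ipZr//; try exact: L2f_indic.
have -> : e / (1 + V) * (e / (1 + V) * ip mu6 \1_(D `*` D) \1_(D `*` D)) *
   ip mu6 (tensor f g) (tensor f g) = e ^+ 2 * (V / (1 + V) ^+ 2).
  by rewrite /V; field; rewrite gt_eqF// ltr_wpDr.
rewrite -[X in _ <= X]mulr1 ler_wpM2l ?sqr_ge0// ler_pdivrMr ?mul1r.
  exact: sqr_large.
by rewrite exprn_gt0// ltr_wpDr.
Qed.

Lemma mformC f g : L2f mu3 f -> L2f mu3 g -> mform f g = mform g f.
Proof.
move=> Lf Lg; apply/eqP; rewrite -subr_eq0 -normr_le0; apply/ler_addgt0Pr => e e0.
have e2 : 0 < e / 2 by rewrite divr_gt0.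
have [n _ /(_ n (leqnn n)) [h1 h2]] := filterI (mform_lim Lf Lg e2) (mform_lim Lg Lf e2).
rewrite add0r; move: h1 h2.
under [X in _ -> `|_ - X| <= _ -> _]eq_bigr do rewrite [ip _ _ g * _]mulrC.
move: (mform f g) (mform g f) (\sum_(j < n) _) => x y z.
by rewrite !ler_norml => /andP[? ?] /andP[? ?]; apply/andP; split; lra.
Qed.

Lemma mform_ge j f : L2f mu3 f -> lam j * ip mu3 (p j) f ^+ 2 <= mform f f.
Proof.
move=> Lf; apply/ler_addgt0Pr => e e0.
(* Going j + 1 terms further ensures that the partial sum contains the term [j]. *)
have [n _ /(_ (n + j.+1)%N (leq_addr _ _))] := mform_lim Lf Lf e0.
have jn : (j < n + j.+1)%N by rewrite addnS ltnS leq_addl.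
rewrite (bigD1 (Ordinal jn))//= ler_norml => /andP[+ _].
have S0 : 0 <= \sum_(i < n + j.+1 | i != Ordinal jn)
    lam i * (ip mu3 (p i) f * ip mu3 (p i) f).
  by apply: sumr_ge0 => i _; rewrite -expr2 mulr_ge0 ?sqr_ge0// ltW// (kernel_lam_gt0 HK).
rewrite -expr2; move: S0; move: (mform f f) (lam j * _) (\sum_(i < _ | _) _) => x y z; lra.
Qed.

Lemma mform_le f : L2f mu3 f -> mform f f <= lam 0%N * ip mu3 f f.
Proof.
move=> Lf; apply/ler_addgt0Pr => e e0.
have [n _ /(_ n (leqnn n))] := mform_lim Lf Lf e0.
rewrite ler_norml => /andP[_].
have l0 := kernel_lam_gt0 HK 0%N.
have : \sum_(j < n) lam j * (ip mu3 (p j) f * ip mu3 (p j) f) <= lam 0%N * ip mu3 f f.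
  apply: (@le_trans _ _ (lam 0%N * \sum_(j < n) ip mu3 (p j) f ^+ 2)).
    rewrite mulr_sumr; apply: ler_sum => j _; rewrite -expr2 ler_wpM2r ?sqr_ge0//.
    exact: (kernel_lam_noninc HK).
  apply: ler_wpM2l; first exact: ltW.
  rewrite (eq_bigr (fun j : 'I_n => ip mu3 f (p j) ^+ 2 / ip mu3 (p j) (p j))).
    apply: (projection_le (e := fun j : 'I_n => p j)) => // [i j ij|i].
      by rewrite ipp (_ : (i == j :> nat) = false)//; apply/negbTE.
    by rewrite ipp eqxx.
  by move=> j _; rewrite ipp eqxx divr1 ipC.
move: (mform f f) (\sum_(j < n) _) (lam 0%N * _) => x y z; lra.
Qed.

(** Some coefficient of [f] on the eigenbasis is nonzero, otherwise all partial sums vanish and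
    their distance to [f], constantly its norm, could not tend to 0. The corresponding term of the
    Mercer series is positive. *)
Lemma mform_gt0 f : L2f mu3 (f \_ D) -> 0 < ip mu3 (f \_ D) (f \_ D) ->
  0 < mform (f \_ D) (f \_ D).
Proof.
move=> Lf f0.
have [j aj] : exists j, ip mu3 (p j) (f \_ D) != 0.
  apply: contrapT => /forallNP H.
  have a0 j : ip mu3 (p j) (f \_ D) = 0 by apply/eqP/negPn/negP/H.
  have /inLp2E fD := Lf; have := (kernel_basis HK).2 f fD.
  have -> : (fun n => Lp_dist 2%:E D f (fun x => \sum_(j < n) inner D f (psi j) * psi j x)) =
      fun=> (Num.sqrt (ip mu3 (f \_ D) (f \_ D)))%:E.
    apply/funext => n; rewrite /Lp_dist -Lnorm2_ip//; congr Lnorm.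
    apply/funext => x /=; congr EFin; rewrite !patchE; case: ifP => // _.
    by rewrite big1 ?subr0// => j _; rewrite inner_ip ipC a0 mul0r.
  move=> h; have E : 0%E = (Num.sqrt (ip mu3 (f \_ D) (f \_ D)))%:E.
    exact: (cvg_unique (@ereal_hausdorff R) h (cvg_cst _)).
  have /eqP := congr1 fine E.
  by rewrite /= eq_sym gt_eqF// sqrtr_gt0.
apply: lt_le_trans (mform_ge j Lf).
by rewrite mulr_gt0 ?(kernel_lam_gt0 HK)// lt_def sqr_ge0 andbT sqrf_eq0.
Qed.

Lemma gamma_bounds (Y : set (R3 R)) (v : nat -> R3 R -> R) (k : nat) : (0 < k)%N ->
  Y `<=` D -> orthonormal Y v -> 0 < gamma_quality D K lam Y v k <= 1.
Proof.
move=> k0 YD [vL vO]; pose h j := v j \_ Y.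
have Lh j : L2f mu3 (h j) by apply/inLp2E.
have hh i j : ip mu3 (h i) (h j) = (i == j)%:R by rewrite -vO inner_ip.
have CE (i j : 'I_k) : C_matrix D K Y v k i j = mform (h i) (h j).
  rewrite mxE Rintegral_mkcond; apply: eq_Rintegral => z _.
  by rewrite /tensor /h !patchE; case: ifP => _; rewrite ?mul0r//; ring.
have hD j : h j = h j \_ D.
  apply/funext => x; rewrite [RHS]patchE; case: ifPn => //.
  by rewrite notin_setE => nx; rewrite /h patchE memNset// => /YD.
pose w (x : 'rV[R]_k) := fun t : R3 R => \sum_(i < k) x 0 i * h i t.
have Lw x : L2f mu3 (w x) by apply: L2f_sum => i _; exact: L2fZ.
have ipw x : ip mu3 (w x) (w x) = \sum_i x 0 i ^+ 2.
  rewrite {1}/w ip_suml//; last by move=> i _; exact: L2fZ.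
  apply: eq_bigr => i _; rewrite ipZl// ip_sumr//; last by move=> j _; exact: L2fZ.
  rewrite (bigD1 i)//= ipZr// hh eqxx mulr1 big1 ?addr0 -?expr2// => j ji.
  by rewrite ipZr// hh (_ : (i == j :> nat) = false) ?mulr0//; apply/negbTE; rewrite eq_sym.
have qE x : (x *m C_matrix D K Y v k *m x^T) 0 0 = mform (w x) (w x).
  rewrite /mform; have -> : tensor (w x) (w x) =
      fun z => \sum_j \sum_i (x 0 j * x 0 i) * tensor (h i) (h j) z.
    apply/funext => z; rewrite /tensor /w mulrC mulr_suml; apply: eq_bigr => j _.
    by rewrite mulr_sumr; apply: eq_bigr => i _; ring.
  have Lij i j : L2f mu6 (tensor (h i) (h j)) by exact: L2f_tensor.
  rewrite mxE ip_sumr; [|by move=> j _; apply: L2f_sum => i _; exact: L2fZ|exact: L2f_kernel].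
  apply: eq_bigr => j _; rewrite ip_sumr; [|by move=> i _; exact: L2fZ|exact: L2f_kernel].
  rewrite !mxE mulr_suml; apply: eq_bigr => i _; rewrite ipZr//; last exact: L2f_kernel.
  by rewrite CE /mform; ring.
have l0 := kernel_lam_gt0 HK 0%N.
have wD x : w x = w x \_ D.
  apply/funext => t; rewrite patchE; case: ifPn => // nt.
  by rewrite /w big1// => i _; rewrite hD patchE (negbTE nt) mulr0.
have Csym : (C_matrix D K Y v k)^T = C_matrix D K Y v k.
  by apply/matrixP => i j; rewrite mxE !CE mformC.
have Cpos (x : 'rV[R]_k) : x != 0 -> 0 < (x *m C_matrix D K Y v k *m x^T) 0 0.
  move=> x0; rewrite qE wD; apply: mform_gt0; rewrite -wD// ipw lt_def sumr_ge0 ?andbT.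
    apply: contraNneq x0 => /psumr_eq0P x0; apply/eqP/rowP => i; rewrite mxE.
    by apply/eqP; rewrite -sqrf_eq0 x0// => j _; rewrite sqr_ge0.
  by move=> i _; rewrite sqr_ge0.
have Cdiag i : C_matrix D K Y v k i i <= lam 0%N.
  by rewrite CE; apply: (le_trans (mform_le (Lh i))); rewrite hh eqxx mulr1.
have := tr_invmx_ge Csym Cpos Cdiag l0; rewrite /gamma_quality.
have kR : 0 < k%:R :> R by rewrite ltr0n.
move=> H; have T0 := lt_le_trans kR H.
by rewrite divr_gt0//= ler_pdivrMr// mul1r.
Qed.

End mercer.

(** * Geometry of the domain and admissible pairs *)

Section domain_geometry.
Context {R : realType}.
Local Notation coord := Defs.coord.
Variable D : set (R3 R).
Implicit Types (x y : R3 R).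

Lemma coord_le_norm x j : `|coord x j| <= `|x|.
Proof.
have E : `|x| = Num.max (Num.max `|x.1.1| `|x.1.2|) `|x.2| by [].
rewrite E !le_max; case: j => -[|[|[|//]]] Hj; rewrite /coord/= lexx ?orbT//.
Qed.

Lemma coord_upd x i t : coord (upd x i t) i = t.
Proof. by case: i => -[|[|[|//]]] Hi. Qed.

Lemma bounded_coord : bounded_set D -> exists2 r : R, 0 < r &
  forall x, D x -> forall j, - r <= coord x j < r.
Proof.
move=> [M [_ /(_ (Num.max M 0 + 1))]] h.
have h1 : M < Num.max M 0 + 1 by rewrite (@le_lt_trans _ _ (Num.max M 0)) ?ltrDl// le_max lexx.
have m0 : 0 <= Num.max M 0 by rewrite le_max lexx orbT.
exists (Num.max M 0 + 2) => [|x Dx j]; first by rewrite ltr_wpDl.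
have := le_trans (coord_le_norm x j) (h h1 x Dx).
rewrite ler_norml => /andP[? ?]; apply/andP; split; lra.
Qed.

(** Openness lets a point move up along any axis. This gives a positive diameter, strict upper
    bounds on the normalized coordinates, and two points separated in one coordinate. *)
Lemma open_upd x i : open D -> D x -> exists2 t, coord x i < t & D (upd x i t).
Proof.
move=> oD Dx.
have xE : upd x i (coord x i) = x.
  by case: x {Dx} => -[x1 x2] x3; case: i => -[|[|[|//]]] Hi.
have : nbhs (coord x i) [set t | D (upd x i t)].
  apply: (@continuous_upd _ x i (coord x i)); rewrite xE.
  exact: open_nbhs_nbhs.
move=> /nbhs_ballP[e /= e0 He]; exists (coord x i + e / 2).
  by rewrite ltrDl divr_gt0.
apply: He; rewrite /ball/= opprD addrA subrr sub0r normrN gtr0_norm ?divr_gt0//.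
by rewrite ltr_pdivrMr// ltr_pMr// ltr1n.
Qed.

Lemma diam_gt0 : open D -> D !=set0 -> bounded_set D -> 0 < diam D.
Proof.
move=> oD [x Dx] bD; have [r r0 Hr] := bounded_coord bD.
have [t xt Dt] := open_upd ord0 oD Dx.
apply: (@lt_le_trans _ _ (edist x (upd x ord0 t))).
  rewrite sqrtr_gt0 (bigD1 ord0)//= ltr_pwDl//; last first.
    by apply: sumr_ge0 => i _; exact: sqr_ge0.
  by rewrite coord_upd lt_def sqr_ge0 andbT sqrf_eq0 subr_eq0 lt_eqF.
apply: sup_ubound; last by exists (x, upd x ord0 t).
exists (Num.sqrt (3 * (2 * r) ^+ 2)) => _ [[y z] [Dy Dz] <-] /=.
rewrite ler_wsqrtr// !big_ord_recl big_ord0 addr0.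
have H i : (coord y i - coord z i) ^+ 2 <= (2 * r) ^+ 2.
  have /andP[+ +] := Hr _ Dy i; have /andP[+ +] := Hr _ Dz i => /=.
  move: (coord y i) (coord z i) => s u *.
  by rewrite -subr_ge0 subr_sqr; apply: mulr_ge0; lra.
have := H ord0; have := H (lift ord0 ord0); have := H (lift ord0 (lift ord0 ord0)).
lra.
Qed.

End domain_geometry.

Section admissible_pairs.
Context {R : realType}.
Local Notation coord := Defs.coord.
Variables (D : set (R3 R)) (a : R3 R).
Hypotheses (oD : open D) (D0 : D !=set0) (bD : bounded_set D).
Hypothesis Ha : normalizing_origin D a.
Implicit Types (x y : R3 R) (L : nat).

Let dD : 0 < diam D := diam_gt0 oD D0 bD.

Lemma coord_normalize x i : coord (normalize D a x) i = (coord x i - coord a i) / diam D.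
Proof.
rewrite mulrC; case: x => -[x1 x2] x3; case: a => -[a1 a2] a3.
by case: i => -[|[|[|//]]] Hi.
Qed.

Lemma normalize_lt x y i : coord x i < coord y i ->
  coord (normalize D a x) i < coord (normalize D a y) i.
Proof. by move=> xy; rewrite !coord_normalize ltr_pM2r ?invr_gt0// ltrD2r. Qed.

(** The bound 1 is strict since a point of D with a larger coordinate also satisfies it. Truncation
    then always yields a valid cube index. *)
Lemma normalize_itv x i : D x -> 0 <= coord (normalize D a x) i < 1.
Proof.
move=> Dx; have /andP[-> _] /= := Ha Dx i.
have [t xt Dt] := open_upd i oD Dx; have /andP[_] := Ha Dt i.
by apply: lt_le_trans; apply: normalize_lt; rewrite coord_upd.
Qed.

Definition cube_index L x : position := fun i => Num.truncn (2 ^+ L * coord (normalize D a x) i).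

Lemma cube_index_itv L x i : D x ->
  (cube_index L x i)%:R <= 2 ^+ L * coord (normalize D a x) i < (cube_index L x i).+1%:R.
Proof.
move=> Dx; apply: truncn_itv; rewrite mulr_ge0 ?exprn_ge0//.
by have /andP[] := normalize_itv i Dx.
Qed.

Lemma cube_index_lt L x i : D x -> (cube_index L x i < 2 ^ L)%N.
Proof.
move=> Dx; have /andP[h _] := cube_index_itv L i Dx; rewrite -(ltr_nat R).
apply: (le_lt_trans h); rewrite natrX -[X in _ < X]mulr1 ltr_pM2l ?exprn_gt0//.
by have /andP[] := normalize_itv i Dx.
Qed.

Lemma cube_index_parent L x : D x -> parent (cube_index L.+1 x) = cube_index L x.
Proof.
move=> Dx; apply/funext => i; apply/esym/truncn_def; rewrite /parent.
have := cube_index_itv L.+1 i Dx; rewrite exprS -mulrA.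
move: (cube_index _ _ _) (2 ^+ L * _) => n t.
rewrite -{1 2}(odd_double_half n) -addnS -muln2 !natrD !natrM -!natr1.
by case: (odd n) => /= /andP[? ?]; apply/andP; split; lra.
Qed.

Lemma cube_index_part L x : D x -> part D a L (cube_index L x) x.
Proof.
move=> Dx; split=> // i; have /andP[h1 h2] := cube_index_itv L i Dx.
have p0 : 0 < 2 ^+ L :> R by rewrite exprn_gt0.
by rewrite ler_pdivrMr// ler_pdivlMr// mulrC h1 /= ltW.
Qed.

(** Follow the cubes of two points of D that differ in one coordinate. They are neighbours at level
    0 and no longer at a fine level; at the first level where they are not, their parents still are,
    which is admissibility. This level depends only on the two points. *)
Lemma admissible_pair : exists N, forall ckappa eps,
  N%:Z <= n_eps ckappa eps -> P_adm D a ckappa eps !=set0.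
Proof.
have [x Dx] := D0; have [t xt Dy] := open_upd ord0 oD Dx.
set y := upd x ord0 t in Dy.
pose P L := P_nonadm L (cube_index L x, cube_index L y).
have lt_xy : coord (normalize D a x) ord0 < coord (normalize D a y) ord0.
  by apply: normalize_lt; rewrite coord_upd.
(* Points of neighbouring cubes are less than two sides apart in each coordinate, hence the 2. *)
have [M hM] := pow2_gt (2 / (coord (normalize D a y) ord0 - coord (normalize D a x) ord0)).
have nPM : ~ P M.
  move=> /(_ ord0) /= [_ _ _]; rewrite -(ler_nat R) => h.
  have /andP[_ h1] := cube_index_itv M ord0 Dy; have /andP[h2 _] := cube_index_itv M ord0 Dx.
  rewrite -subr_gt0 in lt_xy; rewrite ltr_pdivrMr// mulrBr in hM.
  by move: h h1 h2 hM; rewrite -!natr1; move: (_ * _) (_ * _) => u v; lra.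
have exL : exists L, `[< ~ P L >] by exists M; exact/asboolP.
case: (ex_minnP exL) => N /asboolP nPN Nmin; exists N => ckappa eps hN.
have N0 : (0 < N)%N.
  rewrite lt0n; apply: contra_notN nPN => /eqP ->; move=> i /=.
  by have := cube_index_lt 0 i Dx; have := cube_index_lt 0 i Dy; rewrite expn0; case: (cube_index _ _ _) (cube_index _ _ _) => [|?] [|?].
have PN1 : P N.-1.
  apply: contrapT => nP; have /asboolP/Nmin := nP.
  by rewrite -ltnS prednK// ltnn.
exists (part D a N (cube_index N x), part D a N (cube_index N y)), N, (cube_index N x, cube_index N y); split => //=.
  split=> //; rewrite /children /=.
  by have := cube_index_parent N.-1 Dx; have := cube_index_parent N.-1 Dy; rewrite prednK// => -> ->.
by split; [exists x|exists y]; exact: cube_index_part.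
Qed.

Lemma Gamma_bounds K lam psi c ckappa eps
    (v : set (R3 R) -> set (R3 R) -> nat -> R3 R -> R)
    (G : R3 R * R3 R -> \bar R) :
  covariance_kernel D K lam psi -> 0 < eps < 1 ->
  P_adm D a ckappa eps !=set0 ->
  (forall XY, P_adm D a ckappa eps XY ->
     right_singular_functions G XY.1 XY.2 (v XY.1 XY.2)) ->
  0 < Gamma_eps D K lam a c ckappa eps v <= 1.
Proof.
move=> HK /andP[e0 e1] [XY0 adm0] Hv.
have mD : measurable D by exact: open_measurable3.
have Dfin : (mu3 D < +oo)%E.
  have [r r0 Dr] := bounded_coord bD; apply: le_lt_trans (box0_lty r).
  apply: le_measure; rewrite ?inE//; first exact: measurable_box0.
  exact: (box_domain r0 Dr).
have k0 : (0 < k_eps c eps)%N.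
  rewrite /k_eps addn_gt0; apply/orP; right.
  have l0 : 0 < logV eps by rewrite /logV ln_gt0// invf_gt1.
  have : (1 <= Num.ceil (logV eps)) by rewrite -gtz0_ge1 ceil_gt0.
  by lia.
have B XY : P_adm D a ckappa eps XY ->
    0 < gamma_quality D K lam XY.2 (v XY.1 XY.2) (k_eps c eps) <= 1.
  move=> admXY; have [s [e [_ _ vO _]]] := Hv _ admXY.
  apply: (gamma_bounds mD Dfin HK k0 _ vO).
  by have [L [q [_ _ _ -> _]]] := admXY => x [].
(* A positive lower bound on an infimum needs finitely many values: levels are at most [n] and all
   positions below 2^n, so a finite type enumerates the pairs of parts. *)
pose n := `|n_eps ckappa eps|%N.
pose I := ('I_n.+1 * ({ffun 'I_3 -> 'I_(2 ^ n)} * {ffun 'I_3 -> 'I_(2 ^ n)}))%type.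
pose F (i : I) := (part D a i.1 (fun j => i.2.1 j : nat), part D a i.1 (fun j => i.2.2 j : nat)).
have FE XY : P_adm D a ckappa eps XY -> exists i, F i = XY.
  move=> [L [[j j'] [L1 Ln [adm _] -> _]]].
  have Ln' : (L < n.+1)%N by rewrite /n; lia.
  have lt2 k : (k./2 < 2 ^ L.-1)%N -> (k < 2 ^ n)%N.
    rewrite ltn_half_double -mul2n -expnS prednK// => /leq_trans; apply.
    by rewrite leq_pexp2l.
  have hj i : (j i < 2 ^ n)%N by apply: lt2; have [] := adm i.
  have hj' i : (j' i < 2 ^ n)%N by apply: lt2; have [] := adm i.
  exists (Ordinal Ln', ([ffun i => Ordinal (hj i)], [ffun i => Ordinal (hj' i)])).
  by rewrite /F /=; congr (part _ _ _ _, part _ _ _ _); apply/funext => i; rewrite ffunE.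
pose g XY := gamma_quality D K lam XY.2 (v XY.1 XY.2) (k_eps c eps).
(* The default 1 is harmless: [m] only has to be a positive lower bound. *)
pose m := \big[Num.min/1]_(i : I | `[< P_adm D a ckappa eps (F i) >]) g (F i).
have m0 : 0 < m by apply/bigmin_gtP; split => // i /asboolP /B /andP[].
have mlb : lbound [set g XY | XY in P_adm D a ckappa eps] m.
  move=> _ [XY adm <-]; have [i Fi] := FE _ adm; rewrite -Fi.
  by apply: bigmin_le_cond; apply/asboolP; rewrite Fi.
apply/andP; split.
  by apply: (lt_le_trans m0); apply: lb_le_inf => //; exists (g XY0), XY0.
have /andP[_ h] := B _ adm0; apply: le_trans h; apply: ge_inf; last by exists XY0.
by exists m.
Qed.

End admissible_pairs.

(** * The algorithm *)

Section box_algorithm.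
Context {R : realType} (r : R).
Hypothesis r0 : 0 < r.
Variables (D : set (R3 R)) (K : R3 R * R3 R -> R).
Hypotheses (mD : measurable D).

Definition no_subdomain (i : 'I_0) : set (R3 R) := set0.
Definition no_draw (i : 'I_0) (_ : unit) : R3 R -> R := cst 0.

Lemma no_drawP :
  independent_gaussian_draws D K (\d_tt : probability unit R) no_subdomain no_draw.
Proof.
(* Without draws only the empty linear combination remains; it is 0, and the Gaussian law of
   variance 0 is the Dirac mass at 0. *)
split; [by case|by case|by case|] => -[|n] t b B mB; last by case: (t ord0).1.
rewrite !big_ord0 /gaussian_law eqxx !diracE; congr (nat_of_bool _)%:R%:E.
apply/idP/idP => /set_mem h; apply/mem_set.
  by move: h => /=; rewrite big_ord0.
by move: h => /=; rewrite big_ord0.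
Qed.

Variable L : nat.

Definition pos_of (i : nat) : pos L :=
  nth [ffun=> Ordinal (expn_gt0 2 L)] (enum {: pos L}) i.

Definition outputs_of (us : seq (R3 R -> R)) (q : pos L) : R3 R -> R :=
  nth (cst 0) us (enum_rank q).

(** The number of outputs received so far tells which box comes next. *)
Definition box_input (xi : 'I_0 -> R3 R -> R) (us : seq (R3 R -> R)) : R3 R -> R :=
  qbox r L (pos_nat (pos_of (size us))).

(* Outputs that are not square integrable cannot arise from a run of the
   algorithm, but the result must be square integrable for them as well. *)
Definition box_output (xi : 'I_0 -> R3 R -> R) (us : seq (R3 R -> R)) : R3 R * R3 R -> R :=
  if `[< forall q, L2f mu3 (outputs_of us q \_ D) >]
  then box_approximation r (outputs_of us) else cst 0.

Lemma box_inputP xi us : inLp 2%:E D (box_input xi us).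
Proof. by apply/inLp2E; apply: L2f_restrict => //; exact: L2f_qbox. Qed.

Lemma box_outputP xi us : (box_output xi us \_ (D `*` D)) \in Lfun mu6 2%:E.
Proof.
apply/L2fE; rewrite /box_output; case: asboolP => [Lu|_]; last first.
  rewrite (_ : _ \_ _ = fun=> 0); first exact: L2f0.
  by apply/funext => z; rewrite patchE; case: ifP.
have -> : box_approximation r (outputs_of us) \_ (D `*` D) =
   (fun z => \sum_q (side r L ^+ 3)^-1 *
     tensor (outputs_of us q \_ D) (qbox r L (pos_nat q)) z) \_ (D `*` D).
  apply/funext => z; rewrite !patchE; case: ifPn => // /set_mem [D1 D2].
  by apply: eq_bigr => q _; rewrite /tensor patchE mem_set.
apply: L2f_restrict; first exact: measurableX.
by apply: L2f_sum => q _; apply: L2fZ; apply: L2f_tensor => //; exact: L2f_qbox.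
Qed.

Definition box_algorithm : randomized_algorithm D K :=
  @RandomizedAlgorithm R D K _ unit (\d_tt : probability unit R) 0 no_subdomain
    no_draw no_drawP (8 ^ L) box_input box_inputP box_output box_outputP.

Lemma box_algorithm_transcript A (omega : ra_space box_algorithm) us :
  transcript A omega us ->
  (forall q, solves D A (qbox r L (pos_nat q)) (outputs_of us q)) /\
  green_approximation omega us = box_approximation r (outputs_of us).
Proof.
move=> [/= sz H].
have S q : solves D A (qbox r L (pos_nat q)) (outputs_of us q).
  have lt : (enum_rank q < 8 ^ L)%N by rewrite -(card_pos L); exact: ltn_ord.
  have := H _ lt; rewrite /box_input size_takel ?sz 1?ltnW//.
  by rewrite /pos_of nth_enum_rank.
split=> //; rewrite /green_approximation /= /box_output.
case: asboolP => // nL; exfalso; apply: nL => q.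
by have [_ [w [[[/inLp2E]]]]] := S q.
Qed.

End box_algorithm.

Section levels.
Context {R : realType}.
Implicit Types (eps M : R).

Lemma logV_large M : \forall eps \near (0 : R)^'+, M <= logV eps.
Proof.
near=> eps; have e0 : 0 < eps by near: eps; exact: nbhs_right_gt.
rewrite /logV lnV ?posrE// lerNr -[leRHS]expRK ler_ln ?posrE ?expR_gt0//.
by near: eps; apply: nbhs_right_ltW; exact: expR_gt0.
Unshelve. all: by end_near.
Qed.

(** The least level that reaches eps^-2; by minimality it overshoots by a factor at most 2, except
    that level 0 has no predecessor, whence the condition in the second bound. *)
Lemma grid_level eps : exists L : nat,
  eps ^- 2 <= 2 ^+ L /\ (1 <= eps ^- 2 -> 2 ^+ L <= 2 * eps ^- 2).
Proof.
have exL : exists L, (fun L => eps ^- 2 <= 2 ^+ L) L.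
  by have [L /ltW hL] := pow2_gt (eps ^- 2); exists L.
case: (ex_minnP exL) => L hL Lmin; exists L; split => // h1.
case: L hL Lmin => [|L] hL Lmin; first by rewrite expr0; lra.
rewrite exprS ler_pM2l// leNgt; apply/negP => /ltW /Lmin.
by rewrite ltnn.
Qed.

(** The term in [ckappa] is a fixed real number, whatever its value, while log_2 (1 / eps) tends to
    infinity. *)
Lemma n_eps_large (ckappa : R) (N : nat) :
  \forall eps \near (0 : R)^'+, N%:Z <= n_eps ckappa eps.
Proof.
set c0 := ln (54 * pi ^+ 2 * (6 + Num.sqrt 3) * ckappa ^+ 2) / ln 2.
have l2 : 0 < ln 2 :> R by rewrite ln_gt0// ltr1n.
have := logV_large ((N%:R - c0) * ln 2 / 2); apply: filterS => eps h.
rewrite -(ler_int R); apply: le_trans (ceil_ge _); rewrite -/c0 -[N%:~R]/(N%:R).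
rewrite -lerBlDl mulrA ler_pdivlMr//; lra.
Qed.

End levels.

Theorem theorem3 (R : realType)
    (D : set (R3 R)) (hD : lipschitz_domain D)
    (a : R3 R) (ha : normalizing_origin D a)
    (K : R3 R * R3 R -> R) (lam : nat -> R) (psi : nat -> R3 R -> R)
    (hK : covariance_kernel D K lam psi)
    (c ckappa : R) (hc : 0 < c) :
  exists alg : R -> randomized_algorithm D K,
    (exists C : R, \forall eps \near (0 : R)^'+,
       (ra_npairs (alg eps))%:R <= C * (eps ^- 6 * logV eps ^+ 4))
    /\
    forall (A : R3 R -> 'M[R]_3) (G : R3 R * R3 R -> \bar R)
      (v : set (R3 R) -> set (R3 R) -> nat -> R3 R -> R),
      elliptic_coefficient D A ->
      green_function D A G ->
      green_function_facts D A G ->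
      low_rank_constant D G c ->
      pointwise_constant D a G ckappa ->
      (forall eps : R, 0 < eps < 1 ->
         forall XY, P_adm D a ckappa eps XY ->
         right_singular_functions G XY.1 XY.2 (v XY.1 XY.2)) ->
      exists C C' : R, \forall eps \near (0 : R)^'+,
        exists E : set (ra_space (alg eps)),
          [/\ measurable E,
              ((1 - C' * eps `^ (logV eps - 6))%:E
                 <= ra_prob (alg eps) E)%E &
              forall omega, E omega ->
              forall us, transcript A omega us ->
              (L2norm2 D D (fun z => G z - (green_approximation omega us z)%:E)
               <= (C * ((Num.sqrt (Gamma_eps D K lam a c ckappa eps v))^-1
                        * logV eps ^+ 3 * eps))%:E * L2norm2 D D G)%E].
Proof.
have [oD _ D0 bD _] := hD.
have mD : measurable D by exact: open_measurable3.
have [r r0 Dr] := bounded_coord bD.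
have Dfin : (mu3 D < +oo)%E.
  apply: le_lt_trans (box0_lty r); apply: le_measure; rewrite ?inE//.
    exact: measurable_box0.
  exact: (box_domain r0 Dr).
have /choice[level Hlevel] := @grid_level R.
exists (fun eps => box_algorithm r0 K mD (level eps)); split.
  (* The number of pairs is the cube of 2^L <= 2 eps^-2, and log(1 / eps) >= 1 for small eps. *)
  exists 8; near=> eps.
  have e0 : 0 < eps by near: eps; exact: nbhs_right_gt.
  have e1 : eps < 1 by near: eps; exact: nbhs_right_lt.
  have l1 : 1 <= logV eps by near: eps; exact: logV_large.
  have [_ /(_ _) h] := Hlevel eps.
  have {}h : 2 ^+ level eps <= 2 * eps ^- 2.
    by apply: h; rewrite invf_ge1 ?exprn_gt0// exprn_ile1// ltW.
  have -> : (8 ^ level eps)%N%:R = (2 ^+ level eps) ^+ 3 :> R.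
    by rewrite natrX -exprM mulnC exprM; congr (_ ^+ _); ring.
  apply: (@le_trans _ _ ((2 * eps ^- 2) ^+ 3)).
    by rewrite lerXn2r ?nnegrE ?exprn_ge0// mulr_ge0// invr_ge0 exprn_ge0// ltW.
  have -> : (2 * eps ^- 2) ^+ 3 = 8 * eps ^- 6 by field; rewrite gt_eqF.
  rewrite mulrA ler_peMr ?exprn_ege1// mulr_ge0// invr_ge0 exprn_ge0// ltW.
move=> A G v HA HG HF _ _ Hv.
have [C C0 HC] := approximation_error r0 mD Dfin Dr HA HG HF.
have [N HN] := admissible_pair oD D0 bD ha.
(* The error bound holds at every sample point, so the event is the whole space and the failure
   constant is 0. *)
exists (Num.sqrt C), 0; near=> eps.
have e0 : 0 < eps by near: eps; exact: nbhs_right_gt.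
have e1 : eps < 1 by near: eps; exact: nbhs_right_lt.
have l1 : 1 <= logV eps by near: eps; exact: logV_large.
have e01 : 0 < eps < 1 by rewrite e0.
(* The infimum over an empty set would be 0 by convention, and with it the claimed error bound. *)
have adm : P_adm D a ckappa eps !=set0.
  by apply: HN; near: eps; exact: n_eps_large.
have /andP[G0 G1] := Gamma_bounds oD D0 bD c hK e01 adm (Hv _ e01).
exists setT; split => //; first by rewrite mul0r subr0 probability_setT.
move=> omega _ us /(box_algorithm_transcript (r0 := r0))[S ->].
apply: (le_trans (HC _ _ S)); apply: lee_wpmul2r; first exact: Lnorm_ge0.
rewrite lee_fin; apply: (@le_trans _ _ (Num.sqrt (C * eps ^+ 2))).
  apply: ler_wsqrtr; rewrite ler_wpM2l// invf_ple ?posrE ?exprn_gt0//.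
  by have [] := Hlevel eps.
rewrite sqrtrM// sqrtr_sqr gtr0_norm// ler_wpM2l ?sqrtr_ge0//.
(* Both Gamma_eps^(-1/2) and log^3(1 / eps) are at least 1, so an error of order eps is within the
   bound. *)
rewrite ler_peMl ?(ltW e0)// -[leLHS]mulr1 ler_pM//.
  by rewrite invf_ge1 ?sqrtr_gt0// -sqrtr1 ler_wsqrtr.
exact: exprn_ege1.
Unshelve. all: by end_near.
Qed.
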